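(* Let $n_+=\frac{9}{3+\sqrt3}=1.9019238\ldots$. There exists $n_{\rm h}\in(\frac32,n_+)$ such that for all $n$ with $0<n<n_{\rm h}$ the autonomous ordinary differential equation $$\phi'''+3(\mu-1)\phi''+(3\mu^2-6\mu+2)\phi'+\mu(\mu-1)(\mu-2)\phi+\frac{\phi}{|\phi|^n}=0,\qquad \mu=\frac3n,$$ for $\phi=\phi(s)$, $s\in\mathbb{R}$, admits a nontrivial stable periodic solution $\phi_*(s)$ of changing sign.
   Context: Since the nonlinearity $\phi/|\phi|^n$ is not smooth (and for $n\ge1$ is discontinuous or unbounded) at $\phi=0$, solutions are understood in the integrated sense: $\phi\in C^2(\mathbb{R})$, $\phi''$ is locally absolutely continuous, $\phi|\phi|^{-n}$ is locally integrable, and the equation holds for almost every $s$. Solutions are extended through generic transversal zeros, at which $|\phi|^{1-n}$ is integrable for $n<2$. ''Of changing sign'' means that $\phi_*$ takes both positive and negative values. ''Stable'' means that the periodic orbit of $\phi_*$ in the phase space of $(\phi,\phi',\phi'')$ is (orbitally) stable as $s\to+\infty$. *)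

(* Defs.v *)
From HB Require Import structures.
From mathcomp Require Import all_boot all_order all_algebra.
From mathcomp Require Import all_classical all_reals all_analysis.
Set Implicit Arguments.
Unset Strict Implicit.
Unset Printing Implicit Defensive.
Import Order.TTheory GRing.Theory Num.Theory.
Import numFieldNormedType.Exports.
Local Open Scope classical_set_scope.
Local Open Scope ring_scope.

Definition n_plus (R : realType) : R := 9 / (3 + Num.sqrt 3).

Definition absolutely_continuous_on (R : realType) (a b : R) (f : R -> R) :=
  forall e : R, 0 < e -> exists2 d : R, 0 < d &
    forall (k : nat) (x y : 'I_k -> R),
      (forall i, a <= x i /\ x i <= y i /\ y i <= b) ->
      trivIset [set: 'I_k] (fun i => `]x i, y i[%classic) ->
      \sum_(i < k) (y i - x i) < d ->
      \sum_(i < k) `|f (y i) - f (x i)| < e.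

Definition class_C2 (R : realType) (f : R -> R) :=
  [/\ forall s, derivable f s 1,
      forall s, derivable (derive1n 1 f) s 1 &
      continuous (derive1n 2 f)].

(* For [n != 0] this is [0] at [u = 0], because [0 `^ n = 0] and [0^-1 = 0]. *)
Definition nonlin (R : realType) (n u : R) : R := u / `|u| `^ n.

Definition ode (R : realType) (n : R) (phi : R -> R) (s : R) :=
  let mu := 3 / n in
  derive1n 3 phi s + 3 * (mu - 1) * derive1n 2 phi s
  + (3 * mu ^+ 2 - 6 * mu + 2) * derive1n 1 phi s
  + mu * (mu - 1) * (mu - 2) * phi s + nonlin n (phi s) = 0.

(* Solution on an interval [I], in the integrated sense.  The equation is
   imposed on [I] only.  When [I] is a proper closed interval, [phi] is C^2 up
   to the endpoints of [I]; it is then taken with some C^2 extension to the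
   whole line, which is always possible and whose choice is irrelevant, so that
   the two-sided derivatives at the endpoints are the one-sided ones. *)
Definition solution (R : realType) (n : R) (I : set R) (phi : R -> R) :=
  [/\ class_C2 phi,
      forall a b : R, a <= b -> `[a, b]%classic `<=` I ->
        absolutely_continuous_on a b (derive1n 2 phi),
      forall a b : R, a <= b -> `[a, b]%classic `<=` I ->
        (@lebesgue_measure R).-integrable `[a, b]%classic
          (EFin \o (fun s => nonlin n (phi s))) &
      {ae @lebesgue_measure R, forall s, I s ->
        derivable (derive1n 2 phi) s 1 /\ ode n phi s}].

Definition state (R : realType) (phi : R -> R) (s : R) : R * R * R :=
  (phi s, derive1n 1 phi s, derive1n 2 phi s).

Definition near_orbit (R : realType) (phi : R -> R) (e : R) (X : R * R * R) :=
  exists t : R, `|X - state phi t| < e.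

(* Lyapunov stability of the orbit as s -> +oo.  Uniqueness of solutions is not
   assumed: from initial data close to the orbit there is a solution for all
   s >= 0, and every solution, however short-lived, stays close. *)
Definition orbitally_stable (R : realType) (n : R) (phi : R -> R) :=
  forall e : R, 0 < e -> exists2 d : R, 0 < d &
    forall X : R * R * R, near_orbit phi d X ->
      (exists psi : R -> R, solution n `[0, +oo[%classic psi /\ state psi 0 = X) /\
      (forall (T : R) (psi : R -> R), 0 <= T ->
         solution n `[0, T]%classic psi -> state psi 0 = X ->
         forall s : R, 0 <= s <= T -> near_orbit phi e (state psi s)).

(* Main.v *)
From mathcomp Require Import all_boot all_order all_algebra.
From mathcomp Require Import all_classical all_reals all_analysis.
From mathcomp Require Import measurable_realfun ring lra.
Require Import Defs.
Set Implicit Arguments.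
Unset Strict Implicit.
Unset Printing Implicit Defensive.
Import Order.TTheory GRing.Theory Num.Theory.
Import numFieldNormedType.Exports.
Local Open Scope classical_set_scope.
Local Open Scope ring_scope.

(** Put [f y = y^mu phi (ln y)].  The weight [mu = 3 / n] is chosen so that the
    equation becomes [f''' = - f / |f|^n], which is invariant under translations,
    under [f -> - f] and under the scaling [f y -> L^mu f (y / L)].  In the variable
    [s = ln y] this scaling is a translation, so a solution [f] that reproduces
    itself at a larger scale is a periodic solution [phi].

    Between two zeros a solution is, up to symmetry, an arc: it starts with state
    [(0, 1, a)], is positive, and lands with slope [- nu] and second derivative [- b].
    The energy [f'^2 / 2 - f f''] increases, so [nu > 1]; rescaling the next arc to
    unit slope multiplies lengths by [expand a = nu^(1 / (mu - 1)) > 1] and gives it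
    the parameter [ret a = b expand^(2 - mu)].  A nontrivial periodic [phi] of
    changing sign is obtained from a point [a = ret (ret a)].

    The singular term is not Lipschitz at a zero of [f], but at a transversal zero
    [|f| >= m y], and the difference of two solutions is weighted by [y^(1 - n)],
    which is integrable for [n < 2]: this is [comparison], which gives uniqueness
    across zeros and, with an analysis of the landing, [arc_dependence].  Existence is
    obtained by truncating the nonlinearity below a small barrier, where Picard
    iteration applies, and removing the truncation by uniform estimates of the second
    derivative, which is monotone along a positive solution ([existence]).

    Every arc lands if [n <= 3 / 2]: a solution that stays positive grows at most like
    [y^2], and the integral of [y^(2 - 2 n)] diverges. If [n] is slightly larger, all
    arcs with [a] below a fixed bound still land, and this bound may be chosen above
    [ret 0] uniformly in [n] ([lands_gt1], [ret_flat]). This determines how far [n_h]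
    lies above [3 / 2].

    The return map [ret] is continuous, it is injective by uniqueness backwards in
    time, and it is large at large negative [a]; hence it is decreasing, and its square
    is an increasing map of an interval into its interior.  The supremum of the points
    that the square moves to the right is a fixed point with arbitrarily small
    invariant neighbourhoods on both sides, so stability needs no derivative of [ret]
    ([stable_two_cycle]).

    Orbital stability follows because the other coordinate, the position [z] of a zero
    in units of the length of the arc that starts there, satisfies
    [z' = (z + tau a) / expand a] and therefore contracts ([zq_contract]).  A solution
    starting near the orbit first completes a partial arc, possibly after a change of
    sign, and then follows arcs whose data stay near the cycle ([near_trajectory]).

    Finally, jets that solve the equation off their transversal zeros are the solutions
    in the integrated sense.  Between zeros the singular term has a constant sign and a
    continuous primitive, so it is integrable and the second derivative is absolutely
    continuous; conversely absolute continuity and a derivative given almost everywhere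
    determine the second derivative ([solution_of_psol], [psol_of_solution]).  With
    [psol_uniq] every solution starting near the orbit is one of those followed above. *)

(* Continuity and differentiability facts in the context slow linear arithmetic down. *)
Ltac keep_comparisons := repeat match goal with H : ?T |- _ =>
  match type of T with Prop =>
    lazymatch T with is_true _ => fail | @eq _ _ _ => fail | _ => clear H end end end.
Ltac lra_full := lra.
Ltac nra_full := nra.
Tactic Notation "lra" := keep_comparisons; lra_full.
Tactic Notation "nra" := keep_comparisons; nra_full.

(** * Calculus on the real line *)

Section Calculus.
Context {R : realType}.
Implicit Types (f g h k : R -> R) (a b c x y : R).

Lemma contP f x : {for x, continuous f} <->
  forall e, 0 < e -> exists2 d, 0 < d & forall y, `|y - x| < d -> `|f y - f x| < e.
Proof.
split=> [cf e e0|H].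
  move/cvgrPdist_lt : cf => /(_ e e0) /nbhs_ballP[d d0 H].
  exists d => // y yx; rewrite distrC; apply: H.
  by rewrite /ball /= distrC.
apply/cvgrPdist_lt => e e0; have [d d0 H'] := H e e0.
apply/nbhs_ballP; exists d => // y yx; rewrite distrC; apply: H'.
by move: yx; rewrite /ball /= distrC.
Qed.

Lemma near_realP x (P : R -> Prop) :
  (\near x, P x) <-> exists2 d, 0 < d & forall y, `|y - x| < d -> P y.
Proof.
split=> [/nbhs_ballP[d d0 H]|[d d0 H]].
  by exists d => // y yx; apply: H; rewrite /ball /= distrC.
by apply/nbhs_ballP; exists d => // y yx; apply: H; move: yx; rewrite /ball /= distrC.
Qed.

Lemma isD_add f g x a b : is_derive x 1 f a -> is_derive x 1 g b ->
  is_derive x 1 (fun y => f y + g y) (a + b).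
Proof. exact: is_deriveD. Qed.

Lemma isD_sub f g x a b : is_derive x 1 f a -> is_derive x 1 g b ->
  is_derive x 1 (fun y => f y - g y) (a - b).
Proof. exact: is_deriveB. Qed.

Lemma isD_opp f x a : is_derive x 1 f a -> is_derive x 1 (fun y => - f y) (- a).
Proof. exact: is_deriveN. Qed.

Lemma isD_mul f g x a b : is_derive x 1 f a -> is_derive x 1 g b ->
  is_derive x 1 (fun y => f y * g y) (f x * b + g x * a).
Proof. exact: is_deriveM. Qed.

Lemma isD_exp f n x a : is_derive x 1 f a ->
  is_derive x 1 (fun y => f y ^+ n) (n%:R * f x ^+ n.-1 * a).
Proof.
move=> fa; have -> : (fun y => f y ^+ n) = f ^+ n by apply/funext => y; rewrite exprfctE.
exact: is_deriveX.
Qed.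

Lemma isD_comp f g x a b : is_derive (g x) 1 f a -> is_derive x 1 g b ->
  is_derive x 1 (fun y => f (g y)) (a * b).
Proof. exact: is_derive1_comp. Qed.

Lemma isD_pow f x a p : 0 < f x -> is_derive x 1 f a ->
  is_derive x 1 (fun y => f y `^ p) (p * f x `^ (p - 1) * a).
Proof.
by move=> fx fa; apply: (@isD_comp (fun u => u `^ p)) fa; exact: is_derive1_powR.
Qed.

Lemma isD_expR f x a : is_derive x 1 f a ->
  is_derive x 1 (fun y => expR (f y)) (expR (f x) * a).
Proof. by move=> fa; apply: isD_comp fa. Qed.

Lemma isD_ln f x a : 0 < f x -> is_derive x 1 f a ->
  is_derive x 1 (fun y => ln (f y)) ((f x)^-1 * a).
Proof. by move=> fx fa; apply: (@isD_comp (@ln R)) fa; exact: is_derive1_ln. Qed.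

Lemma isD_eq f x a b : is_derive x 1 f a -> a = b -> is_derive x 1 f b.
Proof. by move=> fa <-. Qed.

Lemma isD_id x : is_derive x 1 (fun y : R => y) 1.
Proof. exact: is_derive_id. Qed.

Lemma isD_cst a x : is_derive x 1 (fun _ : R => a) 0.
Proof. exact: is_derive_cst. Qed.

Lemma isD_near f g x d : (exists2 e, 0 < e & forall y, `|y - x| < e -> f y = g y) ->
  is_derive x 1 f d -> is_derive x 1 g d.
Proof. by move=> /near_realP fg; exact: near_eq_is_derive. Qed.

Lemma isD_cont f x d : is_derive x 1 f d -> {for x, continuous f}.
Proof. by move=> [df _]; apply: differentiable_continuous; apply/derivable1_diffP. Qed.

Lemma cont_add f g : continuous f -> continuous g -> continuous (fun y => f y + g y).
Proof. by move=> cf cg x; apply: continuousD; [exact: cf|exact: cg]. Qed.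

Lemma cont_sub f g : continuous f -> continuous g -> continuous (fun y => f y - g y).
Proof. by move=> cf cg x; apply: continuousB; [exact: cf|exact: cg]. Qed.

Lemma cont_opp f : continuous f -> continuous (fun y => - f y).
Proof. by move=> cf x; apply: continuousN; exact: cf. Qed.

Lemma cont_mul f g : continuous f -> continuous g -> continuous (fun y => f y * g y).
Proof. by move=> cf cg x; apply: continuousM; [exact: cf|exact: cg]. Qed.

Lemma cont_exp f n : continuous f -> continuous (fun y => f y ^+ n).
Proof.
move=> cf; elim: n => [|n IH]; first by move=> x; exact: cst_continuous.
by under eq_fun do rewrite exprS; exact: cont_mul.
Qed.

Lemma cont_comp f g : continuous f -> continuous g -> continuous (fun y => f (g y)).
Proof. by move=> cf cg x; apply: continuous_comp; [exact: cg|exact: cf]. Qed.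

Lemma cont_id : continuous (fun y : R => y).
Proof. by move=> x; exact: cvg_id. Qed.

Lemma cont_cst a : continuous (fun _ : R => a).
Proof. by move=> x; exact: cvg_cst. Qed.

Lemma cont_max a : continuous (fun y => Num.max y a).
Proof.
move=> x; apply/contP => e e0; exists e => // y yx.
apply: le_lt_trans yx; have := ler_norm (y - x); have := ler_norm (x - y).
rewrite distrC ler_norml; case: (leP x a) => ?; case: (leP y a) => ?; lra.
Qed.

Lemma cont_min a : continuous (fun y => Num.min y a).
Proof.
move=> x; apply/contP => e e0; exists e => // y yx.
apply: le_lt_trans yx; have := ler_norm (y - x); have := ler_norm (x - y).
rewrite distrC ler_norml; case: (leP x a) => ?; case: (leP y a) => ?; lra.
Qed.

Lemma cont_expR f : continuous f -> continuous (fun y => expR (f y)).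
Proof. by apply: cont_comp; exact: continuous_expR. Qed.

End Calculus.

(* Structural differentiation and continuity; the leaves are left as goals. *)
Ltac der := lazymatch goal with
  | |- is_derive _ _ (fun _ => ?c) _ => exact: isD_cst
  | |- is_derive _ _ (fun y => y) _ => exact: isD_id
  | |- is_derive ?x ?v (+%R ?a) ?d => change (is_derive x v (fun y => a + y) d); der
  | |- is_derive ?x ?v ( *%R ?a) ?d => change (is_derive x v (fun y => a * y) d); der
  | |- is_derive ?x _ (fun y => @?f y + @?g y) _ =>
      notypeclasses refine (@isD_add _ f g x _ _ _ _); cbv beta; der
  | |- is_derive ?x _ (fun y => - @?f y) _ =>
      notypeclasses refine (@isD_opp _ f x _ _); cbv beta; der
  | |- is_derive ?x _ (fun y => @?f y * @?g y) _ =>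
      notypeclasses refine (@isD_mul _ f g x _ _ _ _); cbv beta; der
  | |- is_derive ?x _ (fun y => @?f y ^+ ?n) _ =>
      notypeclasses refine (@isD_exp _ f n x _ _); cbv beta; der
  | |- is_derive ?x _ (fun y => @?f y `^ ?p) _ =>
      notypeclasses refine (@isD_pow _ f x _ p _ _); cbv beta; [|der]
  | |- is_derive ?x _ (fun y => expR (@?f y)) _ =>
      notypeclasses refine (@isD_expR _ f x _ _); cbv beta; der
  | |- is_derive ?x _ (fun y => ln (@?f y)) _ =>
      notypeclasses refine (@isD_ln _ f x _ _ _); cbv beta; [|der]
  | _ => try eassumption
  end.

Ltac ders := notypeclasses refine (@isD_eq _ _ _ _ _ _ _); [der|cbv beta].

Ltac conts := lazymatch goal with
  | |- continuous (fun _ => ?c) => exact: cont_cst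
  | |- continuous (fun y => y) => exact: cont_id
  | |- continuous (+%R ?a) => change (continuous (fun y => a + y)); conts
  | |- continuous ( *%R ?a) => change (continuous (fun y => a * y)); conts
  | |- continuous (fun y => @?f y + @?g y) => apply: (@cont_add _ f g); cbv beta; conts
  | |- continuous (fun y => - @?f y) => apply: (@cont_opp _ f); cbv beta; conts
  | |- continuous (fun y => @?f y * @?g y) => apply: (@cont_mul _ f g); cbv beta; conts
  | |- continuous (fun y => @?f y ^+ ?n) => apply: (@cont_exp _ f n); cbv beta; conts
  | |- continuous (fun y => expR (@?f y)) => apply: (@cont_expR _ f); cbv beta; conts
  | _ => try assumption
  end.

Section MeanValue.
Context {R : realType}.
Implicit Types (f g h k : R -> R) (a b c x y : R).

(** ** Mean value theorems *)

Lemma mvt_ex f df a b : a < b -> continuous f ->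
  (forall x, a < x < b -> is_derive x 1 f (df x)) ->
  exists2 c, a < c < b & f b - f a = df c * (b - a).
Proof.
move=> ab cf dfx.
have H x : x \in `]a, b[%R -> is_derive x 1 f (df x).
  by rewrite in_itv /=; exact: dfx.
have [c + E] := MVT ab H (continuous_subspaceT cf).
by rewrite in_itv /= => cab; exists c.
Qed.

Lemma mvt_closed f df a b : a < b ->
  (forall x, a <= x <= b -> is_derive x 1 f (df x)) ->
  exists2 c, a < c < b & f b - f a = df c * (b - a).
Proof.
move=> ab dfx.
have H x : x \in `]a, b[%R -> is_derive x 1 f (df x).
  by rewrite in_itv /= => /andP[x1 x2]; apply: dfx; rewrite !ltW.
have cf : {within `[a, b], continuous f}.
  apply/continuous_in_subspaceT => x; rewrite inE /= in_itv /= => xab.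
  by apply: isD_cont; exact: dfx.
have [c + E] := MVT ab H cf.
by rewrite in_itv /= => cab; exists c.
Qed.

Lemma mvt_le f a b : a <= b -> continuous f ->
  (forall x, a < x < b -> exists2 d, is_derive x 1 f d & 0 <= d) -> f a <= f b.
Proof.
rewrite le_eqVlt => /predU1P[->//|ab] cf H.
have H' x : a < x < b -> is_derive x 1 f ('D_1 f x).
  by move=> xab; have [d fd _] := H x xab; apply: derivableP; case: fd.
have [c cab E] := mvt_ex ab cf H'.
have [d fd d0] := H c cab.
by case: fd => _ Dd; rewrite -subr_ge0 E Dd mulr_ge0 // subr_ge0 ltW.
Qed.

Lemma mvt_lt f a b : a < b -> continuous f ->
  (forall x, a < x < b -> exists2 d, is_derive x 1 f d & 0 < d) -> f a < f b.
Proof.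
move=> ab cf H.
have H' x : a < x < b -> is_derive x 1 f ('D_1 f x).
  by move=> xab; have [d fd _] := H x xab; apply: derivableP; case: fd.
have [c cab E] := mvt_ex ab cf H'.
have [d fd d0] := H c cab.
by case: fd => _ Dd; rewrite -subr_gt0 E Dd mulr_gt0 // subr_gt0.
Qed.

Lemma mvt_ge f a b : a <= b -> continuous f ->
  (forall x, a < x < b -> exists2 d, is_derive x 1 f d & d <= 0) -> f b <= f a.
Proof.
move=> ab cf H; rewrite -lerN2; apply: (@mvt_le (fun y => - f y)) => //.
  exact: cont_opp.
by move=> x xab; have [d fd d0] := H x xab; exists (- d); [exact: isD_opp|lra].
Qed.

Lemma mvt_bound f a b M : a <= b -> continuous f ->
  (forall x, a < x < b -> exists2 d, is_derive x 1 f d & `|d| <= M) ->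
  `|f b - f a| <= M * (b - a).
Proof.
move=> ab cf H; rewrite ler_norml.
have cM : continuous (fun y => M * y) by conts.
have DM x : is_derive x 1 (fun y => M * y) M by ders; ring.
have : f a + M * a <= f b + M * b.
  apply: (@mvt_le (fun y => f y + M * y)) => //; first exact: cont_add.
  move=> x xab; have [d fd] := H x xab; rewrite ler_norml => d0.
  by exists (d + M); [exact: isD_add|lra].
have : M * a - f a <= M * b - f b.
  apply: (@mvt_le (fun y => M * y - f y)) => //; first exact: cont_sub.
  move=> x xab; have [d fd] := H x xab; rewrite ler_norml => d0.
  by exists (M - d); [exact: isD_sub|lra].
by lra.
Qed.

Lemma mvt_cst f a b : a <= b -> continuous f ->
  (forall x, a < x < b -> is_derive x 1 f 0) -> f b = f a.
Proof.
move=> ab cf H; apply/eqP; rewrite -subr_eq0 -normr_le0.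
have := @mvt_bound f a b 0 ab cf; rewrite mul0r; apply => x xab.
by exists 0; [exact: H|rewrite normr0].
Qed.

(** ** Induction along an interval *)

Lemma real_ind (P : R -> Prop) a b : P a ->
  (forall x, a <= x < b -> (forall y, a <= y <= x -> P y) ->
     exists2 d, 0 < d & forall y, x < y < x + d -> y <= b -> P y) ->
  (forall x, a < x <= b -> (forall y, a <= y < x -> P y) -> P x) ->
  forall x, a <= x <= b -> P x.
Proof.
move=> Pa Pr Pl x0 /andP[ax0 x0b].
pose S := [set x | a <= x <= b /\ forall y, a <= y <= x -> P y].
have ab : a <= b by lra.
have Sa : S a.
  split; first by rewrite lexx.
  by move=> y ya; have -> : y = a by lra.
have hS : has_sup S by split; [exists a|exists b => x [/andP[]]].
pose s := sup S.
have as_ : a <= s by apply: ub_le_sup; [exact: hS.2|].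
have sb : s <= b by apply: ge_sup; [exact: hS.1|move=> x [/andP[]]].
have Plt y : a <= y < s -> P y.
  move=> /andP[ay ys].
  have [z Sz yz] := sup_adherent (eps := s - y) ltac:(lra) hS.
  case: Sz => _; apply; rewrite /s in yz *; lra.
have Ps : P s.
  have [->//|ne] := eqVneq s a.
  by apply: Pl => //; rewrite sb andbT lt_neqAle eq_sym ne.
have Ple y : a <= y <= s -> P y.
  move=> /andP[ay]; rewrite le_eqVlt => /predU1P[->//|ys]; apply: Plt; lra.
have [bs|sltb] := leP b s; first by apply: Ple; lra.
have [d d0 Hd] := Pr s ltac:(lra) Ple.
have : s + Num.min (d / 2) (b - s) <= s.
  apply: ub_le_sup; first exact: hS.2.
  have m1 : Num.min (d / 2) (b - s) <= d / 2 by rewrite ge_min lexx.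
  have m2 : Num.min (d / 2) (b - s) <= b - s by rewrite ge_min lexx orbT.
  have m3 : 0 < Num.min (d / 2) (b - s) by rewrite lt_min; lra.
  split; first lra.
  move=> y /andP[ay ym]; have [ys|sy] := leP y s; first by apply: Ple; lra.
  by apply: Hd; lra.
have m3 : 0 < Num.min (d / 2) (b - s) by rewrite lt_min; lra.
lra.
Qed.

(** A property of intervals that is additive under juxtaposition and holds for
    all small intervals around each point holds for the whole interval: this is
    how compactness is used below. *)
Lemma local_to_global (P : R -> R -> Prop) a b : a <= b ->
  (forall x y z, a <= x -> x <= y -> y <= z -> z <= b -> P x y -> P y z -> P x z) ->
  (forall x, a <= x <= b -> exists2 d, 0 < d & forall y z,
     a <= y -> y <= x -> x <= z -> z <= b -> x - d < y -> z < x + d -> P y z) ->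
  P a b.
Proof.
move=> ab Padd Ploc.
suff: forall x, a <= x <= b -> P a x by apply; rewrite ab lexx.
apply: real_ind.
- have [d d0 H] := Ploc a ltac:(lra); apply: H; lra.
- move=> x xab H; have [d d0 Hd] := Ploc x ltac:(lra).
  exists d => // y xyd yb; apply: (Padd _ x) => //; try lra.
    by apply: H; lra.
  by apply: Hd; lra.
- move=> x xab H; have [d d0 Hd] := Ploc x ltac:(lra).
  have [xd|xd] := leP (x - d / 2) a; first by apply: Hd; lra.
  apply: (Padd _ (x - d / 2)); try lra; first by apply: H; lra.
  by apply: Hd; lra.
Qed.

(** ** Primitives of continuous functions *)

Local Notation mu := (@lebesgue_measure R).

Let PN u (N x : R) : R := \int[mu]_(t in `[(- N)%R, x]) u t.

Let PN_derive u N x : continuous u -> - N < x -> is_derive x 1 (PN u N) (u x).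
Proof.
move=> cu Nx.
have iu : mu.-integrable `[- N, x + 1] (EFin \o u).
  apply: continuous_compact_integrable; first exact: segment_compact.
  exact: continuous_subspaceT.
have [dF F'] := @continuous_FTC1_closed R u (- N) x (x + 1) ltac:(lra) iu Nx (cu x).
by apply: DeriveDef; [exact: dF|rewrite -derive1E; exact: F'].
Qed.

Definition prim (u : R -> R) (x : R) : R :=
  PN u (`|x| + 1) x - PN u (`|x| + 1) 0.

Lemma prim_derive u x : continuous u -> is_derive x 1 (prim u) (u x).
Proof.
move=> cu.
have aux N M y : continuous u -> - N < y -> - M < y -> 0 < N -> 0 < M ->
    PN u N y - PN u N 0 = PN u M y - PN u M 0.
  move=> _ Ny My N0 M0.
  have D z : - N < z -> - M < z -> is_derive z 1 (fun t => PN u N t - PN u M t) 0.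
    by move=> Nz Mz; apply: is_derive_eq; [apply: isD_sub; exact: PN_derive|rewrite subrr].
  have [y0|y0] := leP 0 y.
    move: y0; rewrite le_eqVlt => /predU1P[<-|y0]; first by rewrite !subrr.
    have [|c _] := @mvt_closed (fun t => PN u N t - PN u M t) (fun=> 0) 0 y y0.
      by move=> z zy; apply: D; lra.
    by rewrite mul0r; move: (PN u N y) (PN u M y) (PN u N 0) (PN u M 0) => *; lra.
  have [|c _] := @mvt_closed (fun t => PN u N t - PN u M t) (fun=> 0) y 0 y0.
    by move=> z zy; apply: D; lra.
  by rewrite mul0r; move: (PN u N y) (PN u M y) (PN u N 0) (PN u M 0) => *; lra.
have bnd y : - `|y| <= y by rewrite lerNl -normrN ler_norm.
apply: (@isD_near _ (fun y => PN u (`|x| + 2) y - PN u (`|x| + 2) 0)).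
  exists 1; first lra.
  move=> y yx.
  have h1 : `|y| <= `|x| + `|y - x|.
    by have := ler_normD x (y - x); rewrite [x + _]addrC subrK.
  have h2 := bnd y; have h3 := bnd x; have h4 := normr_ge0 x; have h5 := normr_ge0 y.
  by apply: aux => //; lra.
ders; last by rewrite addr0.
by apply: PN_derive => //; have := bnd x; lra.
Qed.

Lemma prim0 u : prim u 0 = 0.
Proof. by rewrite /prim subrr. Qed.

Lemma prim_cont u : continuous u -> continuous (prim u).
Proof. by move=> cu x; apply: isD_cont; exact: prim_derive. Qed.

Lemma prim_bound u x M : continuous u -> 0 <= x ->
  (forall y, 0 < y < x -> `|u y| <= M) -> `|prim u x| <= M * x.
Proof.
move=> cu x0 H; rewrite -[X in `|X|]subr0 -(prim0 u) -[X in M * X]subr0.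
apply: mvt_bound => //; first exact: prim_cont.
by move=> y yx; exists (u y); [exact: prim_derive|exact: H].
Qed.

Lemma primB u w x : continuous u -> continuous w ->
  prim (fun y => u y - w y) x = prim u x - prim w x.
Proof.
move=> cu cw.
have H := @is_derive_0_is_cst R
  (fun y => prim (fun y => u y - w y) y - (prim u y - prim w y)) x 0.
move: H; rewrite !prim0 => H.
suff: prim (fun y => u y - w y) x - (prim u x - prim w x) = 0 - (0 - 0) by lra.
apply: H => y.
ders; [apply: prim_derive; exact: cont_sub|exact: prim_derive|exact: prim_derive|].
by rewrite subrr.
Qed.

(** The derivative of a continuous function extends continuously to a point where
    the derivative has a limit. *)
Lemma derive_glue f k c e : 0 < e -> continuous f -> continuous k ->
  (forall x, `|x - c| < e -> x != c -> is_derive x 1 f (k x)) ->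
  is_derive c 1 f (k c).
Proof.
move=> e0 cf ck H.
have cK := prim_cont ck.
apply: (@isD_near _ (fun y => f c - prim k c + prim k y)); last first.
  by ders; [exact: prim_derive|rewrite add0r].
exists e => // y yc.
have cfk := cont_sub cf cK.
have D x : `|x - c| < e -> x != c -> is_derive x 1 (fun t => f t - prim k t) 0.
  by move=> xc xnc; ders; [exact: H|exact: prim_derive|rewrite subrr].
suff : f y - prim k y = f c - prim k c by lra.
have [yc'|yc'] := leP c y.
  apply: (@mvt_cst (fun t => f t - prim k t)) => // x xcy; apply: D; last by lra.
  by move: yc; rewrite !ltr_norml; lra.
symmetry; apply: (@mvt_cst (fun t => f t - prim k t)) => //; first lra.
move=> x xcy; apply: D; last by lra.
by move: yc; rewrite !ltr_norml; lra.
Qed.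

(** ** Uniform limits *)

(** The limits of existence proofs below are limits of second derivatives, from which the
    jets are recovered by integration. *)
Lemma unif_cauchy_lim (w : nat -> R -> R) : (forall j, continuous (w j)) ->
  (forall e, 0 < e -> exists N, forall i j y, (N <= i)%N -> (N <= j)%N ->
     `|w i y - w j y| <= e) ->
  exists2 v, continuous v & forall e, 0 < e -> exists N, forall j y, (N <= j)%N ->
     `|w j y - v y| <= e.
Proof.
move=> cw H.
have cv y : cvg (w j y @[j --> \oo]).
  apply/cauchy_cvgP/cauchyP => e e0.
  have [N HN] := H (e / 2) ltac:(lra).
  exists (w N y); exists N => // j /= Nj.
  by rewrite /ball /=; apply: le_lt_trans (HN _ _ _ _ _) _ => //; lra.
pose v y := lim (w j y @[j --> \oo]).
have Hv e : 0 < e -> exists N, forall j y, (N <= j)%N -> `|w j y - v y| <= e.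
  move=> e0; have [N HN] := H (e / 2) ltac:(lra).
  exists N => j y Nj.
  have /cvgrPdist_lt /(_ (e / 2) ltac:(lra)) [M _ HM] := cv y.
  have := HM (maxn M N) (leq_maxl _ _).
  have := HN j (maxn M N) y Nj (leq_maxr _ _) => h1 h2.
  have -> : w j y - v y = (w j y - w (maxn M N) y) - (v y - w (maxn M N) y) by ring.
  by apply: le_trans (ler_normB _ _) _; rewrite -/(v y) in h2; lra.
exists v => // x; apply/contP => e e0.
have [N HN] := Hv (e / 3) ltac:(lra).
have [d d0 Hd] := (contP (w N) x).1 (cw N x) (e / 3) ltac:(lra).
exists d => // y yx.
have h1 := HN N y (leqnn _); have h2 := HN N x (leqnn _); have h3 := Hd y yx.
have -> : v y - v x = (w N y - w N x) - (w N y - v y) + (w N x - v x) by ring.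
have := ler_normD (w N y - w N x - (w N y - v y)) (w N x - v x).
have := ler_normB (w N y - w N x) (w N y - v y); lra.
Qed.

End MeanValue.

(** * The nonlinearity *)

Section Nonlinearity.
Context {R : realType}.
Implicit Types (u v m p x y z : R).

Lemma mvt_closed_bound (f : R -> R) (a b M : R) : a <= b ->
  (forall x, a <= x <= b -> exists2 d, is_derive x 1 f d & `|d| <= M) ->
  `|f b - f a| <= M * (b - a).
Proof.
rewrite le_eqVlt => /predU1P[->|ab] H; first by rewrite !subrr normr0 mulr0.
have H' x : a <= x <= b -> is_derive x 1 f ('D_1 f x).
  by move=> xab; have [d fd _] := H x xab; apply: derivableP; case: fd.
have [c cab ->] := mvt_closed ab H'.
have [d [_ Dd] dM] := H c ltac:(lra).
by rewrite Dd normrM (@ger0_norm _ (b - a)) ?ler_wpM2r //; lra.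
Qed.

Definition apow p u : R := `|u| `^ p.

Lemma apow_gt0E p u : 0 < u -> apow p u = u `^ p.
Proof. by move=> u0; rewrite /apow gtr0_norm. Qed.

Lemma apow_ge0 p u : 0 <= apow p u. Proof. exact: powR_ge0. Qed.

Lemma isD_apow p u : 0 < u -> is_derive u 1 (apow p) (p * u `^ (p - 1)).
Proof.
move=> u0; apply: (@isD_near _ (fun y => y `^ p)); last exact: is_derive1_powR.
exists u => // y; rewrite ltr_norml => yu; rewrite apow_gt0E //; lra.
Qed.

Lemma apow0 p : 0 < p -> apow p 0 = 0.
Proof. by move=> p0; rewrite /apow normr0 powR0 // gt_eqF. Qed.

Lemma apow_cont p : 0 < p -> continuous (apow p).
Proof.
move=> p0 u; have [u0|u0|->] := ltgtP u 0.
- have -> : apow p = (fun y => apow p (- y)) by apply/funext => y; rewrite /apow normrN.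
  by apply: isD_cont; apply: (@isD_comp _ (apow p) (fun y => - y)); apply: isD_apow; lra.
- by apply: isD_cont; exact: isD_apow.
- apply/contP => e e0; exists (e `^ p^-1); first exact: powR_gt0.
  move=> y; rewrite subr0 (apow0 p0) subr0 => ye.
  rewrite ger0_norm ?apow_ge0 // /apow.
  have -> : e = (e `^ p^-1) `^ p by rewrite -powRrM mulVf ?gt_eqF // powRr1 // ltW.
  by apply: gt0_ltr_powR => //; rewrite nnegrE ?powR_ge0.
Qed.

Lemma powR_split u p q : 0 < u -> u `^ (p + q) = u `^ p * u `^ q.
Proof. by move=> u0; rewrite powRD // (gt_eqF u0) implybT. Qed.

Lemma powR_le_neg u v p : 0 < u -> u <= v -> 0 <= p -> v `^ (- p) <= u `^ (- p).
Proof.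
move=> u0 uv p0; rewrite !powRN lef_pV2 ?posrE ?powR_gt0 //; last lra.
by apply: ge0_ler_powR => //; rewrite nnegrE; lra.
Qed.

Context (n : R).

Local Notation g := (nonlin n).

Lemma gE u : 0 < u -> g u = u `^ (1 - n).
Proof.
move=> u0; rewrite /nonlin gtr0_norm // powRB; last by rewrite (gt_eqF u0) implybT.
by rewrite powRr1 // ltW.
Qed.

Lemma gN u : g (- u) = - g u.
Proof. by rewrite /nonlin normrN mulNr. Qed.

Lemma g_gt0 u : 0 < u -> 0 < g u.
Proof. by move=> u0; rewrite gE // powR_gt0. Qed.

Lemma isD_g u : 0 < u -> is_derive u 1 g ((1 - n) * u `^ (- n)).
Proof.
move=> u0; apply: (@isD_near _ (fun y => y `^ (1 - n))).
  exists u => // y; rewrite ltr_norml => yu; rewrite gE //; lra.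
by apply: is_derive_eq; first exact: is_derive1_powR; congr (_ * _ `^ _); ring.
Qed.

Lemma isD_gn u : u != 0 -> exists d, is_derive u 1 g d.
Proof.
rewrite neq_lt => /orP[u0|u0]; last by exists ((1 - n) * u `^ (- n)); exact: isD_g.
have -> : g = (fun y => - g (- y)) by apply/funext => y; rewrite gN opprK.
eexists; apply: isD_opp.
by apply: (@isD_comp _ g (fun y => - y)); apply: isD_g; lra.
Qed.

Lemma g_cont u : u != 0 -> {for u, continuous g}.
Proof. by move=> /isD_gn[d]; exact: isD_cont. Qed.

(** The exponent satisfies [|1 - n| <= 1], so the derivative of the nonlinearity
    is dominated by its value at the left end of a half-line. *)
Lemma g_lip m u v (n_gt0 : 0 < n) (n_lt2 : n < 2) : 0 < m -> m <= u -> m <= v ->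
  `|g u - g v| <= m `^ (- n) * `|u - v|.
Proof.
move=> m0; wlog uv : u v / v <= u => [H mu mv|mu mv].
  have [vu|/ltW uv] := leP v u; first exact: H.
  by rewrite distrC [`|u - v|]distrC; exact: H.
rewrite (@ger0_norm _ (u - v)) ?subr_ge0 //; apply: mvt_closed_bound => // x xuv.
exists ((1 - n) * x `^ (- n)); first by apply: isD_g; lra.
rewrite normrM (@ger0_norm _ (_ `^ _)) ?powR_ge0 //.
have h1 : `|1 - n| <= 1 by rewrite ler_norml; lra.
have h2 : x `^ (- n) <= m `^ (- n) by apply: powR_le_neg => //; [lra|exact: ltW].
have := powR_ge0 x (- n); have := normr_ge0 (1 - n); nra.
Qed.

(** A primitive of [u^(1 - n)]: the total effect of the singular term while the solution
    crosses heights up to [u] at unit speed. *)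
Definition gint u : R := (2 - n)^-1 * apow (2 - n) u.

Lemma gint_cont (n_lt2 : n < 2) : continuous gint.
Proof. by apply: cont_mul; [exact: cont_cst|apply: apow_cont; lra]. Qed.

Lemma isD_gint u (n_lt2 : n < 2) : 0 < u -> is_derive u 1 gint (u `^ (1 - n)).
Proof.
move=> u0; rewrite /gint; ders; first exact: isD_apow.
rewrite mulr0 addr0 mulrA mulVf ?mul1r; last by rewrite gt_eqF; lra.
by congr (_ `^ _); ring.
Qed.

Lemma gint0 (n_lt2 : n < 2) : gint 0 = 0.
Proof. by rewrite /gint apow0 ?mulr0; lra. Qed.

Lemma gint_ge0 u (n_lt2 : n < 2) : 0 <= gint u.
Proof. by rewrite mulr_ge0 ?apow_ge0 // invr_ge0; lra. Qed.

End Nonlinearity.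

(** * Solutions of the autonomous equation *)

Record jet (R : realType) := Jet { pos : R -> R; vel : R -> R; acc : R -> R }.

(* Goals about times alone mostly follow from the hypotheses about times. *)
Ltac lra_times := lazymatch goal with
  | |- context [pos _ _] => fail | |- context [vel _ _] => fail | |- context [acc _ _] => fail
  | _ => repeat match goal with
    | H : context [pos _ _] |- _ => clear H
    | H : context [vel _ _] |- _ => clear H
    | H : context [acc _ _] |- _ => clear H end; lra_full end.
Tactic Notation "lra" := keep_comparisons; first [lra_times | lra_full].

(** At zeros of [f], where [f / |f|^n] may be singular, the third derivative is left
    free and continuity of the jet takes its place.  The sign [sg] is [-1] for solutions
    run backwards. *)
Definition jsol (R : realType) (n sg a b : R) (F : jet R) :=
  [/\ continuous (pos F), continuous (vel F), continuous (acc F),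
    forall y, a < y < b -> is_derive y 1 (pos F) (vel F y) /\
                           is_derive y 1 (vel F) (acc F y) &
    forall y, a < y < b -> pos F y != 0 ->
      is_derive y 1 (acc F) (- sg * nonlin n (pos F y))].

Section Comparison.
Context {R : realType} (n : R).
Implicit Types (F G : jet R) (a b x y z e : R).

Lemma jsol_sub sg a b a' b' F : a <= a' -> b' <= b ->
  jsol n sg a b F -> jsol n sg a' b' F.
Proof.
by move=> aa bb [c0 c1 c2 D1 D2]; split=> // y yab; [apply: D1|apply: D2]; lra.
Qed.

(** The singular weight is the point of the comparison: near a transversal zero
    [F y >= m y], so [g F - g G] is of order [y^(1-n)] times the distance of the
    velocities, which is integrable because [n < 2]. *)
Definition cmp_weight (m y : R) : R :=
  expR (y + (m / 2) `^ (- n) * (2 - n)^-1 * apow (2 - n) y).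

Lemma cmp_weight_cont m (n_lt2 : n < 2) : continuous (cmp_weight m).
Proof. by apply: cont_expR; conts; apply: apow_cont; lra. Qed.

Lemma cmp_weight_ge1 m y (n_lt2 : n < 2) : 0 <= y -> 1 <= cmp_weight m y.
Proof.
move=> y0; rewrite -expR0 ler_expR; apply: addr_ge0 => //.
by rewrite !mulr_ge0 ?powR_ge0 // invr_ge0; lra.
Qed.

Lemma cmp_weight_gt0 m y : 0 < cmp_weight m y. Proof. exact: expR_gt0. Qed.

Lemma isD_cmp_weight m y (n_lt2 : n < 2) : 0 < y -> is_derive y 1 (cmp_weight m)
  (cmp_weight m y * (1 + (m / 2) `^ (- n) * y `^ (1 - n))).
Proof.
move=> y0; rewrite /cmp_weight; ders; first exact: isD_apow.
congr (_ * _); have -> : 2 - n - 1 = 1 - n :> R by ring.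
by rewrite mulr0 addr0 -!mulrA [_^-1 * _]mulrA mulVf ?mul1r //; rewrite gt_eqF; lra.
Qed.

Lemma cmp_weight_homo m x y (n_lt2 : n < 2) : 0 <= x -> x <= y -> cmp_weight m x <= cmp_weight m y.
Proof.
move=> x0 xy; apply: mvt_le => //; first exact: cmp_weight_cont.
move=> z zxy; exists (cmp_weight m z * (1 + (m / 2) `^ (- n) * z `^ (1 - n))).
  by apply: isD_cmp_weight; lra.
by rewrite mulr_ge0 ?expR_ge0 // addr_ge0 // mulr_ge0 // powR_ge0.
Qed.

Lemma comparison sg F G u b m e (n_gt0 : 0 < n) (n_lt2 : n < 2) : `|sg| <= 1 -> 0 <= u -> u <= b -> 0 < m -> 0 < e ->
  jsol n sg u b F -> jsol n sg u b G ->
  (forall y, u <= y <= b -> m * y <= pos F y) ->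
  `|pos G u - pos F u| <= u * e -> `|vel G u - vel F u| < e ->
  `|acc G u - acc F u| < e -> e * cmp_weight m b <= m / 2 ->
  forall y, u <= y <= b ->
    [/\ `|vel G y - vel F y| < e * cmp_weight m y,
        `|acc G y - acc F y| < e * cmp_weight m y,
        `|pos G y - pos F y| <= y * (e * cmp_weight m y) &
        m / 2 * y <= pos G y].
Proof.
move=> sg1 u0 ub m0 e0 [cF0 cF1 cF2 DF DF2] [cG0 cG1 cG2 DG DG2] Fm d0 d1 d2 ebm.
pose B y := e * cmp_weight m y.
have cB : continuous B by apply: cont_mul; [exact: cont_cst|exact: cmp_weight_cont].
have Bgt0 y : 0 < B y by rewrite mulr_gt0 // cmp_weight_gt0.
pose K y := (m / 2) `^ (- n) * y `^ (1 - n).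
have K0 y : 0 <= K y by rewrite mulr_ge0 // powR_ge0.
have DB y : 0 < y -> is_derive y 1 B (B y * (1 + K y)).
  by move=> y0; rewrite /B; ders; [exact: isD_cmp_weight|rewrite mulr0 addr0 mulrA].
have Bm y : u <= y <= b -> B y <= m / 2.
  move=> yub; apply: le_trans ebm; rewrite (ler_wpM2l (ltW e0)) //.
  by apply: cmp_weight_homo; lra.
have eB : e <= B u.
  by rewrite -[leLHS]mulr1 (ler_wpM2l (ltW e0)) // cmp_weight_ge1.
have KE y : K y = (m / 2) `^ (- n) * y `^ (1 - n) by [].
rewrite -[forall y, _]/(forall y, u <= y <= b ->
    [/\ `|vel G y - vel F y| < B y, `|acc G y - acc F y| < B y,
        `|pos G y - pos F y| <= y * B y & m / 2 * y <= pos G y]).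
clearbody K; clearbody B.
(* [|d'| <= B'] propagates the bound [|d| < B] *)
have step (d : R -> R) x : continuous d -> u <= x <= b -> `|d u| < B u ->
    (forall y, u < y < x -> exists2 d', is_derive y 1 d d' & `|d'| <= B y * (1 + K y)) ->
    `|d x| < B x.
  move=> cd xub du H.
  have h1 : B u + d u <= B x + d x.
    apply: (@mvt_le _ (fun y => B y + d y)); [lra|exact: cont_add|move=> y yux].
    have [d' Dd' hd'] := H y yux; exists (B y * (1 + K y) + d').
      by apply: (isD_add (DB y _) Dd'); lra.
    by move: hd'; rewrite ler_norml; lra.
  have h2 : B u - d u <= B x - d x.
    apply: (@mvt_le _ (fun y => B y - d y)); [lra|exact: cont_sub|move=> y yux].
    have [d' Dd' hd'] := H y yux; exists (B y * (1 + K y) - d').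
      by apply: (isD_sub (DB y _) Dd'); lra.
    by move: hd'; rewrite ler_norml; lra.
  by move: du; rewrite !ltr_norml; lra.
have pos_bound x : u <= x <= b -> (forall y, u <= y < x -> `|vel G y - vel F y| < B y) ->
    `|pos G x - pos F x| <= x * B x.
  move=> xub H.
  have cyB : continuous (fun y => y * B y) by conts.
  have cd : continuous (fun y => pos G y - pos F y) by conts.
  have d0' : `|pos G u - pos F u| <= u * B u.
    by apply: le_trans d0 _; rewrite ler_wpM2l.
  have DyB y : u < y < x -> is_derive y 1 (fun y => y * B y) (y * (B y * (1 + K y)) + B y).
    by move=> yux; apply: (isD_eq (isD_mul (isD_id y) (DB y _))); [lra|rewrite mulr1].
  have pB y : u < y < x -> 0 <= y * (B y * (1 + K y)).
    move=> yux; have [b1 k1] := (Bgt0 y, K0 y).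
    by apply: mulr_ge0; [lra|apply: mulr_ge0; lra].
  have h1 : u * B u + (pos G u - pos F u) <= x * B x + (pos G x - pos F x).
    apply: (@mvt_le _ (fun y => y * B y + (pos G y - pos F y))); [lra|exact: cont_add|].
    move=> y yux; have Hy := H y ltac:(lra); have pBy := pB y yux.
    exists (y * (B y * (1 + K y)) + B y + (vel G y - vel F y)).
      have [a1 _] := DF y ltac:(lra); have [a2 _] := DG y ltac:(lra).
      by apply: isD_add (DyB y yux) (isD_sub a2 a1).
    by move: Hy; rewrite ltr_norml; lra.
  have h2 : u * B u - (pos G u - pos F u) <= x * B x - (pos G x - pos F x).
    apply: (@mvt_le _ (fun y => y * B y - (pos G y - pos F y))); [lra|exact: cont_sub|].
    move=> y yux; have Hy := H y ltac:(lra); have pBy := pB y yux.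
    exists (y * (B y * (1 + K y)) + B y - (vel G y - vel F y)).
      have [a1 _] := DF y ltac:(lra); have [a2 _] := DG y ltac:(lra).
      by apply: isD_sub (DyB y yux) (isD_sub a2 a1).
    by move: Hy; rewrite ltr_norml; lra.
  by move: d0'; rewrite !ler_norml; lra.
have main : forall y, u <= y <= b ->
    `|vel G y - vel F y| < B y /\ `|acc G y - acc F y| < B y.
  apply: real_ind; first by split; lra.
  - move=> x xub H; have [h1 h2] := H x ltac:(lra).
    have near_lt (d : R -> R) : continuous d -> `|d x| < B x ->
        exists2 r, 0 < r & forall y, `|y - x| < r -> `|d y| < B y.
      move=> cd dx; pose q := (B x - `|d x|) / 2.
      have q0 : 0 < q by rewrite /q; lra.
      have [r1 r10 H1] := (contP d x).1 (cd x) q q0.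
      have [r2 r20 H2] := (contP B x).1 (cB x) q q0.
      exists (Num.min r1 r2); first by rewrite lt_min r10.
      move=> y; rewrite lt_min => /andP[/H1 e1 /H2 e2].
      have := ler_normD (d x) (d y - d x); rewrite [d x + _]addrC subrK.
      rewrite ltr_norml in e2; rewrite /q in e1 e2; lra.
    have [r1 r10 H1] := near_lt _ (cont_sub cG1 cF1) h1.
    have [r2 r20 H2] := near_lt _ (cont_sub cG2 cF2) h2.
    exists (Num.min r1 r2); first by rewrite lt_min r10.
    move=> y yx yb.
    have : `|y - x| < Num.min r1 r2 by rewrite gtr0_norm; lra.
    by rewrite lt_min => /andP[/H1 ? /H2 ?].
  - move=> x xub H.
    split; [apply: (step (fun y => vel G y - vel F y))|
            apply: (step (fun y => acc G y - acc F y))] => //; try lra.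
    + exact: cont_sub.
    + move=> y yux; exists (acc G y - acc F y).
        have [_ a1] := DF y ltac:(lra); have [_ a2] := DG y ltac:(lra).
        exact: isD_sub.
      have [_ /ltW h] := H y ltac:(lra); apply: le_trans h _.
      by rewrite mulrDr mulr1 lerDl mulr_ge0 // ltW.
    + exact: cont_sub.
    + move=> y yux.
      have hp : `|pos G y - pos F y| <= y * B y.
        by apply: pos_bound => [|z zy]; [lra|have [] := H z ltac:(lra)].
      have hB := Bm y ltac:(lra); have hF := Fm y ltac:(lra).
      have y0 : 0 < y by lra.
      have hyB : y * B y <= m / 2 * y by rewrite mulrC (ler_wpM2r (ltW y0)).
      have hG : m / 2 * y <= pos G y by move: hp; rewrite ler_norml; lra.
      have my0 : 0 < m / 2 * y by rewrite mulr_gt0 //; lra.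
      have hF' : m / 2 * y <= pos F y by lra.
      exists (- sg * nonlin n (pos G y) - - sg * nonlin n (pos F y)).
        by apply: isD_sub; [apply: DG2|apply: DF2]; rewrite ?gt_eqF //; lra.
      rewrite -mulrBr normrM normrN.
      have lip := g_lip n_gt0 n_lt2 my0 hG hF'.
      apply: (@le_trans _ _ (`|nonlin n (pos G y) - nonlin n (pos F y)|)).
        by rewrite ler_piMl.
      apply: le_trans lip _.
      apply: (@le_trans _ _ ((m / 2 * y) `^ (- n) * (y * B y))).
        by rewrite ler_wpM2l // powR_ge0.
      have -> : (m / 2 * y) `^ (- n) * (y * B y) = B y * K y.
        rewrite KE powRM; [|lra|lra].
        have -> : y `^ (1 - n) = y * y `^ (- n) by rewrite powR_split // powRr1 // ltW.
        by ring.
      by rewrite mulrDr mulr1 lerDr ltW.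
move=> y yub; have [h1 h2] := main y yub.
have h0 : `|pos G y - pos F y| <= y * B y.
  by apply: pos_bound => // z zy; have [] := main z ltac:(lra).
split=> //.
have hyB : y * B y <= m / 2 * y by rewrite mulrC ler_wpM2r ?Bm //; lra.
by have := Fm y yub; move: h0; rewrite ler_norml; lra.
Qed.

(** Two solutions with the same state agree as long as one of them stays above a
    line through the origin; the state itself may be a transversal zero. *)
Lemma uniq_above sg F G u b m (n_gt0 : 0 < n) (n_lt2 : n < 2) : `|sg| <= 1 -> 0 <= u -> 0 < m ->
  jsol n sg u b F -> jsol n sg u b G ->
  (forall y, u <= y <= b -> m * y <= pos F y) ->
  pos G u = pos F u -> vel G u = vel F u -> acc G u = acc F u ->
  forall y, u <= y <= b ->
    [/\ pos G y = pos F y, vel G y = vel F y & acc G y = acc F y].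
Proof.
move=> sg1 u0 m0 sF sG Fm e0 e1 e2 y yub.
have small (X Y : R) : (forall e, 0 < e -> e <= m / 2 / cmp_weight m b ->
    `|X - Y| <= (1 + y) * (e * cmp_weight m y)) -> X = Y.
  move=> H; apply/eqP; rewrite -subr_eq0 -normr_le0; apply/ler_addgt0Pl => r r0.
  rewrite addr0.
  pose w := (1 + y) * cmp_weight m y.
  have w0 : 0 < w by rewrite mulr_gt0 ?cmp_weight_gt0 //; lra.
  pose e := Num.min (m / 2 / cmp_weight m b) (r / w).
  have e_gt0 : 0 < e.
    by rewrite lt_min !divr_gt0 ?cmp_weight_gt0 //; lra.
  apply: le_trans (H e e_gt0 _) _; first by rewrite ge_min lexx.
  have : e <= r / w by rewrite ge_min lexx orbT.
  by rewrite ler_pdivlMr // /w mulrCA mulrC.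
have H e : 0 < e -> e <= m / 2 / cmp_weight m b -> _ :=
  fun e0' eb => @comparison sg F G u b m e n_gt0 n_lt2 sg1 u0 ltac:(lra) m0 e0' sF sG Fm
   ltac:(by rewrite e0 subrr normr0 mulr_ge0 // ltW)
   ltac:(by rewrite e1 subrr normr0) ltac:(by rewrite e2 subrr normr0)
   ltac:(by rewrite -ler_pdivlMr ?cmp_weight_gt0) y yub.
have w0 := cmp_weight_gt0 m y.
have y0 : 0 <= y by lra.
split; apply: small => e e0' eb; have [h1 h2 h0 _] := H e e0' eb;
  have ew : 0 < e * cmp_weight m y := mulr_gt0 e0' w0.
- by apply: le_trans h0 _; rewrite (ler_wpM2r (ltW ew)) // lerDr.
- by apply: le_trans (ltW h1) _; rewrite mulrDl mul1r lerDl mulr_ge0 // ltW.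
- by apply: le_trans (ltW h2) _; rewrite mulrDl mul1r lerDl mulr_ge0 // ltW.
Qed.

End Comparison.

(** * Existence *)

Section Volterra.
Context {R : realType}.
Implicit Types (f z w : R -> R) (a b x y t e M L K Y : R).

Lemma cont_bounded f a b : continuous f -> exists2 M, 0 <= M & forall x, a <= x <= b -> `|f x| <= M.
Proof.
move=> cf; have [ab|ba] := leP a b; last by exists 0 => // x xab; lra.
have cnf : continuous (fun x => `|f x|).
  by move=> x; apply: (@continuous_comp _ _ _ f Num.norm); [exact: cf|exact: norm_continuous].
have [c cab H] := EVT_max ab (continuous_subspaceT cnf).
by exists `|f c| => // x xab; apply: H; rewrite in_itv.
Qed.

Lemma half_pow_lt e : 0 < e -> exists N, forall j, (N <= j)%N -> 2^-1 ^+ j < e :> R.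
Proof.
move=> e0.
have [N _ HN] := near_infty_natSinv_lt (PosNum e0).
exists N => j Nj; apply: le_lt_trans (HN j Nj) => /=.
rewrite exprVn lef_pV2 ?posrE ?exprn_gt0 // -natrX ler_nat; exact: ltn_expl.
Qed.

Definition clamp a b x : R := Num.min (Num.max x a) b.

Lemma clamp_cont a b : continuous (clamp a b).
Proof. by apply: (cont_comp (@cont_min _ b)); exact: cont_max. Qed.

Lemma clamp_itv a b x : a <= b -> a <= clamp a b x <= b.
Proof. by rewrite /clamp; case: (leP x a) => ?; [case: (leP a b)|case: (leP x b)]; lra. Qed.

Lemma clamp_id a b x : a <= x <= b -> clamp a b x = x.
Proof. by rewrite /clamp; case: (leP x a) => ?; [case: (leP a b)|case: (leP x b)]; lra. Qed.

Lemma clamp_le a b x : x <= a -> a <= b -> clamp a b x = a.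
Proof. by rewrite /clamp; case: (leP x a) => ?; [case: (leP a b)|case: (leP x b)]; lra. Qed.

Lemma clamp_ge a b x : b <= x -> a <= b -> clamp a b x = b.
Proof. by rewrite /clamp; case: (leP x a) => ?; [case: (leP a b)|case: (leP x b)]; lra. Qed.

(** Picard iteration for equations whose right-hand side may depend on the whole
    past of the unknown; iterates contract in the norm weighted by [exp (K y)]. *)
Lemma volterra (Phi : (R -> R) -> R -> R) L Y : 0 <= L -> 0 <= Y ->
  (forall z, continuous z -> continuous (Phi z)) ->
  (forall z w y M, continuous z -> continuous w -> 0 <= y <= Y ->
     (forall t, 0 <= t <= y -> `|z t - w t| <= M) -> `|Phi z y - Phi w y| <= L * M) ->
  exists z, [/\ continuous z, z 0 = 0 &
    forall y, 0 < y < Y -> is_derive y 1 z (Phi z y)].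
Proof.
move=> L0 Y0 HC HL.
pose T z y := prim (Phi z) (clamp 0 Y y).
have cT z : continuous z -> continuous (T z).
  by move=> cz; apply: (cont_comp (prim_cont (HC z cz))); exact: clamp_cont.
pose zs k := iter k T (fun=> 0).
have czs k : continuous (zs k) by elim: k => [|k IH]; [exact: cont_cst|exact: cT].
have zsS k y : zs k.+1 y = prim (Phi (zs k)) (clamp 0 Y y) by [].
have [A A0 HA] := cont_bounded 0 Y (czs 1%N).
pose K := 2 * L + 1.
have K0 : 0 < K by rewrite /K; lra.
have step k y : 0 <= y <= Y -> `|zs k.+1 y - zs k y| <= A * 2^-1 ^+ k * expR (K * y).
  elim: k y => [|k IH] y yY.
    rewrite expr0 mulr1 subr0; apply: le_trans (HA y yY) _.
    by rewrite ler_peMr // -expR0 ler_expR mulr_ge0 //; lra.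
  have -> : zs k.+2 y - zs k.+1 y = prim (Phi (zs k.+1)) y - prim (Phi (zs k)) y.
    by rewrite !zsS !clamp_id.
  set B := A * 2^-1 ^+ k in IH.
  have -> : A * 2^-1 ^+ k.+1 = B / 2 by rewrite exprSr mulrA.
  have B0 : 0 <= B by rewrite mulr_ge0 // exprn_ge0.
  clearbody B.
  pose E t := B / 2 * expR (K * t).
  have cE : continuous E by rewrite /E; conts.
  have DE t : is_derive t 1 E (B / 2 * K * expR (K * t)) by rewrite /E; ders; ring.
  have cP j : continuous (prim (Phi (zs j))) by apply: prim_cont; apply: HC.
  have DP j t : is_derive t 1 (prim (Phi (zs j))) (Phi (zs j) t).
    by apply: prim_derive; apply: HC.
  have bd t : 0 < t < y -> `|Phi (zs k.+1) t - Phi (zs k) t| <= B / 2 * K * expR (K * t).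
    move=> ty; apply: (@le_trans _ _ (L * (B * expR (K * t)))).
      apply: HL => //; first lra; move=> s st; apply: le_trans (IH s _) _; first lra.
      by rewrite ler_wpM2l // ler_expR ler_wpM2l //; [exact: ltW|lra].
    rewrite mulrA ler_wpM2r ?expR_ge0 // /K.
    by rewrite -subr_ge0 (_ : B / 2 * (2 * L + 1) - L * B = B / 2); [lra|field].
  have E0 : 0 <= E 0 by rewrite /E mulr_ge0 ?expR_ge0 //; lra.
  have h1 : E 0 + (prim (Phi (zs k.+1)) 0 - prim (Phi (zs k)) 0) <=
            E y + (prim (Phi (zs k.+1)) y - prim (Phi (zs k)) y).
    apply: (@mvt_le _ (fun t => E t + (prim (Phi (zs k.+1)) t - prim (Phi (zs k)) t))).
    - lra.
    - by apply: cont_add => //; exact: cont_sub.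
    move=> t ty; exists (B / 2 * K * expR (K * t) + (Phi (zs k.+1) t - Phi (zs k) t)).
      exact: isD_add (DE t) (isD_sub (DP _ t) (DP _ t)).
    by have := bd t ty; rewrite ler_norml => /andP[? ?]; lra.
  have h2 : E 0 - (prim (Phi (zs k.+1)) 0 - prim (Phi (zs k)) 0) <=
            E y - (prim (Phi (zs k.+1)) y - prim (Phi (zs k)) y).
    apply: (@mvt_le _ (fun t => E t - (prim (Phi (zs k.+1)) t - prim (Phi (zs k)) t))).
    - lra.
    - by apply: cont_sub => //; exact: cont_sub.
    move=> t ty; exists (B / 2 * K * expR (K * t) - (Phi (zs k.+1) t - Phi (zs k) t)).
      exact: isD_sub (DE t) (isD_sub (DP _ t) (DP _ t)).
    by have := bd t ty; rewrite ler_norml => /andP[? ?]; lra.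
  rewrite -/(E y) ler_norml; move: h1 h2; rewrite !prim0.
  by move: (E y) (E 0) E0 (prim _ _) (prim _ _) => *; lra.
pose c := A * expR (K * Y).
have c0 : 0 <= c by rewrite mulr_ge0 // expR_ge0.
have ext k y : zs k y = zs k (clamp 0 Y y).
  case: k => [|k] //; rewrite !zsS.
  by rewrite (@clamp_id _ _ (clamp 0 Y y)) //; exact: clamp_itv.
have stepc k y : `|zs k.+1 y - zs k y| <= c * 2^-1 ^+ k.
  have cl := clamp_itv y Y0.
  rewrite ext [zs k y]ext; apply: le_trans (step k _ cl) _.
  rewrite /c mulrAC ler_wpM2r ?exprn_ge0 // ler_wpM2l // ler_expR ler_wpM2l //; last lra.
  exact: ltW.
have tele N p y : `|zs (N + p)%N y - zs N y| <= 2 * c * (2^-1 ^+ N - 2^-1 ^+ (N + p)).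
  elim: p => [|p IH]; first by rewrite addn0 !subrr normr0 mulr0.
  have := ler_normD (zs (N + p.+1)%N y - zs (N + p)%N y) (zs (N + p)%N y - zs N y).
  rewrite subrKA; move=> h; apply: le_trans h _.
  have := stepc (N + p)%N y; rewrite addnS => h.
  have e1 : 2^-1 ^+ (N + p).+1 = 2^-1 ^+ (N + p) / 2 :> R by rewrite exprSr.
  by rewrite e1; move: h IH; move: `|_ - _| `|_ - _| (2^-1 ^+ (N + p)) (2^-1 ^+ N) => *; lra.
have [|v cv Hv] := @unif_cauchy_lim R zs czs.
  move=> e e0.
  have [N HN] := @half_pow_lt (e / (4 * c + 1)) ltac:(by rewrite divr_gt0 //; lra).
  exists N => i j y.
  wlog ij : i j / (i <= j)%N => [H|] Ni Nj.
    have [ij|/ltnW ji] := leqP i j; first exact: H.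
    by rewrite distrC; exact: H.
  rewrite distrC -(subnKC ij); apply: le_trans (tele i _ y) _.
  have := HN i Ni; rewrite ltr_pdivlMr; last lra.
  have : 0 <= 2^-1 ^+ (i + (j - i)) :> R by rewrite exprn_ge0.
  have : 0 <= 2^-1 ^+ i :> R by rewrite exprn_ge0.
  by move: (2^-1 ^+ i) (2^-1 ^+ (i + (j - i))) => p q *; nra.
have vE y : v y = T v y.
  apply/eqP; rewrite -subr_eq0 -normr_le0; apply/ler_addgt0Pl => r r0; rewrite addr0.
  pose e := r / (1 + L * Y).
  have LY : 0 <= L * Y by exact: mulr_ge0.
  have e0 : 0 < e by rewrite divr_gt0 //; lra.
  have [N HN] := Hv e e0.
  have h1 := HN N.+1 y (leqnSn _).
  have h2 : `|T v y - zs N.+1 y| <= L * e * clamp 0 Y y.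
    have cl := clamp_itv y Y0.
    rewrite zsS /T -primB; [|exact: HC|exact: HC].
    apply: prim_bound => //; [by apply: cont_sub; exact: HC|lra|move=> t ty].
    apply: HL => //; first lra; move=> s st; rewrite distrC; exact: HN.
  have h3 : L * e * clamp 0 Y y <= L * e * Y.
    by have := clamp_itv y Y0; move: (clamp 0 Y y) => ? /andP[_ ?]; rewrite ler_wpM2l // mulr_ge0 // ltW.
  have := ler_normB (v y - zs N.+1 y) (T v y - zs N.+1 y).
  have -> : v y - zs N.+1 y - (T v y - zs N.+1 y) = v y - T v y by ring.
  move=> h; apply: le_trans h _; rewrite [`|v y - _|]distrC.
  have <- : e * (1 + L * Y) = r by rewrite /e divfK // gt_eqF //; lra.
  by rewrite mulrDr mulr1 [e * (L * Y)]mulrCA [L * (e * Y)]mulrA; lra.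
exists v; split => //.
  by rewrite vE /T clamp_le // prim0.
move=> y yY; have cPv := HC v cv.
apply: (@isD_near _ (prim (Phi v))); last exact: prim_derive.
exists (Num.min y (Y - y)); first by rewrite lt_min; lra.
move=> t; rewrite lt_min !ltr_norml => /andP[h1 h2].
by rewrite vE /T clamp_id //; lra.
Qed.

End Volterra.

Section Truncated.
Context {R : realType} (n x0 v a kap : R).
Implicit Types (f z w : R -> R) (y t e M L K Y : R).

Lemma cont_max2 f g : continuous f -> continuous g -> continuous (fun y => Num.max (f y) (g y)).
Proof.
move=> cf cg.
have -> : (fun y => Num.max (f y) (g y)) = (fun y => Num.max (f y - g y) 0 + g y).
  by apply/funext => y; case: (leP (f y) (g y)) => ?; case: leP => ?; lra.
by apply: cont_add => //; apply: (cont_comp (@cont_max _ 0)); exact: cont_sub.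
Qed.

(** Admissible initial data for a positive solution: a positive height, or a zero
    with unit slope, to which every transversal zero is reduced by scaling. *)
Definition start_ok := 0 < x0 \/ (x0 = 0 /\ v = 1).

(** A lower barrier that vanishes only at a zero start. *)
Definition barrier y := x0 + Num.min y 1.

(* The singular part [- g (x0 + y)] of the third derivative is integrated
   explicitly, so that the remaining unknown [z] has a continuous derivative. *)
Definition tacc z y := a - (gint n (x0 + y) - gint n x0) + z y.
Definition tvel z y := v + prim (tacc z) y.
Definition tpos z y := x0 + prim (tvel z) y.
Definition tfield z y := if y <= 0 then 0 else
  nonlin n (x0 + y) - nonlin n (Num.max (tpos z y) (kap * barrier y)).

Lemma barrier_cont : continuous barrier.
Proof. by apply: cont_add; [exact: cont_cst|exact: cont_min]. Qed.

Lemma tacc_cont z (n_lt2 : n < 2) : continuous z -> continuous (tacc z).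
Proof.
move=> cz; apply: cont_add; last exact: cz.
apply: cont_sub; first exact: cont_cst.
apply: cont_sub; last exact: cont_cst.
by apply: (cont_comp (gint_cont n_lt2)); conts.
Qed.

Lemma tvel_cont z (n_lt2 : n < 2) : continuous z -> continuous (tvel z).
Proof. by move=> cz; apply: cont_add; [exact: cont_cst|apply/prim_cont/tacc_cont]. Qed.

Lemma tpos_cont z (n_lt2 : n < 2) : continuous z -> continuous (tpos z).
Proof. by move=> cz; apply: cont_add; [exact: cont_cst|apply/prim_cont/tvel_cont]. Qed.

Lemma isD_tvel z y (n_lt2 : n < 2) : continuous z -> is_derive y 1 (tvel z) (tacc z y).
Proof.
move=> cz; apply: (isD_eq (isD_add (isD_cst v y) (prim_derive y (tacc_cont n_lt2 cz)))).
by rewrite add0r.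
Qed.

Lemma isD_tpos z y (n_lt2 : n < 2) : continuous z -> is_derive y 1 (tpos z) (tvel z y).
Proof.
move=> cz; apply: (isD_eq (isD_add (isD_cst x0 y) (prim_derive y (tvel_cont n_lt2 cz)))).
by rewrite add0r.
Qed.

Lemma tvel0 z : tvel z 0 = v. Proof. by rewrite /tvel prim0 addr0. Qed.
Lemma tpos0 z : tpos z 0 = x0. Proof. by rewrite /tpos prim0 addr0. Qed.
Lemma tacc0 z : z 0 = 0 -> tacc z 0 = a.
Proof. by move=> z0; rewrite /tacc z0 !addr0 subrr subr0. Qed.

Lemma start_ge0 : start_ok -> 0 <= x0.
Proof. by move=> [/ltW//|[-> _]]. Qed.

Lemma barrier_ge y : start_ok -> 0 <= y -> Num.min y 1 <= barrier y.
Proof. by move=> /start_ge0 h y0; rewrite /barrier; lra. Qed.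

Lemma barrier_gt0 y : start_ok -> 0 <= y -> 0 < x0 \/ 0 < y -> 0 < barrier y.
Proof.
move=> /start_ge0 h y0 H; rewrite /barrier; case: (leP y 1) => ?; last lra.
by case: H => ?; lra.
Qed.

Lemma barrier_le y : start_ok -> 0 <= y -> barrier y <= x0 + 1 /\ barrier y <= x0 + y.
Proof. by move=> /start_ge0 h y0; rewrite /barrier; case: (leP y 1) => ?; lra. Qed.

Lemma max_lip (p q r : R) : q <= p -> `|p - Num.max r q| <= `|p - r|.
Proof. by move=> qp; case: (leP r q) => rq //; rewrite !ger0_norm; lra. Qed.

Lemma tfield_le0 z y : y <= 0 -> tfield z y = 0.
Proof. by rewrite /tfield => ->. Qed.

Lemma tfield_gt0 z y : 0 < y -> tfield z y =
  nonlin n (x0 + y) - nonlin n (Num.max (tpos z y) (kap * barrier y)).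
Proof. by move=> y0; rewrite /tfield (lt_geF y0). Qed.

Lemma tfield_le z y (n_gt0 : 0 < n) (n_lt2 : n < 2) : start_ok -> 0 < kap <= 1 -> 0 < y ->
  `|tfield z y| <= (kap * barrier y) `^ (- n) * `|x0 + y - tpos z y|.
Proof.
move=> st k01 y0; rewrite tfield_gt0 //.
have b0 := @barrier_gt0 y st (ltW y0) (or_intror y0).
have [_ b1] := @barrier_le y st (ltW y0).
have kb : 0 < kap * barrier y by rewrite mulr_gt0 //; lra.
have kb1 : kap * barrier y <= x0 + y.
  apply: le_trans b1; apply: ler_piMl; lra.
have := @g_lip R n (kap * barrier y) (x0 + y) (Num.max (tpos z y) (kap * barrier y))
  n_gt0 n_lt2 kb kb1 ltac:(by rewrite le_max lexx orbT).
move=> h; apply: le_trans h _; rewrite ler_wpM2l ?powR_ge0 //; exact: max_lip.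
Qed.

Lemma kap_barrier_pow y p : start_ok -> 0 < kap -> 0 < y ->
  (kap * barrier y) `^ p = kap `^ p * barrier y `^ p.
Proof.
move=> st k0 y0; apply: powRM; first exact: ltW.
by apply/ltW; apply: barrier_gt0 => //; [exact: ltW|right].
Qed.

Lemma tfield_cont z (n_gt0 : 0 < n) (n_lt2 : n < 2) : start_ok -> 0 < kap <= 1 ->
  continuous z -> continuous (tfield z).
Proof.
move=> st k01 cz y.
have [y0|y0|->] := ltgtP y 0.
- apply/contP => e e0; exists (- y); first lra.
  by move=> t; rewrite ltr_norml => ty; rewrite !tfield_le0 ?subrr ?normr0 //; lra.
- have H : {for y, continuous (fun y => nonlin n (x0 + y) -
      nonlin n (Num.max (tpos z y) (kap * barrier y)))}.
    have x00 := start_ge0 st.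
    have b0 := @barrier_gt0 y st (ltW y0) (or_intror y0).
    have kb : 0 < kap * barrier y by rewrite mulr_gt0 //; lra.
    apply: (@continuousB _ _ _ (fun y => nonlin n (x0 + y))
      (fun y => nonlin n (Num.max (tpos z y) (kap * barrier y)))).
      apply: (@continuous_comp _ _ _ (fun y => x0 + y) (nonlin n)).
        have c : continuous (fun y => x0 + y) by conts.
        exact: c.
      by apply: g_cont; rewrite gt_eqF //; lra.
    apply: (@continuous_comp _ _ _ (fun y => Num.max (tpos z y) (kap * barrier y)) (nonlin n)).
      have c : continuous (fun y => Num.max (tpos z y) (kap * barrier y)).
        by apply: cont_max2; [exact: tpos_cont|apply: cont_mul; [exact: cont_cst|exact: barrier_cont]].
      exact: c.
    by apply: g_cont; rewrite gt_eqF // lt_max kb orbT.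
  apply/contP => e e0; have [d d0 Hd] := (contP _ y).1 H e e0.
  exists (Num.min d y); first by rewrite lt_min d0.
  move=> t; rewrite lt_min => /andP[/Hd h]; rewrite ltr_norml => ty.
  by rewrite !tfield_gt0 //; lra.
- clear y; apply/contP => e e0.
  have F0 : tfield z 0 = 0 by exact: tfield_le0.
  suff [d d0 Hd] : exists2 d, 0 < d & forall y, 0 < y < d -> `|tfield z y| < e.
    exists d => // t; rewrite subr0 F0 subr0 ltr_norml => td.
    have [t0|t0] := leP t 0; first by rewrite tfield_le0 // normr0.
    by apply: Hd; lra.
  have [x00|x00] := ltP 0 x0.
    have cd : continuous (fun y => x0 + y - tpos z y).
      by apply: cont_sub; [conts|exact: tpos_cont].
    pose C := (kap * x0) `^ (- n).
    have C0 : 0 < C by rewrite powR_gt0 // mulr_gt0 //; lra.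
    have [d d0 Hd] := (contP _ 0).1 (cd 0) (e / C) (divr_gt0 e0 C0).
    exists d => // y yd; apply: le_lt_trans (tfield_le z n_gt0 n_lt2 st k01 _) _; first lra.
    have := Hd y; rewrite tpos0 addr0 subrr !subr0 ger0_norm ?ltr_pdivlMr //; last lra.
    move=> h; apply: le_lt_trans (h _); last lra.
    rewrite mulrC ler_wpM2l // /C; apply: powR_le_neg; [|rewrite ler_wpM2l //|]; try lra.
      by rewrite mulr_gt0 //; lra.
    by rewrite /barrier; case: (leP y 1) => ?; lra.
  have [x0E vE] : x0 = 0 /\ v = 1 by have [|//] := st; lra.
  have [M M0 HM] := cont_bounded 0 1 (tacc_cont n_lt2 cz).
  pose C := kap `^ (- n) * (M + 1).
  have C0 : 0 < C by rewrite mulr_gt0 ?powR_gt0 //; lra.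
  have [d d0 Hd] := (contP _ 0).1 (@apow_cont R (2 - n) ltac:(lra) 0) (e / C) (divr_gt0 e0 C0).
  exists (Num.min d 1); first by rewrite lt_min d0 ltr01.
  move=> y /andP[y0]; rewrite lt_min => /andP[yd y1].
  apply: le_lt_trans (tfield_le z n_gt0 n_lt2 st k01 y0) _.
  rewrite kap_barrier_pow //; last lra.
  have -> : barrier y = y by rewrite /barrier x0E add0r; case: (leP y 1) => ?; lra.
  have b1 t : 0 <= t <= y -> `|1 - tvel z t| <= M * y.
    move=> ty; have -> : 1 - tvel z t = - prim (tacc z) t by rewrite /tvel vE; ring.
    rewrite normrN; apply: (@le_trans _ _ (M * t)); last by rewrite ler_wpM2l //; lra.
    by apply: prim_bound; [exact: tacc_cont|lra|move=> s sy; apply: HM; lra].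
  have b0 : `|x0 + y - tpos z y| <= M * y * y.
    have := @mvt_bound _ (fun t => t - tpos z t) 0 y (M * y) (ltW y0).
    rewrite tpos0 x0E !subr0 add0r; apply.
      by apply: cont_sub; [conts|exact: tpos_cont].
    move=> t ty; exists (1 - tvel z t); last by apply: b1; lra.
    exact: isD_sub (isD_id t) (isD_tpos t n_lt2 cz).
  have := Hd y; rewrite subr0 apow0 ?subr0; last lra.
  rewrite (gtr0_norm y0) ger0_norm ?apow_ge0 // ltr_pdivlMr // apow_gt0E // => /(_ yd).
  apply: le_lt_trans.
  have yn0 : 0 <= kap `^ (- n) * y `^ (- n) by rewrite mulr_ge0 ?powR_ge0.
  apply: le_trans (ler_wpM2l yn0 b0) _; rewrite /C.
  have -> : y `^ (2 - n) = y * y * y `^ (- n).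
    by rewrite powR_split // powR_mulrn ?ltW // expr2.
  have : 0 <= kap `^ (- n) * y `^ (- n) * (y * y) by rewrite !mulr_ge0 ?powR_ge0 // ltW.
  by move: (kap `^ _) (y `^ _) => p q; lra.
Qed.

Lemma tfield_lip z w y Y M (n_gt0 : 0 < n) (n_lt2 : n < 2) : start_ok -> 0 < kap <= 1 ->
  continuous z -> continuous w -> 0 <= y <= Y ->
  (forall t, 0 <= t <= y -> `|z t - w t| <= M) ->
  `|tfield z y - tfield w y| <= kap `^ (- n) * (1 + Y ^+ 2) * M.
Proof.
move=> st k01 cz cw yY H.
have M0 : 0 <= M by apply: le_trans (normr_ge0 _) (H 0 _); lra.
have k0 : 0 <= kap `^ (- n) by exact: powR_ge0.
have Y2 : 0 <= Y ^+ 2 by exact: sqr_ge0.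
have [y0|y0] := leP y 0.
  by rewrite !tfield_le0 // subrr normr0 !mulr_ge0 // addr_ge0.
have kap0 : 0 < kap by lra.
have b0 := @barrier_gt0 y st (ltW y0) (or_intror y0).
have kb : 0 < kap * barrier y by rewrite mulr_gt0.
have -> : tfield z y - tfield w y = nonlin n (Num.max (tpos w y) (kap * barrier y)) -
   nonlin n (Num.max (tpos z y) (kap * barrier y)).
  by rewrite (tfield_gt0 z y0) (tfield_gt0 w y0) opprB addrC subrKA.
have lip := @g_lip R n (kap * barrier y) (Num.max (tpos w y) (kap * barrier y))
  (Num.max (tpos z y) (kap * barrier y)) n_gt0 n_lt2 kb
  ltac:(by rewrite le_max lexx orbT) ltac:(by rewrite le_max lexx orbT).
apply: le_trans lip _.
have e1 t : 0 <= t <= y -> `|tvel w t - tvel z t| <= M * y.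
  move=> ty.
  have -> : tvel w t - tvel z t = prim (fun s => tacc w s - tacc z s) t.
    by rewrite primB; [rewrite /tvel; move: (prim _ _) (prim _ _) => *; ring|exact: tacc_cont|exact: tacc_cont].
  apply: (@le_trans _ _ (M * t)); last by rewrite ler_wpM2l //; lra.
  apply: prim_bound; [by apply: cont_sub; exact: tacc_cont|lra|move=> s sy].
  have -> : tacc w s - tacc z s = w s - z s by rewrite /tacc; ring.
  by rewrite distrC; apply: H; lra.
have e0 : `|tpos w y - tpos z y| <= M * y * y.
  have -> : tpos w y - tpos z y = prim (fun s => tvel w s - tvel z s) y.
    by rewrite primB; [rewrite /tpos; move: (prim _ _) (prim _ _) => *; ring|exact: tvel_cont|exact: tvel_cont].
  apply: prim_bound; [by apply: cont_sub; exact: tvel_cont|lra|move=> s sy].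
  by apply: e1; lra.
have e2 : `|Num.max (tpos w y) (kap * barrier y) - Num.max (tpos z y) (kap * barrier y)|
    <= M * y * y.
  apply: le_trans e0; move: (tpos w y) (tpos z y) (kap * barrier y) => p q r.
  have := ler_norm (p - q); have := ler_norm (q - p); rewrite [`|q - p|]distrC ler_norml.
  by case: (leP p r) => ?; case: (leP q r) => ?; have := normr_ge0 (p - q); lra.
rewrite kap_barrier_pow //.
apply: (@le_trans _ _ (kap `^ (- n) * barrier y `^ (- n) * (M * y * y))).
  by rewrite ler_wpM2l // mulr_ge0 // powR_ge0.
have -> : kap `^ (- n) * barrier y `^ (- n) * (M * y * y) =
  kap `^ (- n) * (M * (barrier y `^ (- n) * (y * y))) by ring.
have -> : kap `^ (- n) * (1 + Y ^+ 2) * M = kap `^ (- n) * (M * (1 + Y ^+ 2)) by ring.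
rewrite ler_wpM2l // ler_wpM2l //.
have bmin := @barrier_ge y st (ltW y0).
have [y1|y1] := leP y 1.
  rewrite /Num.min in bmin; have yb : y <= barrier y by apply: le_trans bmin; case: ltP => //; lra.
  apply: (@le_trans _ _ (y `^ (- n) * (y * y))).
    rewrite ler_wpM2r ?mulr_ge0 ?(ltW y0) //.
    by apply: powR_le_neg => //; exact: ltW.
  have -> : y `^ (- n) * (y * y) = y `^ (2 - n).
    by rewrite [2 - n]addrC powR_split // powR_mulrn ?ltW // expr2.
  apply: (@le_trans _ _ 1); last lra.
  have y01 : 0 < y <= 1 by rewrite y0.
  have n0 : 0 <= 2 - n by lra.
  by have := ger_powR y01 n0; rewrite powRr0.
have b1 : 1 <= barrier y by apply: le_trans bmin; case: (leP y 1) => ?; lra.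
apply: (@le_trans _ _ (1 `^ (- n) * (y * y))).
  rewrite ler_wpM2r ?mulr_ge0 ?(ltW y0) //.
  by apply: powR_le_neg => //; exact: ltW.
by rewrite powR1 mul1r; nra.
Qed.

(** In the singular term the height is replaced by its maximum with [kap * barrier]; the field
    is then Lipschitz in the supremum norm. *)
Lemma truncated_solution Y (n_gt0 : 0 < n) (n_lt2 : n < 2) : start_ok -> 0 < kap <= 1 ->
  0 <= Y -> exists F : jet R,
  [/\ continuous (acc F), (forall y, is_derive y 1 (vel F) (acc F y)),
      (forall y, is_derive y 1 (pos F) (vel F y)),
      [/\ pos F 0 = x0, vel F 0 = v & acc F 0 = a] &
      forall y, 0 < y < Y ->
        is_derive y 1 (acc F) (- nonlin n (Num.max (pos F y) (kap * barrier y)))].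
Proof.
move=> st k01 Y0.
have [||z cz Hz|z [cz z0 Dz]] := @volterra R tfield (kap `^ (- n) * (1 + Y ^+ 2)) Y _ Y0.
- by rewrite mulr_ge0 ?powR_ge0 // addr_ge0 // sqr_ge0.
- by move=> z; exact: tfield_cont.
- by move=> M cz' cw yY H; exact: tfield_lip.
exists (Jet (tpos z) (tvel z) (tacc z)); split => /=.
- exact: tacc_cont.
- by move=> y; exact: isD_tvel.
- by move=> y; exact: isD_tpos.
- by rewrite tpos0 tvel0 tacc0.
move=> y yY; have x00 := start_ge0 st.
have Dg : is_derive y 1 (fun y => gint n (x0 + y)) ((x0 + y) `^ (1 - n)).
  have xy0 : 0 < x0 + y by lra.
  apply: (isD_eq (@isD_comp _ (gint n) (fun y => x0 + y) y _ _ (isD_gint n_lt2 xy0)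
    (isD_add (isD_cst x0 y) (isD_id y)))).
  by rewrite add0r mulr1.
rewrite /tacc; ders; first exact: Dz.
rewrite tfield_gt0; last lra.
by rewrite -gE; [ring|lra].
Qed.

End Truncated.

Section PositiveSolutions.
Context {R : realType} (n : R).
Implicit Types (F G : jet R) (f : R -> R) (a b x y s t e Y : R).

Lemma cont_pos_near f x : continuous f -> 0 < f x ->
  exists2 d, 0 < d & forall y, `|y - x| < d -> 0 < f y.
Proof.
move=> cf fx; have [d d0 H] := (contP f x).1 (cf x) (f x) fx.
by exists d => // y /H; rewrite ltr_norml; lra.
Qed.

Lemma first_hit f Y : continuous f -> 0 < Y ->
  (exists2 r, 0 < r & forall s, 0 <= s < r -> 0 <= f s) ->
  (forall s, 0 <= s <= Y -> 0 <= f s) \/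
  exists2 t, 0 < t < Y & f t = 0 /\ forall s, 0 <= s <= t -> 0 <= f s.
Proof.
move=> cf Y0 [r r0 Hr].
have [|H] := pselect (exists2 t, 0 < t < Y & f t = 0 /\ forall s, 0 <= s <= t -> 0 <= f s).
  by right.
left; apply: real_ind; first by apply: Hr; lra.
- move=> x xY Hx; have [x0|x0] := leP x 0.
    by exists r => // y yx yY; apply: Hr; lra.
  have fx : 0 < f x.
    rewrite lt_neqAle eq_sym Hx ?andbT; last lra.
    by apply/eqP => fx; apply: H; exists x; [lra|split].
  have [d d0 Hd] := cont_pos_near cf fx.
  by exists d => // y yx yY; apply/ltW/Hd; rewrite ltr_norml; lra.
- move=> x xY Hx; rewrite leNgt; apply/negP => fx.
  have cf' : continuous (fun y => - f y) by conts.
  have [d d0 Hd] := @cont_pos_near (fun y => - f y) x cf' ltac:(cbv beta; lra).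
  pose z := Num.max 0 (x - d / 2).
  have [z0 z1] : 0 <= z /\ x - d / 2 <= z by rewrite /z !le_max !lexx orbT.
  have z2 : z < x by rewrite /z gt_max; lra.
  clearbody z.
  have := Hx z ltac:(lra); have := Hd z ltac:(rewrite ltr_norml; lra); lra.
Qed.

Lemma acc_decr a b F : jsol n 1 a b F -> (forall y, a < y < b -> 0 < pos F y) ->
  forall x y, a <= x -> x < y -> y <= b -> acc F y < acc F x.
Proof.
move=> [_ _ c2 _ D2] F0 x y ax xy yb; rewrite -ltrN2.
apply: (@mvt_lt _ (fun t => - acc F t)) => // [|t txy]; first by conts.
have Ft := F0 t ltac:(lra).
exists (- (- 1 * nonlin n (pos F t))).
  by apply: isD_opp; apply: D2; [lra|rewrite gt_eqF].
by rewrite mulN1r opprK g_gt0.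
Qed.

Lemma acc_nincr a b F : jsol n 1 a b F -> (forall y, a < y < b -> 0 < pos F y) ->
  forall x y, a <= x -> x <= y -> y <= b -> acc F y <= acc F x.
Proof.
move=> sF F0 x y ax; rewrite le_eqVlt => /predU1P[->//|xy] yb.
by apply/ltW; apply: (acc_decr sF F0).
Qed.

(** Once the velocity of a positive solution is negative it stays so: by then the
    acceleration, which decreases, is nonpositive. *)
Lemma vel_neg_stays b F : 0 <= vel F 0 \/ acc F 0 <= 0 ->
  jsol n 1 0 b F -> (forall y, 0 < y < b -> 0 < pos F y) ->
  forall s, 0 <= s <= b -> vel F s < 0 ->
  acc F s <= 0 /\ forall t, s <= t <= b -> vel F t <= vel F s.
Proof.
move=> st sF F0 s sb vs; have [c0 c1 c2 D _] := sF.
have mono := acc_nincr sF F0.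
have as0 : acc F s <= 0.
  case: st => [v0|a0]; last by apply: le_trans a0; apply: mono; lra.
  have s0 : 0 < s.
    by rewrite lt_neqAle; apply/andP; split; [apply: contraTN vs => /eqP <-; rewrite -leNgt|lra].
  have [x xs E] := @mvt_ex _ (vel F) (acc F) 0 s s0 c1 (fun x xs => (D x ltac:(lra)).2).
  have : acc F s <= acc F x by apply: mono; lra.
  suff : acc F x < 0 by lra.
  by rewrite -(pmulr_llt0 _ (_ : 0 < s - 0)) -?E; lra.
split=> // t tsb; apply: (@mvt_ge _ (vel F)) => //; first lra.
move=> x xst; exists (acc F x); first by have [] := D x ltac:(lra).
by apply: le_trans as0; apply: mono; lra.
Qed.

End PositiveSolutions.

Section Existence.
Context {R : realType} (n x0 v a : R).
Implicit Types (F G : jet R) (x y s t e Y kap : R) (i j : nat).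

Local Notation b := (barrier x0).

(** Just after the start the solution is above a small multiple of the barrier, so if it ever
    falls below there is a first later time of contact. *)
Lemma truncated_exit kap Y F : start_ok x0 v -> 0 < kap < 1 -> 0 < Y ->
  continuous (acc F) -> (forall y, is_derive y 1 (vel F) (acc F y)) ->
  (forall y, is_derive y 1 (pos F) (vel F y)) -> pos F 0 = x0 -> vel F 0 = v ->
  (forall s, 0 <= s <= Y -> kap * b s <= pos F s) \/
  exists2 t, 0 < t < Y & pos F t = kap * b t /\
     forall s, 0 <= s <= t -> kap * b s <= pos F s.
Proof.
move=> st k01 Y0 c2 D1 D0 p0 v0.
have c1 : continuous (vel F) by move=> y; exact: isD_cont (D1 y).
have c0 : continuous (pos F) by move=> y; exact: isD_cont (D0 y).
have cf : continuous (fun y => pos F y - kap * b y).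
  by apply: cont_sub => //; apply: cont_mul; [exact: cont_cst|exact: barrier_cont].
have [|H|[t tY [H1 H2]]] := first_hit cf Y0.
- have [x00|x00] := ltP 0 x0.
    have f0 : 0 < pos F 0 - kap * b 0.
      by rewrite p0 /barrier /Num.min ltr01; nra.
    have [d d0 Hd] := cont_pos_near cf f0.
    by exists d => // s sd; apply/ltW/Hd; rewrite subr0 ger0_norm; lra.
  have [x0E vE] : x0 = 0 /\ v = 1 by have [|//] := st; lra.
  have cv : continuous (fun y => vel F y - kap) by conts.
  have f0 : 0 < vel F 0 - kap by lra.
  have [d d0 Hd] := cont_pos_near cv f0.
  exists (Num.min d 1); first by rewrite lt_min d0 ltr01.
  move=> s; rewrite lt_min => /and3P[s0 sd s1].
  have -> : b s = s by rewrite /barrier x0E add0r; case: (leP s 1) => ?; lra.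
  have : pos F 0 - kap * 0 <= pos F s - kap * s.
    apply: (@mvt_le _ (fun y => pos F y - kap * y)) => //; first by conts.
    move=> y ys; exists (vel F y - kap); first by ders; [exact: D0|rewrite mulr0 addr0 mulr1].
    by apply/ltW/Hd; rewrite subr0 ger0_norm; lra.
  by rewrite p0 x0E mulr0 subr0.
- by left => s sY; have := H s sY; lra.
- right; exists t => //; split; first by lra.
  by move=> s st'; have := H2 s st'; lra.
Qed.

Lemma truncated_jsol kap Y t F : start_ok x0 v -> 0 < kap -> t <= Y ->
  continuous (acc F) -> (forall y, is_derive y 1 (vel F) (acc F y)) ->
  (forall y, is_derive y 1 (pos F) (vel F y)) ->
  (forall y, 0 < y < Y ->
     is_derive y 1 (acc F) (- nonlin n (Num.max (pos F y) (kap * b y)))) ->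
  (forall s, 0 <= s <= t -> kap * b s <= pos F s) ->
  jsol n 1 0 t F /\ forall y, 0 < y <= t -> 0 < pos F y.
Proof.
move=> st k0 tY c2 D1 D0 D2 H; split.
  split => //.
  - by move=> y; exact: isD_cont (D0 y).
  - by move=> y; exact: isD_cont (D1 y).
  - move=> y yt Fy; have := D2 y ltac:(lra).
    have Hy := H y ltac:(lra).
    have -> : Num.max (pos F y) (kap * b y) = pos F y by apply: max_l.
    by rewrite mulN1r.
move=> y yt; apply: lt_le_trans (H y _); last lra.
by rewrite mulr_gt0 //; apply: (barrier_gt0 st); [lra|right; lra].
Qed.

Lemma truncated_uniq kap Y t F G (n_gt0 : 0 < n) (n_lt2 : n < 2) : start_ok x0 v ->
  0 < kap -> 0 <= t <= Y ->
  jsol n 1 0 t F -> jsol n 1 0 t G ->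
  (forall s, 0 <= s <= t -> kap * b s <= pos F s) ->
  pos G 0 = pos F 0 -> vel G 0 = vel F 0 -> acc G 0 = acc F 0 ->
  forall y, 0 <= y <= t ->
    [/\ pos G y = pos F y, vel G y = vel F y & acc G y = acc F y].
Proof.
move=> st k0 tY sF sG H e0 e1 e2.
have m0 : 0 < kap / (1 + Y) by rewrite divr_gt0 //; lra.
apply: (uniq_above n_gt0 n_lt2 _ _ m0 sF sG) => //; first by rewrite normr1.
move=> y yt; apply: le_trans (H y yt); rewrite -mulrA ler_pM2l //.
apply: le_trans (@barrier_ge _ x0 v y st _); last lra.
rewrite ler_pdivrMl; last lra.
by case: (leP y 1) => ?; nra.
Qed.

End Existence.

Section ExistenceUpToLanding.
Context {R : realType} (n : R).
Implicit Types (F G : jet R) (x y s t e u v Y kap : R) (i j : nat).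

Definition jinit F x x0 v a := [/\ pos F x = x0, vel F x = v & acc F x = a :> R].

Lemma gint_le u v (n_lt2 : n < 2) : 0 <= u -> u <= v -> gint n u <= gint n v.
Proof.
move=> u0 uv; have n2 : 0 <= (2 - n)^-1 by rewrite invr_ge0; lra.
rewrite /gint ler_wpM2l // /apow !ger0_norm; [|lra|lra].
by apply: ge0_ler_powR => //; rewrite ?nnegrE; lra.
Qed.

(** Near a landing the velocity stays below [- c], so the total variation of the
    acceleration is controlled by the height: [acc - gint pos / c] increases. *)
Lemma landing_drop F (n_gt0 : 0 < n) (n_lt2 : n < 2) (a b c : R) : 0 < c -> a <= b ->
  jsol n 1 a b F -> (forall y, a < y < b -> 0 < pos F y) ->
  (forall y, a < y < b -> vel F y <= - c) ->
  acc F a - c^-1 * gint n (pos F a) <= acc F b - c^-1 * gint n (pos F b).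
Proof.
move=> c0 ab [c0' c1 c2 D D2] Fp Fv.
apply: (@mvt_le _ (fun y => acc F y - c^-1 * gint n (pos F y))) => //.
  apply: cont_sub => //; apply: cont_mul; first exact: cont_cst.
  exact: (cont_comp (gint_cont n_lt2)).
move=> y yab; have Fy := Fp y yab; have vy := Fv y yab.
exists (- 1 * nonlin n (pos F y) - (c^-1 * (pos F y `^ (1 - n) * vel F y) + gint n (pos F y) * 0)).
  apply: isD_sub; first by apply: D2 => //; rewrite gt_eqF.
  by apply: (isD_mul (isD_cst _ _)); apply: (isD_comp (isD_gint n_lt2 Fy)); have [] := D y yab.
rewrite -gE // mulr0 addr0.
have g0 : 0 < nonlin n (pos F y) by exact: g_gt0.
have : c^-1 * vel F y <= - 1.
  by rewrite -[in leRHS](mulVf (lt0r_neq0 c0)) -mulrN ler_wpM2l // invr_ge0 ltW.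
move: g0; move: (nonlin n _) (c^-1) (vel F y) => g ci w *; nra.
Qed.

(** A truncated solution solves the equation until it meets [kap * barrier].  If this happens
    before [Y] for every [kap], the second derivatives at the times of contact form a
    uniformly Cauchy sequence by [landing_drop], and the limit lands. *)
Lemma existence x0 v a Y (n_gt0 : 0 < n) (n_lt2 : n < 2) :
  start_ok x0 v -> 0 <= v \/ a <= 0 -> 0 < Y ->
  exists F T, [/\ 0 < T <= Y, jsol n 1 0 T F, jinit F 0 x0 v a,
    forall y, 0 < y < T -> 0 < pos F y &
    pos F T = 0 \/ (T = Y /\ 0 < pos F T)].
Proof.
move=> st sta Y0.
pose kap j : R := 2^-1 ^+ j.+1.
have kap0 j : 0 < kap j by rewrite exprn_gt0.
have kap1 j : kap j < 1 by rewrite exprn_ilt1 //; lra.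
have kapS i j : (i < j)%N -> kap j < kap i.
  by move=> ij; rewrite /kap ltr_iXn2l //; lra.
have kapE : kap = (fun j => 2^-1 ^+ j.+1) by [].
clearbody kap.
have x00 := start_ge0 st.
have k01 j : 0 < kap j <= 1 by apply/andP; split; [exact: kap0|exact: ltW].
have [F HF] := choice (fun j =>
  @truncated_solution R n x0 v a (kap j) Y n_gt0 n_lt2 st (k01 j) (ltW Y0)).
have ini j : jinit (F j) 0 x0 v a by have [] := HF j.
have sol j s : s <= Y -> (forall t, 0 <= t <= s -> kap j * barrier x0 t <= pos (F j) t) ->
    jsol n 1 0 s (F j) /\ forall y, 0 < y <= s -> 0 < pos (F j) y.
  by move=> sY H; have [c2 D1 D0 _ D2] := HF j; exact: (truncated_jsol st (kap0 j) sY c2 D1 D0 D2 H).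
have exits j : (forall s, 0 <= s <= Y -> kap j * barrier x0 s <= pos (F j) s) \/
  exists2 t, 0 < t < Y & pos (F j) t = kap j * barrier x0 t /\
     forall s, 0 <= s <= t -> kap j * barrier x0 s <= pos (F j) s.
  have [c2 D1 D0 [p0 v0 _] _] := HF j.
  have k01' : 0 < kap j < 1 by apply/andP; split; [exact: kap0|exact: kap1].
  exact: (truncated_exit st k01' Y0 c2 D1 D0 p0 v0).
have [[j Hj]|noexit] := pselect (exists j, forall s, 0 <= s <= Y -> kap j * barrier x0 s <= pos (F j) s).
  have [sj pj] := sol j Y (lexx _) Hj.
  exists (F j), Y; split => //; first by rewrite Y0 lexx.
    by move=> y yY; apply: pj; lra.
  by right; split => //; apply: pj; rewrite Y0 lexx.
have texists j : exists t : R, 0 < t < Y /\ (pos (F j) t = kap j * barrier x0 t /\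
     forall s, 0 <= s <= t -> kap j * barrier x0 s <= pos (F j) s).
  have [H|[t tY H]] := exits j; last by exists t.
  by exfalso; apply: noexit; exists j.
have [t Ht] := choice texists; clear texists.
have t0 j : 0 < t j by have [/andP[]] := Ht j.
have tY j : t j < Y by have [/andP[]] := Ht j.
have pt j : pos (F j) (t j) = kap j * barrier x0 (t j) by have [_ []] := Ht j.
have bt j s : 0 <= s <= t j -> kap j * barrier x0 s <= pos (F j) s by have [_ [_]] := Ht j; apply.
have sj j : jsol n 1 0 (t j) (F j) by have [] := sol j (t j) (ltW (tY j)) (bt j).
have pj j y : 0 < y <= t j -> 0 < pos (F j) y.
  by have [_] := sol j (t j) (ltW (tY j)) (bt j); apply.
have b0 s : 0 < s -> 0 < barrier x0 s by move=> s0; apply: (barrier_gt0 st (ltW s0)); right.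
have b1 s : 0 <= s -> barrier x0 s <= x0 + 1 by move=> s0; have [] := barrier_le st s0.
clear HF sol exits noexit Ht.
have agree i j y : 0 <= y -> y <= t i -> y <= t j ->
    [/\ pos (F j) y = pos (F i) y, vel (F j) y = vel (F i) y & acc (F j) y = acc (F i) y].
  move=> y0 yi yj; have [pi vi ai] := ini i; have [pj' vj aj] := ini j.
  apply: (@truncated_uniq R n x0 v (kap i) Y y (F i) (F j) n_gt0 n_lt2 st (kap0 i)).
  - by rewrite y0 /=; apply: le_trans yi _; exact: ltW.
  - exact: jsol_sub (lexx _) yi (sj i).
  - exact: jsol_sub (lexx _) yj (sj j).
  - by move=> s /andP[s0 sy]; apply: bt; rewrite s0 (le_trans sy).
  - by rewrite pi pj'.
  - by rewrite vi vj.
  - by rewrite ai aj.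
  - by rewrite y0 lexx.
have tS i j : (i < j)%N -> t i < t j.
  move=> ij; rewrite ltNge; apply/negP => tji.
  have [pe _ _] := agree i j (t j) (ltW (t0 j)) tji (lexx _).
  have := bt i (t j) ltac:(by rewrite tji ltW); rewrite -pe pt ler_pM2r ?b0 //.
  by rewrite leNgt kapS.
have tle i j : (i <= j)%N -> t i <= t j.
  by rewrite leq_eqVlt => /predU1P[->//|ij]; apply/ltW/tS.
have small e : 0 < e -> exists N, forall j, (N <= j)%N -> kap j * (x0 + 1) < e.
  move=> e0; have [N HN] := @half_pow_lt R (e / (x0 + 1)) ltac:(by rewrite divr_gt0 //; lra).
  exists N => j Nj; rewrite -ltr_pdivlMr; last lra.
  by rewrite kapE; apply: HN; exact: leqW.
have inij j : 0 <= vel (F j) 0 \/ acc (F j) 0 <= 0 by have [_ -> ->] := ini j.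
have vns j s : 0 <= s <= t j -> vel (F j) s < 0 -> acc (F j) s <= 0 /\
    forall y, s <= y <= t j -> vel (F j) y <= vel (F j) s.
  by apply: (vel_neg_stays (inij j) (sj j)) => y /andP[y0 yt]; apply: pj; rewrite y0 ltW.
have [j0 vj0] : exists j0, vel (F j0) (t j0) < 0.
  apply: contrapT => H.
  have vge j s : 0 <= s <= t j -> 0 <= vel (F j) s.
    move=> /andP[s0 stj]; rewrite leNgt; apply/negP => vs.
    have [_ /(_ (t j))] := vns j s ltac:(by rewrite s0) vs; rewrite stj lexx => /(_ isT) le.
    by apply: H; exists j; exact: le_lt_trans vs.
  have p0 : 0 < kap 0%N * barrier x0 (t 0%N) by rewrite mulr_gt0 ?b0.
  have [N HN] := small _ p0; have hN := HN N (leqnn _).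
  have [pe _ _] := agree 0%N N (t 0%N) (ltW (t0 _)) (lexx _) (tle _ _ (leq0n _)).
  have : pos (F N) (t 0%N) <= pos (F N) (t N).
    have [c0 _ _ D _] := sj N.
    apply: (@mvt_le _ (pos (F N))) => //; first exact: tle.
    move=> y /andP[y1 y2]; have y0 : 0 < y by exact: lt_trans y1.
    exists (vel (F N) y); first by have [] := D y ltac:(by rewrite y0).
    by apply: vge; rewrite !ltW.
  rewrite pe !pt; have := b1 (t N) (ltW (t0 N)).
  by have := kap0 N; move: (kap N) (barrier x0 (t N)) (kap 0%N * _) hN => *; nra.
pose c := - vel (F j0) (t j0).
have c0 : 0 < c by rewrite oppr_gt0.
have tail j s : (j0 <= j)%N -> t j0 <= s <= t j -> vel (F j) s <= - c.
  move=> jj /andP[s1 s2]; rewrite opprK.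
  have [_ ve _] := agree j0 j (t j0) (ltW (t0 _)) (lexx _) (tle _ _ jj).
  rewrite -ve; rewrite -ve in vj0.
  have [_] := vns j (t j0) ltac:(by rewrite ltW ?t0 // tle) vj0; apply; exact/andP.
clearbody c.
have mono j x y : 0 <= x -> x <= y -> y <= t j -> acc (F j) y <= acc (F j) x.
  by apply: (acc_nincr (sj j)) => z /andP[z0 zt]; apply: pj; rewrite z0 ltW.
have drop i j : (j0 <= i)%N -> (i <= j)%N ->
    acc (F j) (t i) - acc (F j) (t j) <= c^-1 * gint n (kap i * (x0 + 1)).
  move=> ji ij.
  have := @landing_drop (F j) n_gt0 n_lt2 (t i) (t j) c c0 (tle _ _ ij).
  have [pe _ _] := agree i j (t i) (ltW (t0 _)) (lexx _) (tle _ _ ij).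
  move=> /(_ (jsol_sub (ltW (t0 i)) (lexx _) (sj j))).
  have H1 y : t i < y < t j -> 0 < pos (F j) y.
    by move=> /andP[y1 y2]; apply: pj; rewrite (lt_trans (t0 i)) // ltW.
  have H2 y : t i < y < t j -> vel (F j) y <= - c.
    move=> /andP[y1 y2]; apply: tail; first exact: leq_trans ij.
    by rewrite (ltW y2) andbT; apply: le_trans (tle _ _ ji) (ltW y1).
  move=> /(_ H1 H2); rewrite pe pt.
  have ci : 0 <= c^-1 by rewrite invr_ge0 ltW.
  have g1 : 0 <= c^-1 * gint n (pos (F j) (t j)) by rewrite mulr_ge0 // gint_ge0.
  have g2 : c^-1 * gint n (kap i * barrier x0 (t i)) <= c^-1 * gint n (kap i * (x0 + 1)).
    have k0 := kap0 i; have bt0 := b0 _ (t0 i).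
    rewrite ler_wpM2l //; apply: gint_le => //; first by rewrite mulr_ge0 // ltW.
    by rewrite ler_pM2l // b1 // ltW.
  by move: g1 g2; move: (c^-1 * _) (c^-1 * _) (c^-1 * _) => *; lra.
pose W i y := acc (F (i + j0)%N) (clamp 0 (t (i + j0)%N) y).
have cW i : continuous (W i).
  by have [_ _ c2 _ _] := sj (i + j0)%N; apply: (cont_comp c2); exact: clamp_cont.
have small2 e : 0 < e -> exists N, forall j, (N <= j)%N -> c^-1 * gint n (kap j * (x0 + 1)) <= e.
  move=> e0; have ce : 0 < e * c by exact: mulr_gt0.
  have [d d0 Hd] := (contP (gint n) 0).1 (gint_cont n_lt2 (x:=0)) (e * c) ce.
  have [N HN] := small d d0.
  exists N => j Nj; have k1 : 0 <= kap j * (x0 + 1) by rewrite mulr_ge0 ?(ltW (kap0 _)) //; lra.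
  have := Hd (kap j * (x0 + 1)); rewrite subr0 ger0_norm // gint0 // subr0 => /(_ (HN j Nj)).
  by rewrite ger0_norm ?gint_ge0 // => h; rewrite ler_pdivrMl // [c * e]mulrC ltW.
have clw j y : t j <= y -> clamp 0 (t j) y = t j by move=> ty; apply: clamp_ge => //; exact: ltW.
have cauchyW e : 0 < e -> exists N, forall i j y, (N <= i)%N -> (N <= j)%N -> `|W i y - W j y| <= e.
  move=> e0; have [N HN] := small2 e e0; exists N => i j y.
  wlog ij : i j / (i <= j)%N => [H|] Ni Nj.
    have [ij|/ltnW ji] := leqP i j; first exact: H.
    by rewrite distrC; exact: H.
  have ij' : (i + j0 <= j + j0)%N by rewrite leq_add2r.
  apply: le_trans (HN (i + j0)%N (leq_trans Ni (leq_addr _ _))).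
  apply: le_trans (drop _ _ (leq_addl _ _) ij').
  have tij := tle _ _ ij'; have ti0 := t0 (i + j0)%N; have tj0 := t0 (j + j0)%N.
  have m1 := mono (j + j0)%N (t (i + j0)%N) (t (j + j0)%N) (ltW ti0) tij (lexx _).
  rewrite /W; have [yi|/ltW yi] := leP y (t (i + j0)%N).
    have -> : clamp 0 (t (i + j0)%N) y = clamp 0 (t (j + j0)%N) y.
      have [y0|/ltW y0] := leP y 0; first by rewrite !clamp_le // ltW.
      by rewrite !clamp_id ?y0 ?yi // (le_trans yi).
    have cl : 0 <= clamp 0 (t (j + j0)%N) y <= t (i + j0)%N.
      have [y0|/ltW y0] := leP y 0; first by rewrite clamp_le ?lexx ?(ltW ti0) // ltW.
      by rewrite clamp_id ?y0 ?yi // (le_trans yi).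
    have [_ _ ->] := agree (i + j0)%N (j + j0)%N (clamp 0 (t (j + j0)%N) y) (andP cl).1 (andP cl).2
      (le_trans (andP cl).2 tij).
    by rewrite subrr normr0; lra.
  rewrite (clw _ _ yi).
  have [_ _ <-] := agree (i + j0)%N (j + j0)%N (t (i + j0)%N) (ltW ti0) (lexx _) tij.
  have cl := clamp_itv y (ltW tj0).
  have yc : t (i + j0)%N <= clamp 0 (t (j + j0)%N) y.
    have [yj|/ltW yj] := leP y (t (j + j0)%N); last by rewrite clw.
    by rewrite clamp_id // yj andbT (le_trans (ltW ti0)).
  have m2 := mono (j + j0)%N (t (i + j0)%N) _ (ltW ti0) yc (andP cl).2.
  have m3 := mono (j + j0)%N _ (t (j + j0)%N) (andP cl).1 (andP cl).2 (lexx _).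
  by rewrite ger0_norm; lra.
have [w cw Hw] := unif_cauchy_lim cW cauchyW.
have wE j y : 0 <= y <= t j -> w y = acc (F j) y.
  move=> /andP[y0 yj]; apply/eqP; rewrite -subr_eq0 -normr_le0; apply/ler_addgt0Pl => e e0.
  rewrite addr0; have [N HN] := Hw e e0.
  have := HN (maxn N j) y (leq_maxl _ _); rewrite distrC /W.
  have jm : (j <= maxn N j + j0)%N by rewrite (leq_trans (leq_maxr N j)) // leq_addr.
  have ym := le_trans yj (tle _ _ jm).
  rewrite clamp_id ?y0 //.
  by have [_ _ ->] := agree j (maxn N j + j0)%N y y0 yj ym.
pose u y := v + prim w y.
have cu : continuous u by apply: cont_add; [exact: cont_cst|exact: prim_cont].
have Du y : is_derive y 1 u (w y).
  by apply: (isD_eq (isD_add (isD_cst v y) (prim_derive y cw))); rewrite add0r.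
pose f y := x0 + prim u y.
have cf : continuous f by apply: cont_add; [exact: cont_cst|exact: prim_cont].
have Df y : is_derive y 1 f (u y).
  by apply: (isD_eq (isD_add (isD_cst x0 y) (prim_derive y cu))); rewrite add0r.
have u0 : u 0 = v by rewrite /u prim0 addr0.
have f0 : f 0 = x0 by rewrite /f prim0 addr0.
clearbody u f.
have uE j y : 0 <= y <= t j -> u y = vel (F j) y.
  move=> /andP[y0 yj]; have [_ c1 _ D _] := sj j; have [_ vj _] := ini j.
  have := @mvt_cst _ (fun y => u y - vel (F j) y) 0 y y0 (cont_sub cu c1).
  rewrite u0 vj subrr => H; apply/eqP; rewrite -subr_eq0; apply/eqP; apply: H.
  move=> z /andP[z0 zy]; have zt : z < t j by exact: lt_le_trans yj.
  have [_ Dz] := D z ltac:(by rewrite z0).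
  by apply: (isD_eq (isD_sub (Du z) Dz)); rewrite (wE j) ?subrr // !ltW.
have fE j y : 0 <= y <= t j -> f y = pos (F j) y.
  move=> /andP[y0 yj]; have [c1 _ _ D _] := sj j; have [vj _ _] := ini j.
  have := @mvt_cst _ (fun y => f y - pos (F j) y) 0 y y0 (cont_sub cf c1).
  rewrite f0 vj subrr => H; apply/eqP; rewrite -subr_eq0; apply/eqP; apply: H.
  move=> z /andP[z0 zy]; have zt : z < t j by exact: lt_le_trans yj.
  have [Dz _] := D z ltac:(by rewrite z0).
  by apply: (isD_eq (isD_sub (Df z) Dz)); rewrite (uE j) ?subrr // !ltW.
pose S := range t.
have hS : has_sup S by split; [exists (t 0%N), 0%N|exists Y => _ [j _ <-]; exact: ltW].
pose T := sup S.
have tT j : t j <= T by apply: ub_le_sup; [exact: hS.2|exists j].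
have TY : T <= Y by apply: ge_sup; [exact: hS.1|move=> _ [j _ <-]; exact: ltW].
have T0 : 0 < T by apply: lt_le_trans (tT 0%N).
have below y : y < T -> exists N, forall j, (N <= j)%N -> y < t j.
  move=> yT; have Ty : 0 < T - y by lra.
  have [_ [N _ <-] h] := sup_adherent Ty hS.
  exists N => j Nj; apply: lt_le_trans (tle _ _ Nj); move: h; rewrite -/T; lra.
clearbody T.
exists (Jet f u w), T; split => /=.
- by rewrite T0.
- split => //= y /andP[y0 yT] fy.
  have [N /(_ N (leqnn _)) yN] := below y yT.
  have [_ _ _ _ D2] := sj N.
  rewrite (fE N) ?(ltW y0) ?(ltW yN) // in fy *.
  apply: (@isD_near _ (acc (F N))); last by apply: D2 => //; rewrite y0.
  exists (Num.min y (t N - y)); first by rewrite lt_min y0 subr_gt0.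
  move=> z; rewrite lt_min !ltr_norml => /andP[h1 h2]; symmetry; apply: wE; lra.
- split => //=; rewrite (wE 0%N) ?lexx ?ltW //; by have [] := ini 0%N.
- move=> y /andP[y0 yT]; have [N /(_ N (leqnn _)) yN] := below y yT.
  by rewrite (fE N) ?pj // ?y0 ?ltW // ltW.
left; apply/eqP; rewrite -normr_le0; apply/ler_addgt0Pl => e e0; rewrite addr0.
have [d d0 Hd] := (contP f T).1 (cf T) (e / 2) ltac:(lra).
have [N1 H1] := below (T - d) ltac:(lra).
have [N2 H2] := small (e / 2) ltac:(lra).
pose j := maxn N1 N2.
have h1 := H1 j (leq_maxl _ _); have h2 := H2 j (leq_maxr _ _).
clearbody j.
have tj := tT j.
have := Hd (t j) ltac:(rewrite ltr_norml; lra).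
have cj : 0 <= t j <= t j by rewrite lexx andbT ltW.
rewrite (fE j _ cj) pt.
have b2 := b1 _ (ltW (t0 j)); have b3 := b0 _ (t0 j); have k0 := kap0 j.
have : kap j * barrier x0 (t j) <= kap j * (x0 + 1) by rewrite ler_pM2l.
have : 0 < kap j * barrier x0 (t j) by exact: mulr_gt0.
rewrite ltr_norml ler_norml; lra.
Qed.

End ExistenceUpToLanding.

(** * Uniqueness and arcs *)

Section Arcs.
Context {R : realType} (n : R).
Implicit Types (F G : jet R) (f : R -> R) (a b c m x y z s t e T Y sg : R).

Lemma cont_min_pos f a b : continuous f -> (forall x, a <= x <= b -> 0 < f x) ->
  exists2 m, 0 < m & forall x, a <= x <= b -> m <= f x.
Proof.
move=> cf fp; have [ab|ba] := leP a b; last by exists 1 => // x xab; lra.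
have [c cab H] := EVT_min ab (continuous_subspaceT cf).
exists (f c); first by apply: fp; rewrite in_itv in cab.
by move=> x xab; apply: H; rewrite in_itv.
Qed.

Lemma cont_eq_left f g a b : a < b -> continuous f -> continuous g ->
  (forall y, a <= y < b -> f y = g y) -> f b = g b.
Proof.
move=> ab cf cg H; apply/eqP; rewrite -subr_eq0 -normr_le0; apply/ler_addgt0Pl => e e0.
rewrite addr0; have [d d0 Hd] := (contP _ b).1 (@cont_sub _ _ _ cf cg b) e e0.
pose z := Num.max a (b - d / 2).
have [z0 z1] : a <= z /\ b - d / 2 <= z by rewrite /z !le_max !lexx orbT.
have z2 : z < b by rewrite /z gt_max; lra.
clearbody z.
have := Hd z ltac:(rewrite ltr_norml; lra).
by rewrite H ?subrr ?sub0r ?normrN; [exact: ltW|rewrite z0].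
Qed.

Definition rising F x := 0 < pos F x \/ (pos F x = 0 /\ 0 < vel F x).

(** A transversal start and positivity afterwards give the linear lower bound that the
    comparison of solutions needs. *)
Lemma above_line F b : rising F 0 -> continuous (pos F) -> continuous (vel F) ->
  (forall y, 0 < y < b -> is_derive y 1 (pos F) (vel F y)) ->
  (forall y, 0 < y <= b -> 0 < pos F y) ->
  exists2 m, 0 < m & forall y, 0 <= y <= b -> m * y <= pos F y.
Proof.
move=> st c0 c1 D Fp.
have [b0|b0] := leP b 0.
  exists 1 => // y yb; have -> : y = 0 by lra.
  by rewrite mulr0; case: st => [/ltW//|[-> _]].
have [r [r0 rb [m1 m10 H1]]] : exists r : R, [/\ 0 < r, r <= b &
    exists2 m : R, 0 < m & forall y, 0 <= y <= r -> m * y <= pos F y].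
  case: st => [p0|[p0 v0]].
    have [d' d'0 Hd'] := (contP (pos F) 0).1 (c0 0) (pos F 0 / 2) ltac:(lra).
    exists (Num.min (d' / 2) b); split; [by rewrite lt_min; lra|by rewrite ge_min lexx orbT|].
    exists (pos F 0 / 2 / b); first by rewrite !divr_gt0.
    move=> y; rewrite le_min => /and3P[y0 yd yb].
    have := Hd' y; rewrite subr0 ger0_norm // ltr_norml => /(_ ltac:(lra)) h.
    have h2 : pos F 0 / 2 / b * y <= pos F 0 / 2 by rewrite mulrAC ler_pdivrMr // ler_wpM2l //; lra.
    lra.
  have [d d0 Hd] := (contP (vel F) 0).1 (c1 0) (vel F 0 / 2) ltac:(lra).
  exists (Num.min (d / 2) b); split; [by rewrite lt_min; lra|by rewrite ge_min lexx orbT|].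
  exists (vel F 0 / 2); first lra.
  move=> y; rewrite le_min => /and3P[y0 yd yb].
  have : pos F 0 - vel F 0 / 2 * 0 <= pos F y - vel F 0 / 2 * y.
    apply: (@mvt_le _ (fun y => pos F y - vel F 0 / 2 * y)) => //; first by conts.
    move=> z /andP[z0 zy]; exists (vel F z - vel F 0 / 2).
      by ders; [apply: D; rewrite z0; lra|rewrite mulr0 addr0 mulr1].
    have := Hd z; rewrite subr0 ger0_norm ?ltr_norml; last lra.
    by move=> /(_ ltac:(lra)); lra.
  by rewrite p0; lra.
have [m2 m20 H2] := @cont_min_pos (pos F) r b c0 (fun y yb => Fp y ltac:(lra)).
exists (Num.min m1 (m2 / b)); first by rewrite lt_min m10 divr_gt0.
have l1 : Num.min m1 (m2 / b) <= m1 by rewrite ge_min lexx.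
have l2 : Num.min m1 (m2 / b) <= m2 / b by rewrite ge_min lexx orbT.
have l0 : 0 < Num.min m1 (m2 / b) by rewrite lt_min m10 divr_gt0.
move: (Num.min _ _) l0 l1 l2 => m l0 l1 l2 y yb; have [yr|ry] := leP y r.
  by apply: le_trans (H1 y _); [rewrite ler_wpM2r //|]; lra.
apply: le_trans (H2 y _); last lra.
apply: (@le_trans _ _ (m2 / b * y)); first by rewrite ler_wpM2r //; lra.
by rewrite mulrAC ler_pdivrMr // ler_wpM2l //; lra.
Qed.

(** [uniq_above] applies up to any earlier time, and the final time follows by continuity. *)
Lemma uniq_forward sg F G b (n_gt0 : 0 < n) (n_lt2 : n < 2) : `|sg| <= 1 -> 0 < b ->
  jsol n sg 0 b F -> jsol n sg 0 b G -> rising F 0 ->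
  (forall y, 0 < y < b -> 0 < pos F y) ->
  jinit G 0 (pos F 0) (vel F 0) (acc F 0) ->
  forall y, 0 <= y <= b -> jinit G y (pos F y) (vel F y) (acc F y).
Proof.
move=> sg1 b0 sF sG st Fp [e0 e1 e2].
have H y : 0 <= y < b -> jinit G y (pos F y) (vel F y) (acc F y).
  move=> yb; have [c0 c1 _ D _] := sF.
  have [m m0 Hm] := @above_line F y st c0 c1 (fun z zy => (D z ltac:(lra)).1)
    (fun z zy => Fp z ltac:(lra)).
  have yb1 : y <= b by lra.
  have yy : 0 <= y <= y by lra.
  have [p q r] := @uniq_above _ n sg F G 0 y m n_gt0 n_lt2 sg1 (lexx _) m0
    (jsol_sub (lexx _) yb1 sF) (jsol_sub (lexx _) yb1 sG) Hm e0 e1 e2 y yy.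
  by split.
move=> y yb; have [yb'|yb'] := ltP y b; first by apply: H; lra.
have -> : y = b by lra.
have [cF0 cF1 cF2 _ _] := sF; have [cG0 cG1 cG2 _ _] := sG.
split; apply: (@cont_eq_left _ _ 0 b) => // z zb; by have [] := H z zb.
Qed.

(** An arc is a positive solution between two zeros, normalized by scaling to have
    unit slope at the first one. *)
Definition is_arc a F T := [/\ 0 < T, jsol n 1 0 T F, jinit F 0 0 1 a,
  forall y, 0 < y < T -> 0 < pos F y & pos F T = 0].

Lemma arc_rising a F T : is_arc a F T -> rising F 0.
Proof. by move=> [_ _ [p v _] _ _]; right; rewrite v. Qed.

Lemma arc_end a F T : is_arc a F T -> [/\ vel F T < 0, acc F T < 0 & acc F T < a].
Proof.
move=> [T0 sF [p0 v0 a0] Fp pT]; have [c0 c1 c2 D D2] := sF.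
have mono := acc_decr sF Fp.
have Th : 0 < T / 2 < T by lra.
have [y yT E] := @mvt_ex _ (pos F) (vel F) (T / 2) T ltac:(lra) c0
  (fun y yT => (D y ltac:(lra)).1).
have vy : vel F y < 0.
  have := Fp _ Th; have : 0 < T - T / 2 by lra.
  move: E; rewrite pT; move: (vel F y) (pos F _) (T - T / 2) => *; nra.
have [ay H] := @vel_neg_stays _ n T F ltac:(by left; rewrite v0) sF Fp y ltac:(lra) vy.
have := H T ltac:(lra); have := mono y T ltac:(lra) ltac:(lra) (lexx _).
by have := mono 0 T (lexx _) T0 (lexx _); rewrite a0; split; lra.
Qed.

(** The energy [vel^2 / 2 - pos * acc] increases along solutions. *)
Lemma arc_slope a F T : is_arc a F T -> vel F T < -1.
Proof.
move=> A; have [v1 _ _] := arc_end A; move: A => [T0 sF [p0 v0 a0] Fp pT].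
have [c0 c1 c2 D D2] := sF.
have : vel F 0 ^+ 2 / 2 - pos F 0 * acc F 0 < vel F T ^+ 2 / 2 - pos F T * acc F T.
  apply: (@mvt_lt _ (fun y => vel F y ^+ 2 / 2 - pos F y * acc F y)) => //; first by conts.
  move=> y yT; have [Dp Dv] := D y yT; have Fy := Fp y yT.
  have Da := D2 y yT (lt0r_neq0 Fy).
  exists (pos F y * nonlin n (pos F y)); last by rewrite mulr_gt0 // g_gt0.
  by ders; field.
rewrite p0 v0 pT !mul0r !subr0 => h; nra.
Qed.

Definition lands a := exists F T, is_arc a F T.

(** A solution that does not land is eventually convex; hence it is enough to see
    the acceleration become negative before some a priori time. *)
Lemma lands_of_acc_neg a Y (n_gt0 : 0 < n) (n_lt2 : n < 2) : 0 < Y ->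
  (forall F, jsol n 1 0 Y F -> jinit F 0 0 1 a -> (forall y, 0 < y < Y -> 0 < pos F y) ->
     exists2 y, 0 <= y <= Y & acc F y < 0) -> lands a.
Proof.
move=> Y0 H.
have st : start_ok (0 : R) 1 by right.
have [F1 [T1 [T1Y s1 i1 Fp1 [e1|[T1E Fp1']]]]] :=
  @existence R n 0 1 a Y n_gt0 n_lt2 st (or_introl ler01) Y0.
  by exists F1, T1; have [T10 _] := andP T1Y; split.
rewrite {}T1E in T1Y s1 Fp1 Fp1'.
have [y1 y1Y ay1] := H F1 s1 i1 Fp1.
pose c := - acc F1 y1; have c0 : 0 < c by rewrite oppr_gt0.
have cE : acc F1 y1 = - c by rewrite opprK.
clearbody c.
have p1 : 0 <= pos F1 y1.
  have [y10|y10] := ltP 0 y1; last by have -> : y1 = 0; [lra|have [-> _ _] := i1].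
  have [y1Y'|y1Y'] := ltP y1 Y; first by apply/ltW/Fp1; lra.
  by (have -> : y1 = Y by lra); exact: ltW.
pose B := pos F1 y1 + `|vel F1 y1|.
have B0 : 0 <= B by rewrite addr_ge0.
have vB : vel F1 y1 <= `|vel F1 y1| by exact: ler_norm.
pose t := 1 + 2 * B / c.
have ct : c * t = c + 2 * B by rewrite /t; field; exact: lt0r_neq0.
have t1 : 1 <= t by rewrite lerDl divr_ge0 ?(ltW c0) //; lra.
clearbody t.
have [F2 [T2 [T2Y s2 i2 Fp2 [e2|[T2E Fp2']]]]] :=
  @existence R n 0 1 a (y1 + t) n_gt0 n_lt2 st (or_introl ler01) ltac:(lra).
  by exists F2, T2; have [T20 _] := andP T2Y; split.
rewrite {}T2E in T2Y s2 Fp2 Fp2'; exfalso.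
have [pe ve ae] : jinit F2 y1 (pos F1 y1) (vel F1 y1) (acc F1 y1).
  have [q1 q2 q3] := i1; have [r1 r2 r3] := i2.
  have [y10|y10] := ltP 0 y1; last first.
    by (have -> : y1 = 0 by lra); split; rewrite ?q1 ?q2 ?q3.
  apply: (@uniq_forward 1 F1 F2 y1 n_gt0 n_lt2 _ y10) => //; first by rewrite normr1.
  - by apply: jsol_sub s1; lra.
  - by apply: jsol_sub s2; lra.
  - by right; rewrite q1 q2.
  - by move=> y yy; apply: Fp1; lra.
  - by split; rewrite ?q1 ?q2 ?q3.
  - by rewrite lexx ltW.
have [c0' c1 c2 D _] := s2.
have mono := acc_nincr s2 Fp2.
have vle y : y1 <= y <= y1 + t -> vel F2 y <= vel F1 y1 - c * (y - y1).
  move=> yy; rewrite -ve.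
  have : vel F2 y + c * (y - y1) <= vel F2 y1 + c * (y1 - y1).
    apply: (@mvt_ge _ (fun y => vel F2 y + c * (y - y1))); [lra|by conts|move=> z zy].
    exists (acc F2 z + c); last by have := mono y1 z ltac:(lra) ltac:(lra) ltac:(lra); lra.
    have [_ Dz] := D z ltac:(lra); by ders; ring.
  by rewrite subrr mulr0; lra.
have : pos F2 (y1 + t) - (vel F1 y1 * (y1 + t - y1) - c * (y1 + t - y1) ^+ 2 / 2) <=
       pos F2 y1 - (vel F1 y1 * (y1 - y1) - c * (y1 - y1) ^+ 2 / 2).
  apply: (@mvt_ge _ (fun y => pos F2 y - (vel F1 y1 * (y - y1) - c * (y - y1) ^+ 2 / 2)));
    [lra|by conts|move=> z zy].
  exists (vel F2 z - (vel F1 y1 - c * (z - y1))).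
    have [Dz _] := D z ltac:(lra); ders; rewrite /=; lra.
  by have := vle z ltac:(lra); lra.
rewrite subrr expr0n /= !mulr0 mul0r !subr0 pe.
have -> : y1 + t - y1 = t by ring.
have : pos F1 y1 + vel F1 y1 * t <= B * t.
  rewrite /B mulrDl lerD //; first by rewrite ler_peMr.
  by rewrite ler_wpM2r //; lra.
have : c * t ^+ 2 / 2 = t * (c / 2 + B) by rewrite expr2 mulrA ct; field.
have : 0 < t * c by rewrite mulr_gt0 //; lra.
move: Fp2'; move: (pos F2 _) (pos F1 _) (vel F1 _) (c * _ ^+ 2 / 2) => *; lra.
Qed.

End Arcs.

Ltac dleaf D z := first [exact (proj1 (D z ltac:(lra))) | exact (proj2 (D z ltac:(lra)))].

(** * Landing of arcs *)

Section Landing.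
Context {R : realType} (n : R).
Implicit Types (F G : jet R) (f : R -> R) (a b c m x y z s t e A L N T Y : R).

Lemma lands_neg a (n_gt0 : 0 < n) (n_lt2 : n < 2) : a < 0 -> lands n a.
Proof.
move=> a0; apply: (@lands_of_acc_neg _ n a 1) => // F _ [_ _ aF] _.
by exists 0; [lra|rewrite aF].
Qed.

Lemma lands_le1 a (n_gt0 : 0 < n) : n <= 1 -> lands n a.
Proof.
move=> n1; have n_lt2 : n < 2 by lra.
pose K := (2 - n) * (`|a| + 1).
have K0 : 0 < K by have := normr_ge0 a; rewrite mulr_gt0 //; lra.
pose Y := K `^ (2 - n)^-1.
have Y0 : 0 < Y by exact: powR_gt0.
have gY : gint n Y = `|a| + 1.
  rewrite /gint apow_gt0E // /Y -powRrM mulVf ?powRr1 ?(ltW K0) //; last by apply: lt0r_neq0; lra.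
  by rewrite /K mulKf //; apply: lt0r_neq0; lra.
clearbody Y.
apply: (@lands_of_acc_neg _ n a Y) => // F sF [p0 v0 a0] Fp.
apply: contrapT => H.
have aF y : 0 <= y <= Y -> 0 <= acc F y.
  by move=> yY; rewrite leNgt; apply/negP => ay; apply: H; exists y.
have [c0 c1 c2 D D2] := sF.
have vF y : 0 <= y <= Y -> 1 <= vel F y.
  move=> yY; rewrite -v0; apply: (@mvt_le _ (vel F)) => //; first by lra.
  by move=> z zy; exists (acc F z); [dleaf D z|apply: aF; lra].
have pF y : 0 <= y <= Y -> y <= pos F y.
  move=> yY; have : pos F 0 - 0 <= pos F y - y.
    apply: (@mvt_le _ (fun y => pos F y - y)) => //; [lra|by conts|].
    move=> z zy; exists (vel F z - 1); last by have := vF z ltac:(lra); lra.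
    by ders; [dleaf D z|rewrite ?subr0].
  by rewrite p0; lra.
have : acc F Y + gint n Y <= acc F 0 + gint n 0.
  apply: (@mvt_ge _ (fun y => acc F y + gint n y)) => //; first exact: ltW.
    by apply: cont_add => //; exact: gint_cont.
  move=> y yY; have Fy := Fp y yY; have y0 : 0 < y by lra.
  exists (- 1 * nonlin n (pos F y) + y `^ (1 - n)).
    exact: isD_add (D2 y yY (lt0r_neq0 Fy)) (isD_gint n_lt2 y0).
  rewrite gE // mulN1r addrC subr_le0; have yp := pF y ltac:(lra).
  by apply: ge0_ler_powR; rewrite ?nnegrE; lra.
rewrite a0 gint0 // gY; have := aF Y ltac:(lra); have := ler_norm a; lra.
Qed.

(** For [n > 1] the solution grows at most like [(1 + a) y^2], so the third
    derivative is at least of order [y^(2 - 2 n)]; its integral diverges exactly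
    when [n <= 3 / 2], and is still large when [n] is slightly larger. *)
Lemma lands_gt1 a A e (n_gt1 : 1 < n) (n_lt2 : n < 2) : 0 <= a -> a <= A -> 0 <= e ->
  2 * n - 3 <= e -> e * (2 * (A + 1) ^+ 2) <= 1 / 2 -> lands n a.
Proof.
move=> a0 aA e0 ne eA; have n_gt0 : 0 < n by lra.
pose L := 2 * (A + 1) ^+ 2.
have L0 : 0 < L by rewrite mulr_gt0 // exprn_gt0 //; lra.
have eL : e * L <= 1 / 2 by [].
pose kap := (1 + A)^-1 / 2.
have kL : kap * L = A + 1 by rewrite /kap /L; field; lra.
have kapE : kap = (1 + A)^-1 / 2 by [].
clearbody L kap.
have Y1 : 1 < expR L by rewrite -expR0 ltr_expR.
apply: (@lands_of_acc_neg _ n a (expR L)) => //; first lra.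
move=> F sF [p0 v0 aF0] Fp; exists (expR L); first by rewrite lexx andbT; lra.
have [c0 c1 c2 D D2] := sF.
have mono := acc_nincr sF Fp.
have vF y : 0 <= y <= expR L -> vel F y <= 1 + a * y.
  move=> yY; have : vel F y - a * y <= vel F 0 - a * 0.
    apply: (@mvt_ge _ (fun y => vel F y - a * y)) => //; [lra|by conts|].
    move=> z zy; exists (acc F z - a).
      by ders; [dleaf D z|rewrite mulr0 addr0 mulr1].
    by have := mono 0 z (lexx _) ltac:(lra) ltac:(lra); lra.
  by rewrite v0; lra.
have pF y : 0 <= y <= expR L -> pos F y <= y + a * y ^+ 2 / 2.
  move=> yY; have : pos F y - (y + a * y ^+ 2 / 2) <= pos F 0 - (0 + a * 0 ^+ 2 / 2).
    apply: (@mvt_ge _ (fun y => pos F y - (y + a * y ^+ 2 / 2))) => //; [lra|by conts|].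
    move=> z zy; exists (vel F z - (1 + a * z)); last by have := vF z ltac:(lra); lra.
    by ders; [dleaf D z|rewrite /=; lra].
  by rewrite p0 expr0n /= mulr0 mul0r addr0; lra.
have : acc F (expR L) + kap * L <= acc F (expR 0) + kap * 0.
  apply: (@mvt_ge _ (fun s => acc F (expR s) + kap * s)); first exact: ltW.
    by apply: cont_add; [apply: (cont_comp c2); exact: continuous_expR|conts].
  move=> s sL; pose y := expR s.
  have y1 : 1 < y by rewrite /y -expR0 ltr_expR; lra.
  have yY : y < expR L by rewrite ltr_expR; lra.
  have Fy := Fp y ltac:(lra).
  exists (- 1 * nonlin n (pos F y) * y + kap).
    have Ds : is_derive s 1 (fun s => acc F (expR s)) (- 1 * nonlin n (pos F y) * y).
      exact: (@isD_comp _ (acc F) expR s _ _ (D2 y ltac:(lra) (lt0r_neq0 Fy)) (is_derive_expR s)).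
    by ders; rewrite mulr0 addr0 mulr1.
  have yE : y `^ (- e) = expR (- e * s) by rewrite /y /powR gt_eqF ?expR_gt0 // expRK.
  clearbody y; rewrite gE // mulN1r.
  suff : kap / y <= pos F y `^ (1 - n).
    by rewrite ler_pdivrMr; [rewrite mulNr; lra|lra].
  have py := pF y ltac:(lra).
  have p2 : pos F y <= (1 + a) * y ^+ 2 by nra.
  have q0 : 0 < (1 + a) * y ^+ 2 by rewrite mulr_gt0 ?exprn_gt0 //; lra.
  apply: (@le_trans _ _ (((1 + a) * y ^+ 2) `^ (1 - n))); last first.
    have -> : 1 - n = - (n - 1) by ring.
    by apply: powR_le_neg => //; lra.
  have y20 : 0 <= y ^+ 2 by exact: sqr_ge0.
  rewrite powRM //; last lra.
  have h1 : (1 + A)^-1 <= (1 + a) `^ (1 - n).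
    apply: (@le_trans _ _ ((1 + a)^-1)); first by rewrite lef_pV2 ?posrE; lra.
    rewrite -powR_inv1; last lra.
    have a1 : 1 <= 1 + a by lra.
    have n1 : -1 <= 1 - n by lra.
    by have := ler_powR a1 n1.
  have h2 : 1 / 2 <= y `^ (- e).
    have es : e * s <= e * L by rewrite ler_wpM2l //; lra.
    by rewrite yE; have := expR_ge1Dx (- e * s); rewrite mulNr; lra.
  have h3 : y^-1 * y `^ (- e) <= (y ^+ 2) `^ (1 - n).
    rewrite -powR_mulrn; last lra.
    rewrite -powRrM -powR_inv1; last lra.
    rewrite -powR_split; last lra.
    have yy1 : 1 <= y by lra.
    have n1 : -1 - e <= 2%:R * (1 - n) by lra.
    by have := ler_powR yy1 n1.
  have yi : 0 < y^-1 by rewrite invr_gt0; lra.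
  have h4 : y^-1 * (1 / 2) <= (y ^+ 2) `^ (1 - n).
    by apply: le_trans h3; rewrite ler_wpM2l // ltW.
  have -> : kap / y = (1 + A)^-1 * (y^-1 * (1 / 2)) by rewrite kapE; ring.
  by apply: ler_pM => //; [rewrite invr_ge0; lra|rewrite mulr_ge0 // ltW].
rewrite kL mulr0 addr0 expR0; have := mono 0 1 (lexx _) ler01 ltac:(lra); lra.
Qed.

Lemma lands_le32 a (n_gt0 : 0 < n) : n <= 3 / 2 -> lands n a.
Proof.
move=> n32; have [n1|n1] := leP n 1; first exact: lands_le1.
have n_lt2 : n < 2 by lra.
have [a0|a0] := ltP a 0; first exact: lands_neg.
by apply: (@lands_gt1 a a 0) => //; [lra|rewrite mul0r; lra].
Qed.

(** A steep negative start gives an arc that is short and low, so its final slope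
    stays bounded while its final acceleration is large. *)
Lemma steep_arc N F T (n_gt0 : 0 < n) (n_lt2 : n < 2) : 1 <= N -> is_arc n (- N) F T ->
  - acc F T > N /\ vel F T ^+ 2 <= 5.
Proof.
move=> N1 A; have [vT _ aT] := arc_end A.
move: A => [T0 sF [p0 v0 a0] Fp pT]; split; first by rewrite ltrNr.
have [c0 c1 c2 D D2] := sF.
have mono := acc_nincr sF Fp.
have vF y : 0 <= y <= T -> vel F y <= 1 - y.
  move=> yY; have : vel F y + y <= vel F 0 + 0.
    apply: (@mvt_ge _ (fun y => vel F y + y)) => //; [lra|by conts|].
    move=> z zy; exists (acc F z + 1); first by ders; [dleaf D z|rewrite ?subr0].
    by have := mono 0 z (lexx _) ltac:(lra) ltac:(lra); lra.
  by rewrite v0; lra.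
have pF y : 0 <= y <= T -> pos F y <= y - y ^+ 2 / 2.
  move=> yY; have : pos F y - (y - y ^+ 2 / 2) <= pos F 0 - (0 - 0 ^+ 2 / 2).
    apply: (@mvt_ge _ (fun y => pos F y - (y - y ^+ 2 / 2))) => //; [lra|by conts|].
    move=> z zy; exists (vel F z - (1 - z)); last by have := vF z ltac:(lra); lra.
    by ders; [dleaf D z|rewrite /=; lra].
  by rewrite p0 expr0n /= mul0r subr0; lra.
have T2 : T <= 2 by have := pF T ltac:(lra); rewrite pT; nra.
have : vel F T ^+ 2 / 2 - pos F T * acc F T - T <= vel F 0 ^+ 2 / 2 - pos F 0 * acc F 0 - 0.
  apply: (@mvt_ge _ (fun y => vel F y ^+ 2 / 2 - pos F y * acc F y - y)) => //.
  - exact: ltW.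
  - by conts.
  move=> y yT; have [Dp Dv] := D y yT; have Fy := Fp y yT.
  have Da := D2 y yT (lt0r_neq0 Fy).
  exists (pos F y * nonlin n (pos F y) - 1); first by ders; field.
  rewrite gE // -[X in X * _]powRr1 ?(ltW Fy) // -powR_split //.
  have p1 : 0 < pos F y <= 1 by rewrite Fy; have := pF y ltac:(lra); nra.
  have n1 : 0 <= 1 + (1 - n) by lra.
  by have := ger_powR p1 n1; rewrite powRr0; lra.
by rewrite pT p0 v0 !mul0r expr1n; lra.
Qed.

Lemma concave_chord f df a b : continuous f ->
  (forall y, a < y < b -> is_derive y 1 f (df y)) ->
  (forall x y, a < x -> x <= y -> y < b -> df y <= df x) ->
  forall y, a <= y <= b -> f a * (b - y) + f b * (y - a) <= f y * (b - a).
Proof.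
move=> cf D mono y yab.
have [ay|ya] := ltP a y; last by (have -> : y = a by lra); rewrite subrr mulr0 addr0.
have [yb|by_] := ltP y b; last by (have -> : y = b by lra); rewrite subrr mulr0 add0r.
have [x xay E1] := mvt_ex ay cf (fun x xay => D x ltac:(lra)).
have [z zyb E2] := mvt_ex yb cf (fun x xay => D x ltac:(lra)).
have := mono x z ltac:(lra) ltac:(lra) ltac:(lra).
have : 0 < (y - a) * (b - y) by rewrite mulr_gt0 //; lra.
by move: E1 E2; move: (f a) (f b) (f y) (df x) (df z) => *; nra.
Qed.

Lemma gint_le_affine y (n_gt32 : 3 / 2 <= n) (n_lt85 : n <= 8 / 5) : 0 <= y ->
  gint n y <= 5 / 2 * (1 + y).
Proof.
move=> y0; have c0 : (2 - n)^-1 <= 5 / 2 by rewrite invf_ple ?posrE; lra.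
have c1 : 0 < (2 - n)^-1 by rewrite invr_gt0; lra.
have : apow (2 - n) y <= 1 + y.
  rewrite /apow ger0_norm //; have [y1|/ltW y1] := leP y 1.
    apply: (@le_trans _ _ (1 `^ (2 - n))); last by rewrite powR1; lra.
    by apply: ge0_ler_powR; rewrite ?nnegrE; lra.
  apply: (@le_trans _ _ y); last lra.
  by apply: ler1_powR => //; lra.
have := apow_ge0 (2 - n) y; rewrite /gint; move: (_^-1) (apow _ _) c0 c1 => *; nra.
Qed.

(** Bounds at the end of the arc that starts with zero acceleration, uniform near
    [n = 3 / 2]: the arc is concave, so it lies above the tent over its summit. *)
Lemma flat_arc F T (n_gt32 : 3 / 2 <= n) (n_lt85 : n <= 8 / 5) : is_arc n 0 F T ->
  - acc F T <= 2200 /\ - vel F T <= 13200.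
Proof.
move=> A; have n_gt0 : 0 < n by lra.
have n_lt2 : n < 2 by lra.
have [vT _ _] := arc_end A.
move: A => [T0 sF [p0 v0 a0] Fp pT].
have [c0 c1 c2 D D2] := sF.
have mono := acc_nincr sF Fp.
have aF y : 0 <= y <= T -> acc F y <= 0 by move=> yT; rewrite -a0; apply: mono; lra.
have vmono x y : 0 <= x -> x <= y -> y <= T -> vel F y <= vel F x.
  move=> x0 xy yT; apply: (@mvt_ge _ (vel F)) => // z zxy; exists (acc F z).
    by dleaf D z.
  by apply: aF; lra.
have pF y : 0 <= y <= T -> pos F y <= y.
  move=> yY; have : pos F y - y <= pos F 0 - 0.
    apply: (@mvt_ge _ (fun y => pos F y - y)) => //; [lra|by conts|].
    move=> z zy; exists (vel F z - 1); first by ders; [dleaf D z|rewrite ?subr0].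
    by have := vmono 0 z (lexx _) ltac:(lra) ltac:(lra); lra.
  by rewrite p0; lra.
have T6 : T <= 6.
  have [T1|T1] := leP T 1; first lra.
  have Ti : T * T^-1 = 1 by rewrite mulfV // lt0r_neq0.
  have Ti0 : 0 < T^-1 by rewrite invr_gt0.
  have gT y : 0 < y < T -> T^-1 <= nonlin n (pos F y).
    move=> yT; have Fy := Fp y yT; have py := pF y ltac:(lra).
    rewrite gE //; apply: (@le_trans _ _ (T `^ (1 - n))).
      rewrite -powR_inv1; last exact: ltW.
      have n1 : -1 <= 1 - n by lra.
      by have := ler_powR (ltW T1) n1.
    have -> : 1 - n = - (n - 1) by ring.
    by apply: powR_le_neg; lra.
  have a1 y : 0 <= y <= T -> acc F y <= - T^-1 * y.
    move=> yT; have : acc F y + T^-1 * y <= acc F 0 + T^-1 * 0.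
      apply: (@mvt_ge _ (fun y => acc F y + T^-1 * y)) => //; [lra|by conts|].
      move=> z zy; have Fz := Fp z ltac:(lra).
      exists (- 1 * nonlin n (pos F z) + T^-1); last by have := gT z ltac:(lra); lra.
      by ders; [apply: D2; [lra|exact: lt0r_neq0]|rewrite mulr0 addr0 mulr1].
    by rewrite a0; lra.
  have v1 y : 0 <= y <= T -> vel F y <= 1 - T^-1 * y ^+ 2 / 2.
    move=> yT; have : vel F y + T^-1 * y ^+ 2 / 2 <= vel F 0 + T^-1 * 0 ^+ 2 / 2.
      apply: (@mvt_ge _ (fun y => vel F y + T^-1 * y ^+ 2 / 2)) => //; [lra|by conts|].
      move=> z zy; exists (acc F z + T^-1 * z); last by have := a1 z ltac:(lra); lra.
      by ders; [dleaf D z|rewrite /=; lra].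
    by rewrite v0 expr0n /= mulr0 mul0r; lra.
  have : pos F T - (T - T^-1 * T ^+ 3 / 6) <= pos F 0 - (0 - T^-1 * 0 ^+ 3 / 6).
    apply: (@mvt_ge _ (fun y => pos F y - (y - T^-1 * y ^+ 3 / 6))) => //; [lra|by conts|].
    move=> z zy; exists (vel F z - (1 - T^-1 * z ^+ 2 / 2)); last by have := v1 z ltac:(lra); lra.
    by ders; [dleaf D z|rewrite /=; lra].
  rewrite pT p0 expr0n /= mulr0 mul0r !subr0.
  have -> : T^-1 * T ^+ 3 = T ^+ 2 by rewrite exprS mulrA mulVf ?mul1r // lt0r_neq0.
  by nra.
have [yM yMT vM] : exists2 y, 0 < y < T & vel F y = 0.
  have [||c] := @IVT R (vel F) 0 T 0 (ltW T0).
  - exact: continuous_subspaceT.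
  - by rewrite v0 ge_min le_max; apply/andP; split; apply/orP; [right|left]; lra.
  rewrite in_itv /= => cT vc; exists c => //.
  have c_0 : c != 0 by apply: contra_eq_neq vc => ->; rewrite v0 oner_eq0.
  have c_T : c != T by apply: contra_eq_neq vc => ->; rewrite lt_eqF.
  by rewrite !lt_neqAle eq_sym c_0 c_T.
have [M ME] : exists M, M = pos F yM by exists (pos F yM).
have vchord y : 0 <= y <= yM -> yM - y <= vel F y * yM.
  move=> yy; have := @concave_chord (vel F) (acc F) 0 yM c1 (fun z zy => (D z ltac:(lra)).2)
    (fun x y h1 h2 h3 => mono x y (ltW h1) h2 ltac:(lra)) y yy.
  by rewrite v0 vM mul1r mul0r addr0 subr0.
have M2 : yM / 2 <= M.
  have i0 : 0 < yM^-1 by rewrite invr_gt0; lra.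
  have : pos F 0 - (0 - yM^-1 * 0 ^+ 2 / 2) <= pos F yM - (yM - yM^-1 * yM ^+ 2 / 2).
    apply: (@mvt_le _ (fun y => pos F y - (y - yM^-1 * y ^+ 2 / 2))) => //; [lra|by conts|].
    move=> z zy; exists (vel F z - (1 - yM^-1 * z)).
      by ders; [dleaf D z|rewrite /=; lra].
    have := vchord z ltac:(lra); have : yM^-1 * yM = 1 by rewrite mulVf // lt0r_neq0; lra.
    by move: (yM^-1) i0 => *; nra.
  rewrite p0 expr0n /= mulr0 mul0r.
  have -> : yM^-1 * yM ^+ 2 = yM by rewrite expr2 mulrA mulVf ?mul1r // lt0r_neq0; lra.
  by rewrite ME; lra.
have pl y : 0 <= y <= yM -> y / 2 <= pos F y.
  move=> yy; have := @concave_chord (pos F) (vel F) 0 yM c0 (fun z zy => (D z ltac:(lra)).1)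
    (fun x y h1 h2 h3 => vmono x y (ltW h1) h2 ltac:(lra)) y yy.
  by rewrite p0 mul0r add0r !subr0 -ME; nra.
have npow c y : 1 <= c -> 0 < y -> (y / c) `^ (1 - n) <= c * y `^ (1 - n).
  move=> hc y0; rewrite powRM ?invr_ge0; [|lra|lra].
  rewrite mulrC ler_wpM2r ?powR_ge0 //.
  rewrite -powR_inv1; last lra.
  rewrite -powRrM; have -> : -1 * (1 - n) = n - 1 by ring.
  by apply: ler1_powR => //; lra.
have al y : 0 <= y <= yM -> - 2 * gint n y <= acc F y.
  move=> yy; have : acc F 0 + 2 * gint n 0 <= acc F y + 2 * gint n y.
    apply: (@mvt_le _ (fun y => acc F y + 2 * gint n y)) => //; first lra.
      by conts; exact: gint_cont.
    move=> z zy; have Fz := Fp z ltac:(lra); have z0 : 0 < z by lra.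
    exists (- 1 * nonlin n (pos F z) + 2 * z `^ (1 - n)).
      by ders; [apply: D2; [lra|exact: lt0r_neq0]|exact: isD_gint|rewrite mulr0 addr0].
    have h := npow 2 z ltac:(lra) z0.
    have : nonlin n (pos F z) <= (z / 2) `^ (1 - n).
      rewrite gE // (_ : 1 - n = - (n - 1)); last by ring.
      by apply: powR_le_neg; [lra|apply: pl; lra|lra].
    by lra.
  by rewrite a0 gint0 // mulr0; lra.
have gle := fun y => @gint_le_affine y n_gt32 n_lt85.
have yM5 : 1 / 10 <= yM.
  rewrite leNgt; apply/negP => yM5.
  have : vel F 0 + 10 * 0 <= vel F yM + 10 * yM.
    apply: (@mvt_le _ (fun y => vel F y + 10 * y)) => //; [lra|by conts|].
    move=> z zy; exists (acc F z + 10).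
      by ders; [dleaf D z|rewrite mulr0 addr0 mulr1].
    by have := al z ltac:(lra); have := gle z ltac:(lra); lra.
  by rewrite v0 vM; lra.
have aM : - 35 <= acc F yM by have := al yM ltac:(lra); have := gle yM ltac:(lra); lra.
have pr y : yM <= y <= T -> (T - y) / 120 <= pos F y.
  move=> yy; have := @concave_chord (pos F) (vel F) yM T c0 (fun z zy => (D z ltac:(lra)).1)
    (fun x y h1 h2 h3 => vmono x y ltac:(lra) h2 ltac:(lra)) y yy.
  rewrite pT mul0r addr0 -ME.
  have h : 1 / 20 * (T - y) <= M * (T - y) by rewrite ler_wpM2r //; lra.
  have [yT|yT] := ltP y T; last first.
    move=> _; have -> : y = T by apply/le_anti; case/andP: yy => _ ->.
    by rewrite pT subrr mul0r.
  by have := Fp y ltac:(lra); nra.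
have aT : - 2200 <= acc F T.
  have : acc F yM - 120 * gint n (T - yM) <= acc F T - 120 * gint n (T - T).
    apply: (@mvt_le _ (fun y => acc F y - 120 * gint n (T - y))) => //; first lra.
      apply: cont_sub => //; apply: cont_mul; first exact: cont_cst.
      by apply: (cont_comp (gint_cont n_lt2)); conts.
    move=> z zy; have Fz := Fp z ltac:(lra); have z0 : 0 < T - z by lra.
    exists (- 1 * nonlin n (pos F z) + 120 * (T - z) `^ (1 - n)).
      have Dg : is_derive z 1 (fun y => gint n (T - y)) ((T - z) `^ (1 - n) * (0 - 1)).
        exact: (@isD_comp _ (gint n) (fun y => T - y) z _ _ (isD_gint n_lt2 z0)
          (isD_sub (isD_cst T z) (isD_id z))).
      by ders; [apply: D2; [lra|exact: lt0r_neq0]|ring].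
    have h := npow 120 (T - z) ltac:(lra) z0.
    have : nonlin n (pos F z) <= ((T - z) / 120) `^ (1 - n).
      rewrite gE // (_ : 1 - n = - (n - 1)); last by ring.
      by apply: powR_le_neg; [lra|have := pr z ltac:(lra); lra|lra].
    by lra.
  rewrite subrr gint0 // mulr0 subr0.
  by have := gle (T - yM) ltac:(lra); lra.
have vK K : 0 <= K -> - K <= acc F T -> - vel F T <= 6 * K.
  clear aT => K0 aT; have : vel F 0 + K * 0 <= vel F T + K * T.
    apply: (@mvt_le _ (fun y => vel F y + K * y)) => //; [exact: ltW|by conts|].
    move=> z zy; exists (acc F z + K).
      by ders; [dleaf D z|rewrite mulr0 addr0 mulr1].
    by have := mono z T ltac:(lra) ltac:(lra) (lexx _); lra.
  have : K * T <= K * 6 by rewrite ler_wpM2l.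
  by rewrite v0; lra.
clear - aT vK; split; first lra.
by have := vK 2200 ltac:(lra) aT; lra.
Qed.

End Landing.

(** * Continuous dependence along an arc *)

Section Dependence.
Context {R : realType} (n : R).
Implicit Types (F G : jet R) (f : R -> R) (a b c d m x y z s t u v e T Y B th eta : R).

Lemma unif_cont f a b e : continuous f -> 0 < e ->
  exists2 d, 0 < d & forall x y, a <= x <= b -> a <= y <= b -> `|x - y| < d -> `|f x - f y| < e.
Proof.
move=> cf e0; have [ab|ba] := leP a b; last by exists 1 => // x y xab; lra.
pose P p q := exists2 d : R, 0 < d &
  forall x y, p <= x <= q -> p <= y <= q -> `|x - y| < d -> `|f x - f y| < e.
apply: (@local_to_global _ P) => //; last first.
  move=> x xab; have [d d0 Hd] := (contP f x).1 (cf x) (e / 2) ltac:(lra).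
  exists d => // y z ay yx xz zb dy dz; exists 1 => // s t syz tyz _.
  have h1 := Hd s ltac:(rewrite ltr_norml; lra); have h2 := Hd t ltac:(rewrite ltr_norml; lra).
  by move: h1 h2; rewrite !ltr_norml; lra.
move=> x y z ax xy yz zb [d1 d10 H1] [d2 d20 H2].
have [d d0 Hd] := (contP f y).1 (cf y) (e / 2) ltac:(lra).
exists (Num.min d (Num.min d1 d2)); first by rewrite !lt_min d0 d10.
move=> s t sxz txz; rewrite !lt_min => /and3P[sd sd1 sd2].
have cross p q : x <= p <= y -> y <= q <= z -> `|p - q| < d -> `|f p - f q| < e.
  move=> pxy qyz; rewrite ltr_norml => pq.
  have h1 := Hd p ltac:(rewrite ltr_norml; lra); have h2 := Hd q ltac:(rewrite ltr_norml; lra).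
  by move: h1 h2; rewrite !ltr_norml; lra.
have [sy|ys] := leP s y; have [ty|yt] := leP t y.
- by apply: H1 => //; lra.
- by apply: cross => //; lra.
- by rewrite distrC; apply: cross; rewrite 1?distrC //; lra.
- by apply: H2 => //; lra.
Qed.

Definition close e G y F z := [/\ `|pos G y - pos F z| < e, `|vel G y - vel F z| < e &
  `|acc G y - acc F z| < e].

Lemma close_trans d e G y F z H t : close d G y F z -> close e F z H t ->
  close (d + e) G y H t.
Proof.
by move=> [a1 a2 a3] [b1 b2 b3]; split;
  [rewrite -(subrKA (pos F z))|rewrite -(subrKA (vel F z))|rewrite -(subrKA (acc F z))];
  apply: le_lt_trans (ler_normD _ _) _; apply: ltrD.
Qed.

Lemma close_le d e G y F z : d <= e -> close d G y F z -> close e G y F z.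
Proof. by move=> de [a1 a2 a3]; split; exact: lt_le_trans de. Qed.

Lemma close_unif F a b e : continuous (pos F) -> continuous (vel F) -> continuous (acc F) ->
  0 < e -> exists2 d, 0 < d & forall x y, a <= x <= b -> a <= y <= b -> `|x - y| < d ->
  close e F x F y.
Proof.
move=> c0 c1 c2 e0.
have [d1 d10 H1] := @unif_cont _ a b e c0 e0.
have [d2 d20 H2] := @unif_cont _ a b e c1 e0.
have [d3 d30 H3] := @unif_cont _ a b e c2 e0.
exists (Num.min d1 (Num.min d2 d3)); first by rewrite !lt_min d10 d20.
by move=> x y xab yab; rewrite !lt_min => /and3P[h1 h2 h3]; split; auto.
Qed.

Definition jshift s F := Jet (fun y => pos F (y + s)) (fun y => vel F (y + s))
  (fun y => acc F (y + s)).

Lemma isD_shift f y s d : is_derive (y + s) 1 f d -> is_derive y 1 (fun y => f (y + s)) d.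
Proof.
move=> fd; apply: (isD_eq (@isD_comp _ f (fun y => y + s) y _ _ fd
  (isD_add (isD_id y) (isD_cst s y)))).
by rewrite addr0 mulr1.
Qed.

Lemma jsol_shift sg a b s F : jsol n sg (a + s) (b + s) F -> jsol n sg a b (jshift s F).
Proof.
move=> [c0 c1 c2 D D2]; have cs : continuous (fun y => y + s) by conts.
split => /=; [exact: cont_comp|exact: cont_comp|exact: cont_comp| |].
  move=> y yab; have [D0 D1] := D (y + s) ltac:(lra).
  by split; exact: isD_shift.
by move=> y yab Fy; apply: isD_shift; apply: D2 => //; lra.
Qed.

(** The velocity stays negative, so the remaining time is controlled by the height, and by
    [landing_drop] so is the change of the acceleration. *)
Lemma quick_landing G u Y c B (n_gt0 : 0 < n) (n_lt2 : n < 2) : 0 < c -> 0 < B -> u <= Y ->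
  jsol n 1 u Y G -> (forall y, u < y < Y -> 0 < pos G y) -> 0 <= pos G u ->
  vel G u <= - c -> `|acc G u| <= B -> 2 * pos G u / c < c / (2 * B) ->
  Y - u <= 2 * pos G u / c /\ forall y, u <= y <= Y ->
   [/\ `|pos G y - pos G u| <= pos G u,
       `|vel G y - vel G u| <= (B + (c / 2)^-1 * gint n (pos G u)) * (2 * pos G u / c) &
       `|acc G y - acc G u| <= (c / 2)^-1 * gint n (pos G u)].
Proof.
move=> c0 B0 uY sG Gp x0 vc aB small.
have [c0' c1 c2 D D2] := sG.
have mono := acc_nincr sG Gp.
have aB' := ler_norm (acc G u).
set x := pos G u in x0 small *.
have vle y : u <= y <= Y -> vel G y <= - c + B * (y - u).
  move=> yY; have : vel G y - B * (y - u) <= vel G u - B * (u - u).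
    apply: (@mvt_ge _ (fun y => vel G y - B * (y - u))); [lra|by conts|move=> z zy].
    exists (acc G z - B); last by have := mono u z (lexx _) ltac:(lra) ltac:(lra); lra.
    by ders; [exact: (D z ltac:(lra)).2|ring].
  by rewrite subrr mulr0; lra.
pose t := c / (2 * B); have Bt : B * t = c / 2 by rewrite /t; field; exact: lt0r_neq0.
rewrite -/t in small.
have tt0 : 0 < t by rewrite divr_gt0 // mulr_gt0.
clearbody t.
have v2 y : u <= y <= Y -> y - u <= t -> vel G y <= - (c / 2).
  move=> yY yt; have := vle y yY; have : B * (y - u) <= B * t by rewrite ler_wpM2l // ltW.
  by lra.
have ple y : u <= y <= Y -> y - u <= t -> pos G y <= x - c / 2 * (y - u).
  move=> yY yt; have : pos G y + c / 2 * (y - u) <= pos G u + c / 2 * (u - u).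
    apply: (@mvt_ge _ (fun y => pos G y + c / 2 * (y - u))); [lra|by conts|move=> z zy].
    exists (vel G z + c / 2); last by have := v2 z ltac:(lra) ltac:(lra); lra.
    by ders; [exact: (D z ltac:(lra)).1|ring].
  by rewrite subrr mulr0 -/x; lra.
pose q := 2 * x / c; have qE : c * q = 2 * x by rewrite /q; field; exact: lt0r_neq0.
rewrite -/q in small *.
have q0 : 0 <= q by rewrite divr_ge0 ?mulr_ge0 // ltW.
clearbody q.
have Yq : Y - u <= q.
  rewrite leNgt; apply/negP => qY.
  have mt : Num.min (Y - u) t <= t by rewrite ge_min lexx orbT.
  have mY : Num.min (Y - u) t <= Y - u by rewrite ge_min lexx.
  have mq : q < Num.min (Y - u) t by rewrite lt_min qY small.
  move: (Num.min _ _) mt mY mq => r rt rY rq.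
  pose w := (q + r) / 2.
  have wq : q < w by rewrite /w; lra.
  have wr : w < r by rewrite /w; lra.
  clearbody w.
  have := Gp (u + w) ltac:(lra); have := ple (u + w) ltac:(lra) ltac:(lra).
  have -> : u + w - u = w by ring.
  have : c * q < c * w by rewrite ltr_pM2l.
  by lra.
split => // y yY.
have Gp' z : u < z < y -> 0 < pos G z by move=> zy; apply: Gp; lra.
have py0 : 0 <= pos G y.
  have [yY'|yY'] := ltP y Y.
    have [uy|uy] := ltP u y; first by apply/ltW/Gp; lra.
    by (have -> : y = u by lra).
  have [uy|uy] := ltP u Y; last by (have -> : y = u by lra).
  have {yY'}-> : y = Y by lra.
  rewrite leNgt; apply/negP => pY.
  have [d d0 Hd] := @cont_pos_near _ (fun y => - pos G y) Y (cont_opp c0') ltac:(cbv beta; lra).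
  pose z := Num.max ((u + Y) / 2) (Y - d / 2).
  have [z1 z2] : (u + Y) / 2 <= z /\ Y - d / 2 <= z by rewrite /z !le_max !lexx orbT.
  have z3 : z < Y by rewrite /z gt_max; lra.
  clearbody z; have := Gp z ltac:(lra); have := Hd z ltac:(rewrite ltr_norml; lra); lra.
have pyx := ple y yY ltac:(lra).
have cy : 0 <= c / 2 * (y - u) by rewrite mulr_ge0 //; lra.
have ci : 0 <= (c / 2)^-1 by rewrite invr_ge0; lra.
have ad : acc G u - (c / 2)^-1 * gint n x <= acc G y - (c / 2)^-1 * gint n (pos G y).
  apply: (@landing_drop _ n G n_gt0 n_lt2 u y (c / 2)) => //; try lra.
    by apply: jsol_sub sG; lra.
  by move=> z zy; apply: v2; lra.
have gy : 0 <= (c / 2)^-1 * gint n (pos G y) by rewrite mulr_ge0 // gint_ge0.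
have gx : 0 <= (c / 2)^-1 * gint n x by rewrite mulr_ge0 // gint_ge0.
move: (_ * gint n (pos G y)) (_ * gint n x) ad gy gx => gy gx ad gy0 gx0.
have am z : u <= z <= y -> `|acc G z| <= B + gx.
  move=> zy; have m1 := mono u z (lexx _) ltac:(lra) ltac:(lra).
  have m2 := mono z y ltac:(lra) ltac:(lra) ltac:(lra).
  by move: aB; rewrite !ler_norml; lra.
split.
- by rewrite ler_norml; lra.
- have := @mvt_bound _ (vel G) u y (B + gx) ltac:(lra) c1
    (fun z zy => ex_intro2 _ _ (acc G z) (D z ltac:(lra)).2 (am z ltac:(lra))).
  move=> h; apply: le_trans h _; rewrite ler_wpM2l //; lra.
- have m1 := mono u y (lexx _) ltac:(lra) ltac:(lra).
  by rewrite ler_norml; lra.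
Qed.

Lemma gint_small e (n_gt0 : 0 < n) (n_lt2 : n < 2) : 0 < e ->
  exists2 d, 0 < d & forall x, 0 <= x <= d -> gint n x <= e.
Proof.
move=> e0; have [d d0 Hd] := (contP (gint n) 0).1 (gint_cont n_lt2 (x := 0)) e e0.
exists (d / 2); first lra.
move=> x xd; have := Hd x; rewrite subr0 gint0 // subr0 ger0_norm; last lra.
by rewrite ger0_norm ?gint_ge0 // => h; apply/ltW/h; lra.
Qed.


End Dependence.

Section ArcDependence.
Context {R : realType} (n : R).
Implicit Types (F G : jet R) (f : R -> R) (a b c d m x y z s t u v e r T Y B th eta : R).

(** Close to the landing the arc has velocity below a negative constant, so a nearby
    solution is forced down to zero before its state can change. *)
Lemma landing_phase a F T e (n_gt0 : 0 < n) (n_lt2 : n < 2) : is_arc n a F T -> 0 < e ->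
  exists eta d, [/\ 0 < eta < T, 0 < d & forall u G Y, T - eta <= u <= T -> u <= Y ->
    jsol n 1 u Y G -> (forall y, u < y < Y -> 0 < pos G y) -> 0 <= pos G u ->
    close d G u F u ->
    [/\ `|Y - T| < e, `|Y - u| < e &
      forall y, u <= y <= Y -> close e G y F u /\ close e G y F T]].
Proof.
move=> A e0; have vT := arc_slope A; move: A => [T0 sF iF Fp pT].
have [c0 c1 c2 D D2] := sF.
have [B0 B00 HB] := cont_bounded 0 T c2.
pose B := B0 + 1; have B1 : 1 <= B by rewrite /B; lra.
have HB' y : 0 <= y <= T -> `|acc F y| <= B - 1 by rewrite /B addrK; exact: HB.
clearbody B.
pose r := Num.min (e / 32) (1 / 4).
have r0 : 0 < r by rewrite /r lt_min; lra.
have r1 : r <= e / 32 by rewrite /r ge_min lexx.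
have r2 : r <= 1 / 4 by rewrite /r ge_min lexx orbT.
clearbody r.
have [d1 d10 Hd1] := @gint_small _ n r n_gt0 n_lt2 r0.
pose th := Num.min d1 (Num.min (r / (B + 1)) (1 / (20 * B))).
have th0 : 0 < th by rewrite /th !lt_min d10 !divr_gt0 //; lra.
have th1 : th <= d1 by rewrite /th ge_min lexx.
have th2 : (B + 1) * th <= r.
  by rewrite mulrC -ler_pdivlMr; [rewrite /th !ge_min lexx orbT|lra].
have th3 : 20 * B * th <= 1.
  by rewrite mulrC -ler_pdivlMr; [rewrite /th !ge_min lexx !orbT|lra].
clearbody th.
have thr : th <= r by nra.
pose k := Num.min (th / 2) r.
have k0 : 0 < k by rewrite /k lt_min r0 andbT; lra.
have k1 : k <= th / 2 by rewrite /k ge_min lexx.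
have k2 : k <= r by rewrite /k ge_min lexx orbT.
clearbody k.
have [d2 d20 Hd2] := @close_unif _ F 0 T k c0 c1 c2 k0.
pose eta := Num.min (d2 / 2) (Num.min (T / 2) r).
have h0 : 0 < eta by rewrite /eta !lt_min r0 andbT; apply/andP; split; lra.
have h1 : eta <= d2 / 2 by rewrite /eta ge_min lexx.
have h2 : eta <= T / 2 by rewrite /eta !ge_min lexx orbT.
have h3 : eta <= r by rewrite /eta !ge_min lexx !orbT.
clearbody eta.
exists eta, k; split => //; first lra.
move=> u G Y uT uY sG Gp G0 cl.
have cT : close k F u F T by apply: Hd2; rewrite ?ltr_norml; lra.
have [p1 v1 a1] := cT; have [p2 v2 a2] := cl.
have x1 : pos G u <= th by move: p1 p2; rewrite pT !ltr_norml; lra.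
have v3 : vel G u <= - (1 / 2) by move: v1 v2; rewrite !ltr_norml; lra.
have a3 : `|acc G u| <= B.
  have := HB' u ltac:(lra); move: a2; rewrite ltr_norml !ler_norml; lra.
have e1 : 2 * pos G u / (1 / 2) = 4 * pos G u by field.
have e2 : 1 / 2 / (2 * B) = 1 / (4 * B) by field; lra.
have e3 : (1 / 2 / 2)^-1 = 4 :> R by field.
have sm : 2 * pos G u / (1 / 2) < 1 / 2 / (2 * B).
  rewrite e1 e2 ltr_pdivlMr; last lra.
  by move: x1 th3 B1 G0 th0; clear; nra.
have Bp : 0 < B by move: B1; clear; lra.
have hp : 0 < 1 / 2 :> R by clear; lra.
have [Yu Hy] := @quick_landing _ n G u Y (1 / 2) B n_gt0 n_lt2 hp Bp
  uY sG Gp G0 v3 a3 sm.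
rewrite e1 in Yu Hy; rewrite e3 in Hy.
have g1 : gint n (pos G u) <= r by apply: Hd1; lra.
have g0 := gint_ge0 (pos G u) n_lt2.
have clG y : u <= y <= Y -> close (5 * r) G y G u.
  move=> yY; have [q1 q2 q3] := Hy y yY; split.
  - by apply: le_lt_trans q1 _; lra.
  - apply: le_lt_trans q2 _; have : (B + 4 * gint n (pos G u)) * (4 * pos G u) <= (B + 1) * (4 * th).
      have x4 : 4 * pos G u <= 4 * th by move: x1; clear; lra.
      have x40 : 0 <= 4 * pos G u by move: G0; clear; lra.
      have Bg : B + 4 * gint n (pos G u) <= B + 1 by move: g1 r2; clear; lra.
      have Bg0 : 0 <= B + 4 * gint n (pos G u) by move: g0 Bp; clear; lra.
      exact: ler_pM.
    by move: th2 r0; clear; lra.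
  - by apply: le_lt_trans q3 _; lra.
split.
- by rewrite ltr_norml; lra.
- by rewrite ltr_norml; lra.
- move=> y yY; have cu := close_trans (clG y yY) cl.
  split; first by apply: close_le cu; lra.
  by apply: close_le (close_trans cu cT); lra.
Qed.

(** Near the initial zero the arc has velocity at least [1 / 2], so a small time shift
    equates the heights; elsewhere no shift is needed. *)
Lemma launch_shift a F T b e q : is_arc n a F T -> 0 < b < T -> 0 < e -> 0 < q ->
  exists2 d, 0 < d & forall u G, 0 <= u <= b -> 0 <= pos G u -> close d G u F u ->
    exists s, [/\ `|s| < e, 0 <= u + s <= b, `|pos G u - pos F (u + s)| <= (u + s) * q,
      `|vel G u - vel F (u + s)| < q & `|acc G u - acc F (u + s)| < q].
Proof.
move=> [T0 [c0 c1 c2 D _] [p0 v0 _] _ _] bT e0 q0.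
have [d1 d10 Hd1] := (contP (vel F) 0).1 (c1 0) (1 / 2) ltac:(lra).
pose r := Num.min (d1 / 4) (b / 3).
have r0 : 0 < r by rewrite /r lt_min; apply/andP; split; lra.
have r1 : 4 * r <= d1 by have : r <= d1 / 4 by [rewrite /r ge_min lexx]; lra.
have r2 : 3 * r <= b by have : r <= b / 3 by [rewrite /r ge_min lexx orbT]; lra.
clearbody r.
have vr y : 0 <= y <= 3 * r -> 1 / 2 <= vel F y.
  move=> yr; have := Hd1 y; rewrite v0 subr0 ger0_norm; last lra.
  by move=> /(_ ltac:(lra)); rewrite ltr_norml; lra.
have pr x y : 0 <= x -> x <= y -> y <= 3 * r -> (y - x) / 2 <= pos F y - pos F x.
  move=> x0 xy yr; have : pos F x - 1 / 2 * x <= pos F y - 1 / 2 * y.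
    apply: (@mvt_le _ (fun y => pos F y - 1 / 2 * y)) => //; first by conts.
    move=> z zxy; exists (vel F z - 1 / 2); last by have := vr z ltac:(lra); lra.
    by ders; [exact: (D z ltac:(lra)).1|rewrite mulr0 addr0 mulr1].
  by lra.
have [d2 d20 Hd2] := @close_unif _ F 0 T (q / 2) c0 c1 c2 ltac:(lra).
pose d := Num.min (r * q) (Num.min (q / 2) (Num.min (r / 2) (Num.min (d2 / 4) (Num.min (e / 8) (1 / 4))))).
have d0 : 0 < d by rewrite /d !lt_min !mulr_gt0 //=; repeat (apply/andP; split); lra.
have dd1 : d <= r * q by rewrite /d ge_min lexx.
have dd2 : d <= q / 2 by rewrite /d !ge_min lexx !orbT.
have dd3 : d <= r / 2 by rewrite /d !ge_min lexx !orbT.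
have dd4 : d <= d2 / 4 by rewrite /d !ge_min lexx !orbT.
have dd5 : d <= e / 8 by rewrite /d !ge_min lexx !orbT.
clearbody d.
exists d => // u G ub G0 cl.
have [h1 h2 h3] := cl.
have [ru|ur] := leP r u.
  exists 0; rewrite normr0 addr0; split => //; try lra.
  by apply: (le_trans (ltW h1)); apply: (le_trans dd1); rewrite (ler_wpM2r (ltW q0)).
have [||u1] := @IVT R (pos F) 0 (3 * r) (pos G u) ltac:(lra).
- exact: continuous_subspaceT.
- have := pr u (3 * r) ltac:(lra) ltac:(lra) ltac:(lra).
  have := pr 0 (3 * r) ltac:(lra) ltac:(lra) ltac:(lra).
  rewrite p0 => i1 i2; move: h1; rewrite ltr_norml => h1.
  by rewrite ge_min le_max; apply/andP; split; apply/orP; [left|right]; lra.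
rewrite in_itv /= => u1r pu1.
have uu : `|u1 - u| <= 2 * d.
  move: h1; rewrite -pu1 ltr_norml ler_norml => h1.
  have [uu1|uu1] := leP u u1.
    by have := pr u u1 ltac:(lra) ltac:(lra) ltac:(lra); lra.
  by have := pr u1 u ltac:(lra) ltac:(lra) ltac:(lra); lra.
exists (u1 - u); rewrite (_ : u + (u1 - u) = u1); last by ring.
have [k1 k2 k3] : close (q / 2) F u F u1.
  by apply: Hd2; [lra|lra|rewrite distrC; apply: le_lt_trans uu _; lra].
split.
- by apply: le_lt_trans uu _; lra.
- by lra.
- by rewrite pu1 subrr normr0 mulr_ge0 //; lra.
- by rewrite -(subrKA (vel F u)); apply: le_lt_trans (ler_normD _ _) _; lra.
- by rewrite -(subrKA (acc F u)); apply: le_lt_trans (ler_normD _ _) _; lra.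
Qed.

(** Away from the landing a solution starting near the arc is compared with the arc
    after a small time shift, chosen near the initial zero so that both have the
    same height at the start. *)
Lemma launch_phase a F T b e (n_gt0 : 0 < n) (n_lt2 : n < 2) : is_arc n a F T ->
  0 < b < T -> 0 < e ->
  exists2 d, 0 < d & forall u G Y, 0 <= u <= b -> u <= Y ->
    jsol n 1 u Y G -> (forall y, u < y < Y -> 0 < pos G y) -> 0 <= pos G u ->
    close d G u F u ->
    exists s, [/\ `|s| < e, 0 <= u + s <= b & forall y, u <= y <= Y -> y + s <= b ->
      close e G y F (y + s) /\ (0 < pos G y \/ y + s = 0)].
Proof.
move=> A bT e0; have st := arc_rising A; have [T0 sF _ Fp _] := A.
have [c0 c1 c2 D D2] := sF.
have [m m0 Hm] := @above_line _ F b st c0 c1 (fun y yb => (D y ltac:(lra)).1)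
  (fun y yb => Fp y ltac:(lra)).
have w0 := cmp_weight_gt0 n m b.
pose q := Num.min (m / 2) (e / 2 / (1 + b)) / cmp_weight n m b.
have q0 : 0 < q by rewrite /q divr_gt0 // lt_min; apply/andP; split; rewrite divr_gt0 //; lra.
have qw : q * cmp_weight n m b = Num.min (m / 2) (e / 2 / (1 + b)).
  by rewrite /q divfK // lt0r_neq0.
have q1 : q * cmp_weight n m b <= m / 2 by rewrite qw ge_min lexx.
have q2 : (1 + b) * (q * cmp_weight n m b) <= e / 2.
  by rewrite mulrC -ler_pdivlMr; [rewrite qw ge_min lexx orbT|lra].
have wle y : 0 <= y <= b -> q * cmp_weight n m y <= q * cmp_weight n m b.
  by move=> yb; rewrite ler_pM2l //; apply: cmp_weight_homo; lra.
have w1 y : 0 <= y -> 1 <= cmp_weight n m y by exact: cmp_weight_ge1.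
clear qw; clearbody q.
have [d d0 Hd] := launch_shift A bT e0 q0.
exists d => // u G Y ub uY sG Gp G0 cl.
have [s [se us s0 s1 s2]] := Hd u G ub G0 cl.
exists s; split => // y yY ysb.
pose z := y + s.
have zE : z = y + s by [].
have E1 : (u + s) + - s = u by ring.
have E2 : z + - s = y by rewrite /z; ring.
rewrite -zE in ysb *; clearbody z.
have uz : u + s <= z by move: yY zE; clear; lra.
have zb : 0 <= z <= b by move: uz us ysb; clear; lra.
have us0 : 0 <= u + s by move: us; clear; lra.
have sG' : jsol n 1 (u + s) z (jshift (- s) G).
  by apply: jsol_shift; rewrite E1 E2; apply: jsol_sub sG => //; lra.
have sF' : jsol n 1 (u + s) z F by apply: jsol_sub sF => //; move: zb bT; clear; lra.
have Hm' t : u + s <= t <= z -> m * t <= pos F t.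
  by move=> tt; apply: Hm; move: tt us0 zb; clear; lra.
have qz1 : q * cmp_weight n m z <= m / 2 by apply: le_trans q1; exact: wle.
have zz : u + s <= z <= z by rewrite uz lexx.
have sg1 : `|1| <= 1 :> R by rewrite normr1.
have [k1 k2 k3 k4] := @comparison _ n 1 F (jshift (- s) G) (u + s) z m q n_gt0 n_lt2
  sg1 us0 uz m0 q0 sF' sG' Hm' ltac:(by rewrite /= E1)
  ltac:(by rewrite /= E1) ltac:(by rewrite /= E1) qz1 z zz.
rewrite /= E2 in k1 k2 k3 k4.
have [z0 _] := andP zb; have wz := wle z zb; have wz1 := w1 z z0.
have qz : 0 < q * cmp_weight n m z := mulr_gt0 q0 (cmp_weight_gt0 n m z).
have arith (p p' : R) : p <= p' -> 0 < p -> (1 + b) * p' <= e / 2 -> p < e /\ b * p' < e.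
  move=> pp pp0 h; have b0 : 0 < b * p' by case/andP: bT => b0 _; apply: mulr_gt0 => //; exact: lt_le_trans pp.
  by move: h b0 pp; rewrite mulrDl mul1r; move: (b * p') e0 pp0; clear; move=> t *; split; lra.
have [ae bpe] := arith _ _ wz qz q2.
split; last first.
  have [z0'|z0'] := ltP 0 z; last by right; apply/eqP; rewrite eq_le z0'.
  by left; apply: lt_le_trans k4; apply: mulr_gt0 => //; apply: divr_gt0.
split.
- apply: le_lt_trans k3 _; apply: le_lt_trans bpe.
  have [_ zb'] := andP zb; exact: (ler_pM z0 (ltW qz) zb' wz).
- exact: lt_trans k1 ae.
- exact: lt_trans k2 ae.
Qed.

(** The launch and the landing overlap at time [b]: the comparison brings the solution to
    a neighbourhood of [F b], from where it lands quickly. *)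
Lemma arc_dependence a F T e (n_gt0 : 0 < n) (n_lt2 : n < 2) : is_arc n a F T -> 0 < e ->
  exists2 d, 0 < d & forall u G Y, 0 <= u <= T -> u <= Y ->
    jsol n 1 u Y G -> (forall y, u < y < Y -> 0 < pos G y) -> 0 <= pos G u ->
    close d G u F u ->
    [/\ Y <= T + e,
        forall y, u <= y <= Y -> exists z, [/\ 0 <= z <= T, `|z - y| < e & close e G y F z] &
        pos G Y = 0 -> u < Y \/ vel G Y <= 0 -> `|Y - T| < e /\ close e G Y F T].
Proof.
move=> A e0; have e20 : 0 < e / 2 by lra.
have [eta [d1 [etaT d10 H1]]] := landing_phase n_gt0 n_lt2 A e20.
pose e2 := Num.min (Num.min d1 (e / 2)) (1 / 2).
have e2_0 : 0 < e2 by rewrite /e2 !lt_min d10 /=; apply/andP; split; lra.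
have e2_1 : e2 <= d1 by rewrite /e2 !ge_min lexx.
have e2_2 : e2 <= e / 2 by rewrite /e2 !ge_min lexx !orbT.
have e2_3 : e2 <= 1 / 2 by rewrite /e2 !ge_min lexx !orbT.
clearbody e2.
have [b bE] : exists b, b = T - eta by exists (T - eta).
have bT : 0 < b < T by rewrite bE; lra.
have [d2 d20 H2] := launch_phase n_gt0 n_lt2 A bT e2_0.
have v0 : vel F 0 = 1 by have [_ _ []] := A.
exists (Num.min d1 d2); first by rewrite lt_min d10.
have dd1 : Num.min d1 d2 <= d1 by rewrite ge_min lexx.
have dd2 : Num.min d1 d2 <= d2 by rewrite ge_min lexx orbT.
move: (Num.min _ _) dd1 dd2 => d dd1 dd2 u G Y uT uY sG Gp G0 cl.
have [ub|ub] := leP b u.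
  have [k1 k2 k3] := H1 u G Y ltac:(rewrite bE in ub; lra) uY sG Gp G0 (close_le dd1 cl).
  split.
  - by move: k1; rewrite ltr_norml; lra.
  - move=> y yY; exists u; split => //; last by have [k4 _] := k3 y yY; apply: close_le k4; lra.
    by move: k2; rewrite !ltr_norml; lra.
  - move=> _ _; have [_ k4] := k3 Y ltac:(lra).
    by split; [apply: lt_trans k1 _; lra|apply: close_le k4; lra].
have [s [se us Hs]] := H2 u G Y ltac:(lra) uY sG Gp G0 (close_le dd2 cl).
rewrite ltr_norml in se.
have [Yb|bY] := leP (Y + s) b.
  split.
  - by lra.
  - move=> y yY; have [k1 _] := Hs y yY ltac:(lra).
    exists (y + s); split; [lra| |by apply: close_le k1; lra].
    by rewrite ltr_norml; lra.
  - move=> pY uv; have [k1 [k2|k2]] := Hs Y ltac:(lra) Yb; first by rewrite pY ltxx in k2.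
    have uY' : u = Y by lra.
    case: uv => [|vY]; first by lra.
    by have [_] := k1; rewrite k2 v0 ltr_norml => ? _; exfalso; lra.
have [u' u'E] : exists u', u' = b - s by exists (b - s).
have u'Y : u <= u' <= Y by rewrite u'E; lra.
have [k1 _] := Hs u' u'Y ltac:(rewrite u'E; lra).
have E2 : u' + s = b by rewrite u'E subrK.
rewrite E2 in k1.
have sG' : jsol n 1 b (Y + s) (jshift (- s) G).
  by apply: jsol_shift; rewrite addrK; apply: jsol_sub sG; rewrite -?u'E; lra.
have Gp' y : b < y < Y + s -> 0 < pos (jshift (- s) G) y by move=> yb /=; apply: Gp; rewrite u'E in u'Y; lra.
have Gb : 0 <= pos (jshift (- s) G) b.
  rewrite /= -u'E; have [uu|uu] := ltP u u'; first by apply/ltW/Gp; lra.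
  by (have -> : u' = u by lra).
have clb : close d1 (jshift (- s) G) b F b.
  by rewrite /close /= -u'E; exact: close_le k1.
have [k2 k3 k4] := H1 b (jshift (- s) G) (Y + s) ltac:(rewrite bE; lra) ltac:(lra) sG' Gp' Gb clb.
split.
- by move: k2; rewrite ltr_norml; lra.
- move=> y yY; have [yb|yb] := leP (y + s) b.
    have [k5 _] := Hs y yY yb.
    exists (y + s); split; [lra| |by apply: close_le k5; lra].
    by rewrite ltr_norml; lra.
  exists b; split; [lra| |].
    by move: k3; rewrite !ltr_norml; lra.
  have [+ _] := k4 (y + s) ltac:(lra); rewrite /close /= addrK => k5.
  by apply: (@close_le _ (e / 2)) => //; lra.
- move=> _ _; have [_] := k4 (Y + s) ltac:(lra); rewrite /close /= addrK => k5.
  split; last by apply: (@close_le _ (e / 2)) => //; lra.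
  by move: k2; rewrite !ltr_norml; lra.
Qed.

End ArcDependence.

(** * The return map *)

Section Scaling.
Context {R : realType} (n : R).
Implicit Types (F G : jet R) (a b s x y u v e r L T : R).

Definition exponent : R := 3 / n.
Local Notation mu := exponent.

Lemma mu_gt1 (n_gt0 : 0 < n) (n_lt2 : n < 2) : 1 < mu.
Proof. by rewrite /exponent ltr_pdivlMr //; lra. Qed.

Lemma powR_sub1 L p : 0 < L -> L `^ (p - 1) = L `^ p / L.
Proof. by move=> L0; rewrite powR_split // powR_inv1 // ltW. Qed.

Lemma nonlin_scale e L u (n_gt0 : 0 < n) : `|e| = 1 -> 0 < L ->
  nonlin n (e * L `^ mu * u) = e * L `^ (mu - 3) * nonlin n u.
Proof.
move=> e1 L0; rewrite /nonlin normrM normrM e1 mul1r (@ger0_norm _ (_ `^ _)) ?powR_ge0 //.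
rewrite powRM ?powR_ge0 // -powRrM.
have -> : mu * n = 3 by rewrite /exponent divfK // lt0r_neq0.
rewrite powR_split // powRN.
by rewrite invfM; ring.
Qed.

(** The symmetries of the equation: scaling by [L], sign [e], translation by [s], and
    reversal of time for [r = - 1], which changes the sign of the equation. *)
Definition jaff e r L s F := Jet (fun y => e * L `^ mu * pos F (r * (y - s) / L))
  (fun y => e * r * L `^ (mu - 1) * vel F (r * (y - s) / L))
  (fun y => e * L `^ (mu - 2) * acc F (r * (y - s) / L)).

Lemma jsol_aff sg e r L s a b a' b' F (n_gt0 : 0 < n) : `|e| = 1 -> r * r = 1 -> 0 < L ->
  (forall y, a' < y < b' -> a < r * (y - s) / L < b) ->
  jsol n sg a b F -> jsol n (sg * r) a' b' (jaff e r L s F).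
Proof.
move=> e1 r1 L0 H [c0 c1 c2 D D2].
have cA : continuous (fun y => r * (y - s) / L) by conts.
have DA y : is_derive y 1 (fun y => r * (y - s) / L) (r / L).
  by ders; ring.
have L1 : L `^ (mu - 1) = L `^ mu / L by exact: powR_sub1.
have L2 : L `^ (mu - 2) = L `^ (mu - 1) / L.
  by rewrite -powR_sub1 //; congr (_ `^ _); ring.
have L3 : L `^ (mu - 3) = L `^ (mu - 2) / L.
  by rewrite -powR_sub1 //; congr (_ `^ _); ring.
have DC (f : R -> R) c d y : is_derive (r * (y - s) / L) 1 f d ->
    is_derive y 1 (fun y => c * f (r * (y - s) / L)) (c * (d * (r / L))).
  move=> fd; apply: (isD_eq (isD_mul (isD_cst c y)
      (@isD_comp _ f (fun y => r * (y - s) / L) y _ _ fd (DA y)))).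
  by rewrite mulr0 addr0.
split => /=.
- by apply: cont_mul; [exact: cont_cst|exact: cont_comp].
- by apply: cont_mul; [exact: cont_cst|exact: cont_comp].
- by apply: cont_mul; [exact: cont_cst|exact: cont_comp].
- move=> y yab; have [D0 D1] := D _ (H y yab); split.
    by apply: (isD_eq (DC _ _ _ _ D0)); rewrite L1; ring.
  apply: (isD_eq (DC _ _ _ _ D1)); rewrite L2.
  have -> : e * r * L `^ (mu - 1) * (acc F (r * (y - s) / L) * (r / L)) =
    r * r * (e * L `^ (mu - 1) / L * acc F (r * (y - s) / L)) by ring.
  by rewrite r1; ring.
move=> y yab Fy.
have Fy' : pos F (r * (y - s) / L) != 0 by apply: contra_neq Fy => ->; rewrite mulr0.
apply: (isD_eq (DC _ _ _ _ (D2 _ (H y yab) Fy'))).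
rewrite nonlin_scale // L3; ring.
Qed.

End Scaling.

Section ReturnMap.
Context {R : realType} (n : R).
Implicit Types (F G : jet R) (a b d l s x y u v e eta r A L N T : R).
Local Notation mu := (exponent n).

Lemma arc_sig a : {FT : jet R * R | lands n a -> is_arc n a FT.1 FT.2}.
Proof.
apply: cid; have [[F [T A]]|H] := pselect (lands n a); first by exists (F, T).
by exists (Jet id id id, 0).
Qed.

Definition arcF a := (sval (arc_sig a)).1.
Definition tau a := (sval (arc_sig a)).2.

Lemma arcP a : lands n a -> is_arc n a (arcF a) (tau a).
Proof. exact: (svalP (arc_sig a)). Qed.

Definition slope a := - vel (arcF a) (tau a).

(** After one arc, lengths have been multiplied by [expand a], and the normalized
    second derivative at the new zero is [ret a]. *)
Definition expand a := slope a `^ (mu - 1)^-1.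
Definition ret a := - acc (arcF a) (tau a) * expand a `^ (2 - mu).

Lemma tau_gt0 a : lands n a -> 0 < tau a.
Proof. by move=> /arcP[]. Qed.

Lemma slope_gt1 a : lands n a -> 1 < slope a.
Proof. by move=> /arcP/arc_slope; rewrite /slope; lra. Qed.

Lemma expand_gt1 a (n_gt0 : 0 < n) (n_lt2 : n < 2) : lands n a -> 1 < expand a.
Proof.
move=> /slope_gt1 s1; have m1 := mu_gt1 n_gt0 n_lt2.
have p0 : 0 < (mu - 1)^-1 by rewrite invr_gt0; lra.
rewrite [X in X < _](_ : 1 = 1 `^ (mu - 1)^-1); last by rewrite powR1.
apply: gt0_ltr_powR; rewrite ?nnegrE //; lra.
Qed.

Lemma expand_slope a (n_gt0 : 0 < n) (n_lt2 : n < 2) : lands n a ->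
  expand a `^ (mu - 1) = slope a.
Proof.
move=> /slope_gt1 s1; have m1 := mu_gt1 n_gt0 n_lt2.
rewrite /expand -powRrM mulVf ?powRr1 //; first lra.
by apply: lt0r_neq0; lra.
Qed.

Lemma ret_acc a (n_gt0 : 0 < n) (n_lt2 : n < 2) : lands n a ->
  acc (arcF a) (tau a) = - (expand a `^ (mu - 2) * ret a).
Proof.
move=> la; have e1 := expand_gt1 n_gt0 n_lt2 la.
rewrite /ret mulrCA -powR_split; last lra.
have -> : mu - 2 + (2 - mu) = 0 by ring.
by rewrite powRr0 mulr1 opprK.
Qed.

Lemma ret_gt0 a (n_gt0 : 0 < n) (n_lt2 : n < 2) : lands n a -> 0 < ret a.
Proof.
move=> la; have e1 := expand_gt1 n_gt0 n_lt2 la.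
have [_ a0 _] := arc_end (arcP la).
have e0 : 0 < expand a by lra.
by apply: mulr_gt0; [rewrite oppr_gt0|exact: powR_gt0].
Qed.

(** ** Continuity *)

Lemma mul_near x y e : 0 < e -> exists2 d, 0 < d & forall u v,
  `|u - x| < d -> `|v - y| < d -> `|u * v - x * y| < e.
Proof.
move=> e0; pose K := 1 + `|x| + `|y|.
have K1 : 1 <= K by rewrite /K -addrA lerDl addr_ge0.
exists (Num.min 1 (e / (2 * K))); first by rewrite lt_min ltr01 divr_gt0 //; lra.
move=> u v; rewrite !lt_min => /andP[u1 u2] /andP[v1 v2].
have -> : u * v - x * y = (u - x) * v + x * (v - y) by ring.
apply: le_lt_trans (ler_normD _ _) _; rewrite !normrM.
have vK : `|v| < K - `|x|.
  have := ler_normD (v - y) y; rewrite subrK /K; lra.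
have xK : `|x| <= K by rewrite /K -addrA addrCA lerDl addr_ge0.
have := normr_ge0 (u - x); have := normr_ge0 (v - y); have := normr_ge0 x.
have := normr_ge0 v; rewrite ltr_pdivlMr in u2; last lra.
rewrite ltr_pdivlMr in v2; last lra.
clear K1; move: u2 v2 vK xK; move: (K) => k.
move: `|v| `|x| `|u - x| `|v - y| => p q s t *.
have : s * p <= s * (k - q) by rewrite ler_wpM2l //; lra.
have [->|q0] := eqVneq q 0; first by nra.
have : q * t <= k * t by rewrite ler_wpM2r //; lra.
nra.
Qed.

Lemma powR_near p x e : 0 < x -> 0 < e -> exists2 d, 0 < d & forall u,
  `|u - x| < d -> `|u `^ p - x `^ p| < e.
Proof.
move=> x0; apply: (contP (fun u => u `^ p) x).1.
by apply: isD_cont; exact: is_derive1_powR.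
Qed.

Lemma arc_end_cont a e (n_gt0 : 0 < n) (n_lt2 : n < 2) : lands n a -> 0 < e ->
  exists2 d, 0 < d & forall b, lands n b -> `|b - a| < d ->
    `|tau b - tau a| < e /\ close e (arcF b) (tau b) (arcF a) (tau a).
Proof.
move=> la e0; have [d d0 H] := arc_dependence n_gt0 n_lt2 (arcP la) e0.
exists d => // b lb ba.
have [T0 sF iF Fp pT] := arcP lb; have [T0' _ [p0 v0 a0] _ _] := arcP la.
have [p1 v1 a1] := iF.
have h0 : (0 : R) <= 0 <= tau a by have := tau_gt0 la; lra.
have h2 : 0 <= pos (arcF b) 0 by rewrite p1.
have cl : close d (arcF b) 0 (arcF a) 0.
  by split; rewrite ?p1 ?v1 ?a1 ?p0 ?v0 ?a0 ?subrr ?normr0.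
have [_ _ K] := H 0 (arcF b) (tau b) h0 (ltW T0) sF Fp h2 cl.
by apply: K => //; left.
Qed.

Lemma ret_cont a e (n_gt0 : 0 < n) (n_lt2 : n < 2) : lands n a -> 0 < e ->
  exists2 d, 0 < d & forall b, lands n b -> `|b - a| < d ->
    [/\ `|tau b - tau a| < e, `|expand b - expand a| < e, `|ret b - ret a| < e &
        close e (arcF b) (tau b) (arcF a) (tau a)].
Proof.
move=> la e0; have s1 := slope_gt1 la; have e1 := expand_gt1 n_gt0 n_lt2 la.
have [d1 d10 H1] := @mul_near (- acc (arcF a) (tau a)) (expand a `^ (2 - mu)) e e0.
have [d2 d20 H2] := @powR_near (2 - mu) (expand a) d1 ltac:(lra) d10.
have m20 : 0 < Num.min d2 e by rewrite lt_min d20.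
have [d3 d30 H3] := @powR_near (mu - 1)^-1 (slope a) (Num.min d2 e) ltac:(lra) m20.
pose q := Num.min e (Num.min d1 d3).
have q0 : 0 < q by rewrite !lt_min e0 d10.
have [d d0 H] := arc_end_cont n_gt0 n_lt2 la q0.
exists d => // b lb ba; have [t [c0 c1 c2]] := H b lb ba.
move: t c0 c1 c2; rewrite !lt_min => /andP[t _] /andP[c0 _] /and3P[c1 _ c1'] /and3P[c2 c2' _].
have sl : `|slope b - slope a| < d3 by rewrite /slope -opprD normrN.
have := H3 _ sl; rewrite lt_min => /andP[ex ex'].
split => //; apply: H1; last exact: H2.
by rewrite -opprD normrN.
Qed.

(** ** Injectivity *)

(** An arc run backwards and rescaled starts with unit slope and second derivative
    [- ret a], so arcs with the same [ret] share their reversed initial data. *)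
Lemma reversed_arc a (n_gt0 : 0 < n) (n_lt2 : n < 2) : lands n a ->
  let L := (expand a)^-1 in let G := jaff n 1 (-1) L (tau a * L) (arcF a) in
  [/\ 0 < tau a * L, jsol n (-1) 0 (tau a * L) G, jinit G 0 0 1 (- ret a),
      forall y, 0 < y < tau a * L -> 0 < pos G y &
      jinit G (tau a * L) 0 (- L `^ (mu - 1)) (L `^ (mu - 2) * a)].
Proof.
move=> la L G; have [T0 sF [p0 v0 a0] Fp pT] := arcP la.
have e1 := expand_gt1 n_gt0 n_lt2 la.
have L0 : 0 < L by rewrite invr_gt0; lra.
have TL : 0 < tau a * L by rewrite mulr_gt0.
have E y : -1 * (y - tau a * L) / L = tau a - y / L by field; exact: lt0r_neq0.
have itv y : 0 < y < tau a * L -> 0 < tau a - y / L < tau a.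
  move=> /andP[y0 y1]; rewrite subr_gt0 ltr_pdivrMr // y1 /= ltrBlDr ltrDl.
  by rewrite divr_gt0.
have powL p : L `^ p = (expand a `^ p)^-1.
  by rewrite /L -powR_inv1 ?(ltW (lt_trans ltr01 e1)) // -powRrM mulN1r powRN.
split; first exact: TL.
- rewrite -[-1]mul1r; apply: (@jsol_aff _ n 1 1 (-1) L (tau a * L) 0 (tau a)) => //.
  + by rewrite normr1.
  + by rewrite mulrNN mulr1.
  + by move=> y yT; rewrite E; exact: itv.
- split; rewrite /= E mul0r subr0.
  + by rewrite pT mulr0.
  + rewrite powL expand_slope // /slope mul1r invrN mulrNN mul1r mulVf //.
    by have [/ltr0_neq0] := arc_end (arcP la).
  + rewrite powL ret_acc // mul1r mulrN mulKf // lt0r_neq0 // powR_gt0; lra.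
- move=> y yT; rewrite /= E; have := Fp _ (itv y yT); rewrite mul1r => F0.
  by rewrite mulr_gt0 // powR_gt0.
split; rewrite /= E mulfK ?subrr ?lt0r_neq0 //.
- by rewrite p0 mulr0.
- by rewrite v0 mul1r mulr1 mulN1r.
- by rewrite a0 mul1r.
Qed.

Lemma powR_inj_pos p x y : p != 0 -> 0 < x -> 0 < y -> x `^ p = y `^ p -> x = y.
Proof.
move=> p0 x0 y0 E; rewrite -(powRr1 (ltW x0)) -(mulfV p0) powRrM E -powRrM mulfV //.
by rewrite powRr1 // ltW.
Qed.

Lemma ret_inj a b (n_gt0 : 0 < n) (n_lt2 : n < 2) : lands n a -> lands n b ->
  ret a = ret b -> a = b.
Proof.
wlog : a b / tau a * (expand a)^-1 <= tau b * (expand b)^-1.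
  move=> H la lb E; have [|/ltW] := leP (tau a * (expand a)^-1) (tau b * (expand b)^-1).
    by move=> h; exact: (H a b h la lb E).
  by move=> h; exact: esym (H b a h lb la (esym E)).
move=> TT la lb E.
have [Ta0 sA iA Ap [eA0 eA1 eA2]] := reversed_arc n_gt0 n_lt2 la.
have [Tb0 sB iB Bp [eB0 eB1 eB2]] := reversed_arc n_gt0 n_lt2 lb.
have ea1 := expand_gt1 n_gt0 n_lt2 la; have eb1 := expand_gt1 n_gt0 n_lt2 lb.
have m1 := mu_gt1 n_gt0 n_lt2.
have La0 : 0 < (expand a)^-1 by rewrite invr_gt0 (lt_trans ltr01).
have Lb0 : 0 < (expand b)^-1 by rewrite invr_gt0 (lt_trans ltr01).
set La := (expand a)^-1 in TT Ta0 sA iA Ap eA0 eA1 eA2 La0.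
set Lb := (expand b)^-1 in TT Tb0 sB iB Bp eB0 eB1 eB2 Lb0.
clearbody La Lb.
move: (jaff n 1 _ La _ _) sA iA Ap eA0 eA1 eA2 => GA sA [pA vA aA] Ap eA0 eA1 eA2.
move: (jaff n 1 _ Lb _ _) sB iB Bp eB0 eB1 eB2 => GB sB [pB vB aB] Bp eB0 eB1 eB2.
have rA : rising GA 0 by right; split; [exact: pA|rewrite vA; exact: ltr01].
have sg1 : `|-1| <= 1 :> R by rewrite normrN normr1.
have iAB : jinit GB 0 (pos GA 0) (vel GA 0) (acc GA 0).
  by split; rewrite ?pA ?vA ?aA ?E.
have H := @uniq_forward _ n (-1) GA GB (tau a * La) n_gt0 n_lt2 sg1 Ta0 sA
  (jsol_sub (lexx _) TT sB) rA Ap iAB.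
have TE : tau a * La = tau b * Lb.
  apply/eqP; rewrite eq_le TT leNgt; apply/negP => TT'.
  have [h _ _] := H (tau a * La) ltac:(by rewrite lexx ltW).
  by have := Bp (tau a * La) ltac:(by rewrite Ta0); rewrite h eA0 ltxx.
have [_ h1 h2] := H (tau a * La) ltac:(by rewrite lexx ltW).
rewrite eA1 eA2 TE eB1 eB2 in h1 h2.
have m0 : mu - 1 != 0 by rewrite subr_eq0 gt_eqF.
have LL : La = Lb := powR_inj_pos m0 La0 Lb0 (esym (oppr_inj h1)).
rewrite LL in h2; move: h2; clear - Lb0 => h2.
exact: mulfI (lt0r_neq0 (powR_gt0 (mu - 2) Lb0)) _ _ (esym h2).
Qed.

(** ** Bounds *)

(** Only the second derivative is large at the end of a steep arc, and [2 - mu] is at least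
    [- (mu - 1)], so that rescaling costs at most a factor [slope]. *)
Lemma ret_steep N (n_gt0 : 0 < n) (n_lt2 : n < 2) : 1 <= N -> lands n (- N) -> N / 3 <= ret (- N).
Proof.
move=> N1 la; have [aN v5] := steep_arc n_gt0 n_lt2 N1 (arcP la).
have s1 := slope_gt1 la; have e1 := expand_gt1 n_gt0 n_lt2 la.
have s3 : slope (- N) <= 3.
  have : slope (- N) ^+ 2 <= 5 by rewrite /slope sqrrN.
  by move: (slope _) s1 => s; clear; nra.
have h : 3^-1 <= expand (- N) `^ (2 - mu).
  apply: (@le_trans _ _ (expand (- N) `^ (- (mu - 1)))).
    by rewrite powRN expand_slope // lef_pV2 ?posrE; lra.
  have m : - (mu - 1) <= 2 - mu by lra.
  by have := ler_powR (ltW e1) m.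
rewrite /ret; apply: ler_pM; [lra|by rewrite invr_ge0 ler0n|exact: ltW|exact: h].
Qed.

Lemma ret_flat (n_gt32 : 3 / 2 <= n) (n_lt85 : n <= 8 / 5) : lands n 0 ->
  ret 0 <= 2200 * 13200.
Proof.
move=> l0; have n_gt0 : 0 < n by lra.
have n_lt2 : n < 2 by lra.
have [a0 v0] := flat_arc n_gt32 n_lt85 (arcP l0).
have [_ a1 _] := arc_end (arcP l0).
have e1 := expand_gt1 n_gt0 n_lt2 l0.
have h : expand 0 `^ (2 - mu) <= 13200.
  apply: le_trans v0; rewrite -/(slope 0) -expand_slope //.
  have m32 : 3 / 2 <= mu by rewrite /exponent ler_pdivlMr; lra.
  have m : 2 - mu <= mu - 1 by lra.
  by have := ler_powR (ltW e1) m.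
rewrite /ret; apply: ler_pM; [lra|exact: powR_ge0|exact: a0|exact: h].
Qed.

Local Opaque ret expand slope tau.

(** ** A stable fixed point of the second iterate *)

(** At the supremum of the points that an increasing map moves to the right, the
    map is stable from both sides, without any condition on its derivative. *)
Lemma monotone_stable_fixed_point (H : R -> R) A : continuous H -> 0 <= A ->
  (forall x y, 0 <= x -> x <= y -> y <= A -> H x <= H y) -> 0 < H 0 -> H A < A ->
  exists2 x, 0 < x < A & H x = x /\ forall eta, 0 < eta -> exists l r,
    [/\ 0 < l < x, x < r < A, x - eta < l, r < x + eta &
        forall y, l <= y <= r -> l <= H y <= r].
Proof.
move=> cH A0 mono H0 HA.
pose S := [set x | 0 <= x <= A /\ x < H x].
have S0 : S 0 by split; rewrite ?lexx.
have hS : has_sup S by split; [exists 0|exists A => x [/andP[]]].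
pose x : R := sup S.
have x0 : 0 <= x by apply: ub_le_sup => //; exact: hS.2.
have xA : x <= A by apply: ge_sup; [exact: hS.1|move=> y [/andP[]]].
have right y : x < y <= A -> H y <= y.
  move=> yx; rewrite leNgt; apply/negP => Hy.
  have : y <= x by apply: ub_le_sup; [exact: hS.2|split => //; lra].
  lra.
have left e : 0 < e -> exists2 y, S y & x - e < y.
  by move=> e0; exact: sup_adherent.
have upper y : S y -> y <= x by move=> Sy; apply: ub_le_sup => //; exact: hS.2.
clearbody x.
have Hx : H x = x.
  apply/eqP; rewrite eq_le !leNgt; apply/andP; split; apply/negP => h.
    have [d d0 Hd] := @cont_pos_near _ (fun y => H y - y) x (cont_sub cH (@cont_id R)) ltac:(cbv beta; lra).
    have xA' : x < A.
      by rewrite lt_neqAle xA andbT; apply: contraTneq h => ->; rewrite -leNgt ltW.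
    pose y := Num.min (x + d / 2) A.
    have yd : y <= x + d / 2 by rewrite /y ge_min lexx.
    have yA : y <= A by rewrite /y ge_min lexx orbT.
    have yx : x < y by rewrite /y lt_min; lra.
    clearbody y; have := Hd y ltac:(rewrite ltr_norml; lra).
    by have := right y ltac:(lra); lra.
  have [d d0 Hd] := @cont_pos_near _ (fun y => y - H y) x (cont_sub (@cont_id R) cH) ltac:(cbv beta; lra).
  have [y [yA yH] yd] := left d d0; have yx := upper y (conj yA yH).
  by have := Hd y ltac:(rewrite ltr_norml; lra); lra.
have x_gt0 : 0 < x.
  by rewrite lt_neqAle x0 andbT; apply: contraTneq H0 => x0'; rewrite x0' Hx -x0' ltxx.
have x_ltA : x < A.
  by rewrite lt_neqAle xA andbT; apply: contraTneq HA => <-; rewrite Hx ltxx.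
exists x; first by rewrite x_gt0.
split => // eta eta0.
have [l [lA lH] lx] := left (Num.min eta x) ltac:(by rewrite lt_min eta0).
have m1 : Num.min eta x <= eta by rewrite ge_min lexx.
have m2 : Num.min eta x <= x by rewrite ge_min lexx orbT.
move: (Num.min _ _) m1 m2 lx => m m1 m2 lx.
have llx : l < x.
  by rewrite lt_neqAle (upper l (conj lA lH)) andbT; apply: contraTneq lH => ->; rewrite Hx ltxx.
pose r := Num.min (x + eta / 2) ((x + A) / 2).
have r1 : r <= x + eta / 2 by rewrite /r ge_min lexx.
have r2 : r <= (x + A) / 2 by rewrite /r ge_min lexx orbT.
have r3 : x < r by rewrite /r lt_min; lra.
clearbody r; exists l, r; split; try lra.
move=> y yl; have := mono l y ltac:(lra) ltac:(lra) ltac:(lra).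
by have := mono y r ltac:(lra) ltac:(lra) ltac:(lra); have := right r ltac:(lra); lra.
Qed.

(** It suffices that all arcs starting below [ret 0] land: [ret] is then continuous,
    injective and large at large negative points, hence decreasing, and its square
    is an increasing map of the interval from [0] to [ret 0] into its interior. *)
Lemma stable_two_cycle (n_gt0 : 0 < n) (n_lt2 : n < 2) : lands n 0 ->
  (forall a, a <= ret 0 -> lands n a) ->
  exists a, [/\ lands n a, lands n (ret a), ret (ret a) = a &
    forall eta, 0 < eta -> exists l r, [/\ l < a < r, a - eta < l, r < a + eta,
      forall y, l <= y <= r -> lands n y /\ lands n (ret y) &
      forall y, l <= y <= r -> l <= ret (ret y) <= r]].
Proof.
move=> l0 lA; have A0 : 0 < ret 0 by exact: ret_gt0.
have [N N0 rN] : exists2 N, 0 < N & ret 0 < ret (- N).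
  have h0 : 1 <= 1 + 3 * ret 0 by move: (ret 0) A0; clear=> A; lra.
  have h1 : - (1 + 3 * ret 0) <= ret 0 by move: (ret 0) A0; clear=> A; lra.
  have := ret_steep n_gt0 n_lt2 h0 (lA _ h1).
  by exists (1 + 3 * ret 0); [move: h0|]; move: (ret (- _)) A0 H; move: (ret 0); clear=> A B; lra.
have [A AE] : exists A, ret 0 = A by exists (ret 0).
rewrite AE in A0 rN lA.
have NAA : - N <= A by move: N0 A0; clear; lra.
have [h [hE ch]] : exists h : R -> R, (forall a, - N <= a <= A -> h a = ret a) /\ continuous h.
  exists (fun a => ret (clamp (- N) A a)); split; first by move=> a aA; rewrite clamp_id.
  have lc a : lands n (clamp (- N) A a) by apply: lA; case/andP: (clamp_itv a NAA).
  move=> a; apply/contP => e e0.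
  have [d d0 Hd] := ret_cont n_gt0 n_lt2 (lc a) e0.
  have [d' d'0 Hd'] := (contP _ a).1 (@clamp_cont _ (- N) A a) d d0.
  by exists d' => // y /Hd' /Hd H; have [] := H (lc y).
have hA x : 0 <= x <= A -> h x = ret x.
  by move=> xA; apply: hE; move: xA N0; clear; lra.
have injh : {in `[(- N), A]%R &, injective h}.
  move=> x y; rewrite !in_itv /= => xA yA; rewrite (hE x xA) (hE y yA) => E.
  have [[_ xA'] [_ yA']] := (andP xA, andP yA).
  exact: ret_inj n_gt0 n_lt2 (lA x xA') (lA y yA') E.
have h0 : h 0 = A by rewrite hA // lexx ltW.
have hN : A < h (- N) by rewrite hE // lexx NAA.
have decr : {in `[(- N), A]%R &, {mono h : x y /~ x <= y}}.
  apply: (segment_continuous_inj_ge _ (continuous_subspaceT ch) injh).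
  rewrite leNgt; apply/negP => hh.
  have := segment_continuous_inj_le (ltW hh) (continuous_subspaceT ch) injh.
  move=> /(_ (- N) 0); rewrite !in_itv /= lexx NAA.
  have -> : - N <= 0 <= A by move: N0 A0; clear; lra.
  have -> : - N <= 0 by move: N0; clear; lra.
  by move=> /(_ isT isT); rewrite h0 leNgt hN.
have hdec x y : 0 <= x -> x <= y -> y <= A -> h y <= h x.
  move=> x0 xy yA; rewrite decr // in_itv /=; move: N0 x0 xy yA; clear; lra.
have hpos x : 0 <= x <= A -> 0 < h x <= A.
  move=> xA; have [x0 x1] := andP xA.
  apply/andP; split; last by have := hdec 0 x (lexx 0) x0 x1; rewrite h0.
  by rewrite (hA x xA); exact: ret_gt0 n_gt0 n_lt2 (lA x x1).
have h00 : 0 < h A <= A by apply: hpos; rewrite lexx ltW.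
have ne x : 0 < x <= A -> h x < A.
  move=> /andP[x0 xA]; have /andP[_] := hpos x ltac:(by rewrite (ltW x0)).
  rewrite le_eqVlt => /predU1P[E|//].
  have E0 : x = 0.
    apply: injh; rewrite ?E ?h0 // in_itv /=; move: N0 A0 x0 xA; clear; lra.
  by rewrite E0 ltxx in x0.
have [| | | | |a aA [Ha stab]] := @monotone_stable_fixed_point (fun a => h (h a)) A.
- exact: cont_comp.
- exact: ltW.
- move=> x y x0 xy yA.
  have /andP[h1 _] := hpos y ltac:(by rewrite yA (le_trans x0)).
  have /andP[_ h2] := hpos x ltac:(by rewrite x0 (le_trans xy)).
  by apply: (hdec); [exact: ltW|exact: (hdec)|].
- rewrite h0; by case/andP: h00.
- by apply: ne.
have lA' x : 0 <= x <= A -> [/\ lands n x, lands n (ret x), 0 <= ret x <= A & h (h x) = ret (ret x)].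
  move=> xA; have := hpos x xA; rewrite hA // => /andP[r0 rA].
  have r01 : 0 <= ret x <= A by rewrite (ltW r0).
  have [_ x1] := andP xA.
  by split; [exact: lA|exact: lA|exact: r01|rewrite (hA _ r01)].
have aA' : 0 <= a <= A by move: aA; clear; lra.
have [l1 l2 l3 E1] := lA' a aA'.
exists a; split; [exact: l1|exact: l2|by rewrite -E1|].
move=> eta eta0; have [l [r [la ra le re H]]] := stab eta eta0.
have yA y : l <= y <= r -> 0 <= y <= A by move: la ra; clear; lra.
exists l, r; split; [by move: la ra; clear; lra|exact: le|exact: re| |].
  by move=> y /yA /lA'[].
by move=> y yl; have := H y yl; have [_ _ _ ->] := lA' y (yA y yl).
Qed.

End ReturnMap.

(** * Absolute continuity *)

Section AbsoluteContinuity.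
Context {R : realType}.
Implicit Types (f g h k : R -> R) (a b c d e x y z u v : R) (s : seq (R * R)).
Local Notation leb := (@lebesgue_measure R).
Local Notation AC := (@absolutely_continuous_on R).

Lemma ac_sub a b a' b' f : a <= a' -> b' <= b -> AC a b f -> AC a' b' f.
Proof.
move=> aa bb H e e0; have [d d0 Hd] := H e e0; exists d => // k x y xy.
by apply: Hd => i; have [? [? ?]] := xy i; split; [lra|split; lra].
Qed.

Lemma ac_add a b f g : AC a b f -> AC a b g -> AC a b (fun y => f y + g y).
Proof.
move=> F G e e0; have [d d0 Hd] := F (e / 2) ltac:(lra).
have [d' d'0 Hd'] := G (e / 2) ltac:(lra).
exists (Num.min d d'); first by rewrite lt_min d0.
move=> k x y xy T; rewrite lt_min => /andP[/(Hd _ _ _ xy T) h1 /(Hd' _ _ _ xy T) h2].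
apply: (@le_lt_trans _ _ (\sum_(i < k) `|f (y i) - f (x i)| + \sum_(i < k) `|g (y i) - g (x i)|)).
  rewrite -big_split /=; apply: ler_sum => i _.
  by rewrite opprD addrACA; exact: ler_normD.
by move: h1 h2; clear; lra.
Qed.

Lemma ac_lip a b f K : 0 < K ->
  (forall x y, a <= x -> x <= y -> y <= b -> `|f y - f x| <= K * (y - x)) -> AC a b f.
Proof.
move=> K0 lip e e0; exists (e / K); first exact: divr_gt0.
move=> k x y xy _ lt; apply: (@le_lt_trans _ _ (\sum_(i < k) K * (y i - x i))).
  by apply: ler_sum => i _; have [? [? ?]] := xy i; exact: lip.
by rewrite -mulr_sumr mulrC -ltr_pdivlMr.
Qed.

(** Lists of nonoverlapping intervals, which can be concatenated, stand for the indexed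
    families in the definition of absolute continuity. *)
Fixpoint chain x s y : Prop :=
  if s is (u, v) :: s' then [/\ x <= u, u <= v & chain v s' y] else x <= y.

Lemma chain_le s x y : chain x s y -> x <= y.
Proof. by elim: s x => [|[u v] s IH] x //= [xu uv /IH]; lra. Qed.

Lemma chain_cat s t x y z : chain x s y -> chain y t z -> chain x (s ++ t) z.
Proof.
elim: s x => [|[u v] s IH] x /=; last by case=> xu uv /IH H /H; split.
case: t => [|[u v] t] /=; first exact: le_trans.
by move=> xy [yu uv c]; split => //; exact: le_trans yu.
Qed.

Lemma chain_nth s x y i : chain x s y -> (i < size s)%N ->
  [/\ x <= (nth (0, 0) s i).1, (nth (0, 0) s i).1 <= (nth (0, 0) s i).2 &
      (nth (0, 0) s i).2 <= y].
Proof.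
elim: s x i => [|[u v] s IH] x [|i] //= [xu uv c] h.
  by split => //; exact: chain_le c.
by have [h1 h2 h3] := IH _ i c h; split => //; lra.
Qed.

Lemma chain_sorted s x y i j : chain x s y -> (i < j)%N -> (j < size s)%N ->
  (nth (0, 0) s i).2 <= (nth (0, 0) s j).1.
Proof.
elim: s x i j => [|[u v] s IH] x [|i] [|j] //= [xu uv c] h1 h2.
  by have [] := chain_nth c h2.
exact: (IH v i j c h1 h2).
Qed.

Lemma ac_chain a b f e : AC a b f -> 0 < e -> exists2 d, 0 < d & forall s,
  chain a s b -> \sum_(p <- s) (p.2 - p.1) < d -> \sum_(p <- s) `|f p.2 - f p.1| < e.
Proof.
move=> F e0; have [d d0 Hd] := F e e0; exists d => // s c.
rewrite !(big_nth (0, 0)) !big_mkord; apply: Hd.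
  by move=> i; have [] := chain_nth c (ltn_ord i).
move=> i j _ _ [t [/= ]]; rewrite !in_itv /= => /andP[i1 i2] /andP[j1 j2].
have [ij|ij|/val_inj //] := ltngtP i j.
  by have := lt_trans (lt_le_trans i2 (chain_sorted c ij (ltn_ord j))) j1; rewrite ltxx.
by have := lt_trans (lt_le_trans j2 (chain_sorted c ij (ltn_ord i))) i1; rewrite ltxx.
Qed.

Lemma chain_measure (U : set R) s x y : measurable U -> chain x s y ->
  (forall p, p \in s -> `]p.1, p.2[ `<=` U) ->
  ((\sum_(p <- s) (p.2 - p.1))%:E <= leb (U `&` `]x, y[))%E.
Proof.
move=> mU; elim: s x => [|[u v] s IH] x /=; first by rewrite big_nil measure_ge0.
move=> [xu uv c] sU; rewrite big_cons /= EFinD.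
have vy := chain_le c.
have {IH} h := IH v c (fun p ps => sU p ltac:(by rewrite inE ps orbT)).
apply: (@le_trans _ _ (leb (`]u, v[ `|` (U `&` `]v, y[)))).
  rewrite measureU //=; last 2 first.
  - by apply: measurableI.
  - rewrite -subset0 => t /= []; rewrite !in_itv /= => ? [_ ?]; lra.
  apply: leeD => //; rewrite lebesgue_measure_itv /= lte_fin.
  by case: ltP => // ?; rewrite lee_fin; lra.
apply: le_measure; rewrite ?inE.
- by apply: measurableU => //; exact: measurableI.
- exact: measurableI.
- move=> t [tuv|[Ut tv]]; split => //.
  + by apply: (sU (u, v)); rewrite ?inE ?eqxx.
  + by move: tuv; rewrite /= !in_itv /=; lra.
  + by move: tv; rewrite /= !in_itv /=; lra.
Qed.

(** A gauge argument: where the derivative vanishes increments are negligible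
    against lengths, and the remaining points lie in an open set of small measure, in
    which absolute continuity controls the increments. *)
Lemma ac_cst a b f : a <= b -> AC a b f ->
  {ae leb, forall x, a <= x <= b -> is_derive x 1 f 0} -> f b = f a.
Proof.
move=> ab F [Z [mZ Z0 HZ]].
suff H e : 0 < e -> `|f b - f a| <= e * (b - a + 1).
  apply/eqP; rewrite -subr_eq0 -normr_le0; apply/ler_addgt0Pr => e e0.
  have h : 0 < b - a + 1 by lra.
  by rewrite add0r; have := H _ (divr_gt0 e0 h); rewrite divfK // lt0r_neq0.
move=> e0; have [d d0 Hd] := ac_chain F e0.
have Zoo : (leb Z < +oo)%E by rewrite Z0 ltry.
have [U [oU ZU UZ]] := lebesgue_regularity_outer mZ Zoo d0.
have mU : measurable U by exact: measurable_realfun.open_measurable.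
have Ud : (leb U < d%:E)%E.
  apply: le_lt_trans UZ; have := measureU2 leb mZ (measurableD mU mZ).
  rewrite setDUK // => /le_trans; apply.
  by change (leb Z + leb (U `\` Z) <= leb (U `\` Z))%E; rewrite Z0 add0e.
have [||s [c sU h]] := @local_to_global R (fun x y => exists s,
    [/\ chain x s y, (forall p, p \in s -> `]p.1, p.2[ `<=` U) &
       `|f y - f x| <= e * (y - x) + \sum_(p <- s) `|f p.2 - f p.1|]) a b ab.
- move=> x y z ax xy yz zb [s [cs sU hs]] [t [ct tU ht]]; exists (s ++ t); split.
  + exact: chain_cat ct.
  + by move=> p; rewrite mem_cat => /orP[/sU|/tU].
  + rewrite big_cat /= -(subrKA (f y)); apply: le_trans (ler_normD _ _) _.
    by move: hs ht; clear; lra.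
- move=> x xab; have [Zx|Zx] := pselect (Z x).
    have /nbhs_ballP[r r0 Hr] := open_nbhs_nbhs (conj oU (ZU _ Zx)).
    exists r => // y z ay yx xz zb yr zr; exists [:: (y, z)]; split => /=.
    + by split => //; lra.
    + move=> p; rewrite inE => /eqP -> /= t; rewrite /= in_itv /= => tt.
      by apply: Hr; rewrite /ball /= ltr_norml; lra.
    + by rewrite big_seq1 /= lerDr mulr_ge0 //; lra.
  have fx : is_derive x 1 f 0.
    by apply: contrapT => nd; apply: Zx; apply: HZ => /= /(_ xab).
  have [r r0 Hr] : exists2 r : R, 0 < r & forall y, `|y - x| < r -> `|f y - f x| <= e * `|y - x|.
    have [df D0] := fx; move: df; rewrite /derivable.
    rewrite /derive in D0; move=> /cvgrPdist_lt; rewrite D0 => /(_ e e0); rewrite near_withinE => /nbhs_ballP[r r0 Hr].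
    exists r => // y yx; have [->|yx'] := eqVneq y x; first by rewrite !subrr normr0 mulr0.
    have yx0 : y - x != 0 by rewrite subr_eq0.
    have := Hr (y - x); rewrite /ball /= sub0r normrN => /(_ yx yx0).
    rewrite sub0r normrN /= [_ *: 1]mulr1 subrK [_ *: _]mulrC normrM normfV.
    by rewrite ltr_pdivrMr ?normr_gt0 // => /ltW.
  exists r => // y z ay yx xz zb yr zr; exists [::]; split => //=; first lra.
  rewrite big_nil addr0 -(subrKA (f x)); apply: le_trans (ler_normD _ _) _.
  have h1 := Hr z ltac:(rewrite ltr_norml; lra).
  have := Hr y ltac:(rewrite ltr_norml; lra).
  rewrite distrC [`|y - x|]distrC => h2.
  rewrite [`|z - x|]ger0_norm in h1; last lra.
  rewrite [`|x - y|]ger0_norm in h2; last lra.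
  by move: h1 h2; clear; lra.
apply: (le_trans h); rewrite [leRHS]mulrDr mulr1 lerD2l; apply/ltW/Hd => //.
rewrite -lte_fin; apply: le_lt_trans Ud; apply: le_trans (chain_measure mU c sU) _.
by apply: le_measure; rewrite ?inE //; exact: measurableI.
Qed.

Lemma ac_primitive a b f k : a <= b -> AC a b f -> continuous k ->
  {ae leb, forall x, a <= x <= b -> is_derive x 1 f (k x)} ->
  f b - f a = prim k b - prim k a.
Proof.
move=> ab F ck H.
have [M M0 HM] : exists2 M, 0 < M & forall x, a <= x <= b -> `|k x| <= M.
  have [|M _ HM] := @EVT_max R (fun x => `|k x|) a b ab.
    by apply: continuous_subspaceT => x; apply: continuous_comp; [exact: ck|exact: norm_continuous].
  exists (`|k M| + 1); first by rewrite ltr_wpDl.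
  move=> x xab; have /(_ x) := HM; rewrite in_itv => /(_ xab); lra.
have G : AC a b (fun y => f y - prim k y).
  apply: ac_add => //; apply: (ac_lip M0) => x y ax xy yb.
  apply: (@mvt_bound _ (fun y => - prim k y)) => //; first by apply: cont_opp; exact: prim_cont.
  move=> z zxy; exists (- k z); last by rewrite normrN; apply: HM; lra.
  by apply: isD_opp; exact: prim_derive.
have := ac_cst ab G; have -> : forall p q r t : R, (p - q = r - t) = (p - r = q - t).
  by move=> p q r t; apply/propext; split; lra.
apply; have [Z [mZ Z0 HZ]] := H; exists Z; split => // x nx; apply: HZ => Hx; apply: nx => xab.
by apply: (isD_eq (isD_sub (Hx xab) (prim_derive x ck))); rewrite subrr.
Qed.

End AbsoluteContinuity.

Section SingularPrimitive.
Context {R : realType}.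
Implicit Types (f F h k : R -> R) (a b c d e x y z u v : R).
Local Notation leb := (@lebesgue_measure R).
Local Notation AC := (@absolutely_continuous_on R).
Local Notation itv x y := (`]x, y]%classic : set R).

Lemma measurable_itv_oc x y f : (forall z, x < z < y -> {for z, continuous f}) ->
  measurable_fun (itv x y) f.
Proof.
move=> cf; apply/measurable_fun_itv_bndo_bndcP.
apply: open_continuous_measurable_fun => //.
by move=> z; rewrite inE /= in_itv /= => /cf.
Qed.

(** Monotone convergence over interior intervals; the integrand may be unbounded near the
    end points. *)
Lemma ftc_ge0 x y h F : x < y -> continuous F ->
  (forall z, x < z < y -> [/\ 0 <= h z, {for z, continuous h} & is_derive z 1 F (h z)]) ->
  (\int[leb]_(z in itv x y) (h z)%:E = (F y - F x)%:E)%E.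
Proof.
move=> xy cF H.
have mh : measurable_fun (`]x, y[ : set R) (EFin \o h).
  apply/measurable_EFinP; apply: open_continuous_measurable_fun => //.
  by move=> z; rewrite inE /= in_itv /= => /H[].
rewrite -(integral_itv_bndo_bndc mh).
pose q (i : nat) : R := (y - x) / (i.+3)%:R.
have q0 i : 0 < q i by rewrite divr_gt0 ?ltr0n //; lra.
have q1 i : q i < (y - x) / 2.
  by rewrite /q ltr_pM2l ?subr_gt0 // ltf_pV2 ?posrE ?ltr_nat ?ltr0n.
have qle i j : (i <= j)%N -> q j <= q i.
  by move=> ij; rewrite /q ler_pM2l ?subr_gt0 // lef_pV2 ?posrE ?ler_nat ?ltr0n.
have qlim e : 0 < e -> exists N, q N < e.
  move=> e0; have q2 : 0 < e / (y - x) by rewrite divr_gt0 // subr_gt0.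
  have [N HN] := ltr_add_invr q2.
  exists N; rewrite /q mulrC -ltr_pdivlMr ?subr_gt0 //; apply: le_lt_trans HN.
  by rewrite add0r lef_pV2 ?posrE ?ler_nat ?ltr0n // ltnW // ltnW.
pose D i : set R := `[x + q i, y - q i]%classic.
have DU : \bigcup_i D i = `]x, y[%classic.
  apply/seteqP; split => z /=.
    by move=> [i _]; rewrite /D /= !in_itv /=; have := q0 i; lra.
  rewrite in_itv /= => zxy.
  have [N HN] := qlim (Num.min (z - x) (y - z)) ltac:(rewrite lt_min; lra).
  move: HN; rewrite lt_min => HN.
  by exists N => //; rewrite /D /= in_itv /=; lra.
have h0 i z : D i z -> (0 <= (h z)%:E)%E.
  rewrite /D /= in_itv /= lee_fin => zD.
  by have [] := H z ltac:(have := q0 i; lra).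
have Dhomo : {homo D : n m / (n <= m)%N >-> (n <= m)%O}.
  move=> i j ij; apply/subsetPset => z; rewrite /D /= !in_itv /=; have := qle i j ij; lra.
have mD i : measurable (D i) by exact: measurable_itv.
have mhD i : measurable_fun (D i) (EFin \o h).
  apply: measurable_funS mh => //.
  by move=> z; rewrite /D /= !in_itv /=; have := q0 i; lra.
have : (\int[leb]_(z in D i) (EFin \o h) z)%E @[i --> \oo] -->
    (\int[leb]_(z in \bigcup_i D i) (EFin \o h) z)%E.
  exact: ge0_nondecreasing_set_cvg_integral.
rewrite DU => /cvg_lim <- //.
apply/cvg_lim => //.
have -> : (fun i => \int[leb]_(z in D i) (EFin \o h) z)%E =
    EFin \o (fun i => F (y - q i) - F (x + q i)).
  apply/funext => i /=; have h1 := q0 i; have h2 := q1 i.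
  rewrite EFinB; apply: continuous_FTC2.
  - by lra.
  - apply: continuous_in_subspaceT => z; rewrite inE /= in_itv /= => zD.
    by have [] := H z ltac:(lra).
  - split.
    + move=> z; rewrite in_itv /= => zD; have [_ _ [dz _]] := H z ltac:(lra).
      exact: dz.
    + by apply: cvg_at_right_filter; exact: cF.
    + by apply: cvg_at_left_filter; exact: cF.
  - move=> z; rewrite in_itv /= => zD; have [_ _ dz] := H z ltac:(lra).
    by rewrite derive1E; exact: derive_val.
apply: cvg_EFin; first exact: nearW.
have arith (p t r s e : R) : `|p - t| < e / 2 -> `|r - s| < e / 2 -> `|t - s - (p - r)| < e.
  by rewrite !ltr_norml; lra.
apply/cvgrPdist_lt => e e0.
have [d1 d10 H1] := (contP F y).1 (cF y) (e / 2) ltac:(lra).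
have [d2 d20 H2] := (contP F x).1 (cF x) (e / 2) ltac:(lra).
have [N HN] := qlim (Num.min d1 d2) ltac:(by rewrite lt_min d10).
move: HN; rewrite lt_min => HN.
near=> i.
have Ni : q i <= q N by apply: qle; near: i; exact: nbhs_infty_ge.
have [HN1 HN2] := andP HN.
have := H1 (y - q i) ltac:(by rewrite addrAC subrr add0r normrN gtr0_norm // (le_lt_trans Ni)).
have := H2 (x + q i) ltac:(by rewrite addrAC subrr add0r gtr0_norm // (le_lt_trans Ni)).
by move=> h2 h1; exact: arith h1 h2.
Unshelve. all: by end_near. Qed.

(** The relation that passes from intervals where [f] has a constant sign to their unions,
    and still yields absolute continuity of [F]. *)
Definition dominates f F x y := [/\ measurable_fun (itv x y) f,
  (\int[leb]_(z in itv x y) `|f z|%:E < +oo)%E &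
  ((`|F y - F x|)%:E <= \int[leb]_(z in itv x y) `|f z|%:E)%E].

Lemma dominates_sign f F x y : x <= y -> continuous F ->
  (forall z, x < z < y -> {for z, continuous f} /\ is_derive z 1 F (f z)) ->
  (forall z, x < z < y -> 0 <= f z) \/ (forall z, x < z < y -> f z <= 0) ->
  dominates f F x y.
Proof.
rewrite le_eqVlt => /predU1P[<- _ _ _|xy cF H S].
  by rewrite /dominates set_itvoc0 // !integral_set0 subrr normr0; split => //; exact: measurable_fun_set0.
have mf : measurable_fun (itv x y) f by apply: measurable_itv_oc => z /H[].
suff E : (\int[leb]_(z in itv x y) `|f z|%:E = (`|F y - F x|)%:E)%E.
  by split; rewrite ?E ?ltry.
case: S => S.
  rewrite ger0_norm; last first.
    by rewrite subr_ge0; apply: mvt_le => //; [exact: ltW|move=> z zxy; exists (f z); [exact: (H z zxy).2|exact: S]].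
  apply: ftc_ge0 => // z zxy; have [c D] := H z zxy; split => //.
  - by apply: continuous_comp c _; exact: norm_continuous.
  - by rewrite ger0_norm //; exact: S.
rewrite ler0_norm; last first.
  by rewrite subr_le0; apply: mvt_ge => //; [exact: ltW|move=> z zxy; exists (f z); [exact: (H z zxy).2|exact: S]].
rewrite opprB -[F x - F y]opprB opprD.
apply: (@ftc_ge0 x y (fun z => `|f z|) (fun z => - F z)) => //; first exact: cont_opp.
move=> z zxy; have [c D] := H z zxy; split => //.
- by apply: continuous_comp c _; exact: norm_continuous.
- by rewrite ler0_norm; [exact: isD_opp|exact: S].
Qed.

Lemma dominates_cat f F x y z : x <= y -> y <= z ->
  dominates f F x y -> dominates f F y z -> dominates f F x z.
Proof.
move=> xy yz [m1 i1 b1] [m2 i2 b2].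
have U : itv x z = itv x y `|` itv y z.
  by apply/seteqP; split => t /=; rewrite !in_itv /= => h;
    [have [ty|ty] := leP t y; [left|right]; lra|case: h; lra].
have mf : measurable_fun (itv x z) f.
  by rewrite U; apply/measurable_funU => //; exact: measurable_itv.
have E : (\int[leb]_(t in itv x z) `|f t|%:E =
    \int[leb]_(t in itv x y) `|f t|%:E + \int[leb]_(t in itv y z) `|f t|%:E)%E.
  rewrite U ge0_integral_setU //.
  - rewrite -U; apply/measurable_EFinP; exact: measurableT_comp.
  - apply/disj_setPS => t [/=]; rewrite !in_itv /=; lra.
split => //; rewrite E; first exact: lte_add_pinfty.
apply: le_trans (leeD b1 b2); rewrite -EFinD lee_fin.
by rewrite -(subrKA (F y)) [leRHS]addrC ler_normD.
Qed.

Lemma dominates_integrable f F a b : dominates f F a b ->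
  leb.-integrable `[a, b] (EFin \o f).
Proof.
move=> [mf fin _].
have mf' : measurable_fun (`[a, b] : set R) f by apply/measurable_fun_itv_obnd_cbndP.
apply/integrableP; split; first exact/measurable_EFinP.
rewrite (_ : (fun z => _) = (fun z => `|f z|%:E)) //.
rewrite -integral_itv_obnd_cbnd //.
by apply/measurable_EFinP; exact: measurableT_comp.
Qed.

Lemma leb_bigsetU_le (I : Type) (s : seq I) (G : I -> set R) : (forall i, measurable (G i)) ->
  (leb (\big[setU/set0]_(i <- s) G i) <= \sum_(i <- s) leb (G i))%E.
Proof.
move=> mG; elim: s => [|i s IH]; first by rewrite !big_nil measure0.
rewrite !big_cons; apply: le_trans (leeD (lexx _) IH).
have mB : measurable (\big[setU/set0]_(i <- s) G i) by apply: bigsetU_measurable.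
exact: (measureU2 leb (mG i) mB).
Qed.

(** The increments of [F] over disjoint intervals are bounded by the integral of [|f|] over
    their union, which is small with its measure. *)
Lemma dominates_ac f F a b : a <= b ->
  (forall x y, a <= x -> x <= y -> y <= b -> dominates f F x y) -> AC a b F.
Proof.
move=> ab H e e0.
have [mf fin _] := H a b (lexx _) ab (lexx _).
have mab : measurable (itv a b) by exact: measurable_itv.
have intf : leb.-integrable (itv a b) (EFin \o f).
  by apply/integrableP; split => //; exact/measurable_EFinP.
have intT : leb.-integrable setT (EFin \o (f \_ (itv a b))).
  by rewrite -restrict_EFin; apply/integrable_restrict => //; rewrite setTI.
have [d [d0 Hd]] := integral_normr_continuous intT e0.
exists d => // k x y xy tri lt.
pose G i : set R := itv (x i) (y i).
have mG i : measurable (G i) by exact: measurable_itv.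
have triG : trivIset [set` (index_enum 'I_k)] G.
  move=> i j _ _ [t [/= ]]; rewrite /G /= !in_itv /= => ti tj; apply: tri => //.
  pose m := Num.max (x i) (x j).
  have m1 : x i <= m by rewrite /m le_max lexx.
  have m2 : x j <= m by rewrite /m le_max lexx orbT.
  have m3 : m < t by rewrite /m gt_max; lra.
  clearbody m; exists ((m + t) / 2); rewrite /= !in_itv /=; split; lra.
pose A := \big[setU/set0]_(i <- index_enum 'I_k) G i.
have mA : measurable A by apply: bigsetU_measurable.
have Aab : A `<=` itv a b.
  rewrite /A -bigcup_seq => t [i _]; rewrite /G /= !in_itv /=.
  by have [? [? ?]] := xy i; lra.
have Ad : (leb A < d%:E)%E.
  apply: le_lt_trans (leb_bigsetU_le _ mG) _.
  rewrite (eq_bigr (fun i => (y i - x i)%:E)) ?sumEFin ?lte_fin // => i _.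
  rewrite /G lebesgue_measure_itv /= lte_fin; have [? [h _]] := xy i.
  by case: ltP => // h'; have -> : y i = x i by [lra]; rewrite subrr.
have E : (\int[leb]_(z in A) `|(f \_ (itv a b)) z|%:E = \sum_(i <- index_enum 'I_k) \int[leb]_(z in G i) `|f z|%:E)%E.
  rewrite -ge0_integral_bigsetU //; last 2 first.
  - by rewrite index_enum_uniq.
  - apply/measurable_EFinP; apply: measurableT_comp => //; exact: measurable_funS mf.
  by apply: eq_integral => z; rewrite inE => /Aab zab; rewrite patchT // inE.
have := Hd A mA Ad; rewrite -lte_fin /Rintegral E fineK; last first.
  rewrite -E; apply: integrable_fin_num => //.
  apply: (integrableS measurableT) => //; exact: integrable_abse intT.
move=> h; rewrite -lte_fin; apply: le_lt_trans h; rewrite -sumEFin; apply: lee_sum => i _.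
by have [? [? ?]] := xy i; have [] := H (x i) (y i) ltac:(lra) ltac:(lra) ltac:(lra).
Qed.

End SingularPrimitive.

(** * Integrated solutions and jets *)

Section Solutions.
Context {R : realType} (n : R).
Implicit Types (P Q : jet R) (phi psi : R -> R) (a b c d e s t x y z T : R).
Local Notation mu := (exponent n).
Local Notation leb := (@lebesgue_measure R).
Local Notation AC := (@absolutely_continuous_on R).

Definition lin3 P s := 3 * (mu - 1) * acc P s + (3 * mu ^+ 2 - 6 * mu + 2) * vel P s +
  mu * (mu - 1) * (mu - 2) * pos P s.

Definition psol a b P := [/\ continuous (pos P), continuous (vel P), continuous (acc P),
  forall s, a < s < b -> is_derive s 1 (pos P) (vel P s) /\ is_derive s 1 (vel P) (acc P s) &
  forall s, a < s < b -> pos P s != 0 ->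
    is_derive s 1 (acc P) (- (lin3 P s + nonlin n (pos P s)))].

Definition transversal P s := pos P s = 0 -> vel P s != 0.

Lemma psol_sub a b a' b' P : a <= a' -> b' <= b -> psol a b P -> psol a' b' P.
Proof. by move=> aa bb [c0 c1 c2 D D2]; split => // s sab; [apply: D|apply: D2]; lra. Qed.

Definition lin2 P s := 3 * (mu - 1) * vel P s + (3 * mu ^+ 2 - 6 * mu + 2) * pos P s +
  mu * (mu - 1) * (mu - 2) * prim (pos P) s.

Lemma lin3_cont a b P : psol a b P -> continuous (lin3 P).
Proof. by move=> [c0 c1 c2 _ _]; rewrite /lin3; conts. Qed.

Lemma lin2_cont a b P : psol a b P -> continuous (lin2 P).
Proof.
move=> [c0 c1 c2 _ _]; have cp : continuous (prim (pos P)) by exact: prim_cont.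
by rewrite /lin2; conts.
Qed.

Lemma isD_lin2 a b P s : psol a b P -> a < s < b -> is_derive s 1 (lin2 P) (lin3 P s).
Proof.
move=> [c0 c1 c2 D _] sab; have [D0 D1] := D s sab.
have Dp := prim_derive s c0; rewrite /lin2 /lin3.
ders; ring.
Qed.

(** This function has the singular term as its derivative away from the zeros, and is
    monotone between zeros, although the singular term may be unbounded. *)
Definition singular_part P s := - (acc P s + lin2 P s).

Lemma singular_part_cont a b P : psol a b P -> continuous (singular_part P).
Proof.
move=> S; have cl := lin2_cont S; case: S => c0 c1 c2 _ _.
by apply: cont_opp; exact: cont_add.
Qed.

Lemma isD_singular_part a b P s : psol a b P -> a < s < b -> pos P s != 0 ->
  is_derive s 1 (singular_part P) (nonlin n (pos P s)).
Proof.
move=> S sab ps; have Dl := isD_lin2 S sab; case: S => c0 c1 c2 _ D2.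
apply: (isD_eq (isD_opp (isD_add (D2 s sab ps) Dl))).
by move: (lin3 P s) (nonlin n _) => u v; ring.
Qed.

Lemma psol_dominates_sign a b P x y : psol a b P -> a <= x -> x <= y -> y <= b ->
  (forall t, x < t < y -> 0 < pos P t) \/ (forall t, x < t < y -> pos P t < 0) ->
  dominates (fun s => nonlin n (pos P s)) (singular_part P) x y.
Proof.
move=> S ax xy yb H; have cS := singular_part_cont S.
have c0 : continuous (pos P) by case: S.
have ne t : x < t < y -> pos P t != 0.
  by move=> txy; case: H => /(_ t txy) h; [rewrite gt_eqF|rewrite lt_eqF].
apply: dominates_sign => //.
  move=> t txy; split; last by apply: (isD_singular_part S); [lra|exact: ne].
  by apply: continuous_comp; [exact: c0|apply: g_cont; exact: ne].
case: H => H; [left|right] => t /H h; first by rewrite ltW // g_gt0.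
by rewrite -[pos P t]opprK gN oppr_le0 ltW // g_gt0 // oppr_gt0.
Qed.

Lemma sign_near P s : continuous (pos P) -> pos P s != 0 -> exists2 d, 0 < d &
  (forall t, `|t - s| < d -> 0 < pos P t) \/ (forall t, `|t - s| < d -> pos P t < 0).
Proof.
move=> c0; rewrite neq_lt => /orP[h|h].
  have [d d0 H] := @cont_pos_near _ (fun t => - pos P t) s (cont_opp c0) ltac:(by rewrite oppr_gt0).
  by exists d => //; right => t /H; rewrite oppr_gt0.
by have [d d0 H] := cont_pos_near c0 h; exists d => //; left.
Qed.

(** Hence transversal zeros are isolated, and the singular term has a constant sign on each
    side. *)
Lemma transversal_near a b P s : psol a b P -> pos P s = 0 -> vel P s != 0 ->
  exists2 d, 0 < d &
  (forall t, a <= t -> t <= b -> s - d < t -> t < s -> a <= s <= b -> pos P t < 0) /\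
  (forall t, a <= t -> t <= b -> s < t -> t < s + d -> a <= s <= b -> 0 < pos P t) \/
  (forall t, a <= t -> t <= b -> s - d < t -> t < s -> a <= s <= b -> 0 < pos P t) /\
  (forall t, a <= t -> t <= b -> s < t -> t < s + d -> a <= s <= b -> pos P t < 0).
Proof.
move=> [c0 c1 c2 D _] p0 v0.
have [d d0 H] := @sign_near (Jet (vel P) id id) s c1 v0.
exists d => //; case: H => /= H; [left|right]; split => t at_ tb st ts sab; rewrite -p0.
- apply: mvt_lt => // z zts; exists (vel P z); first by apply: (D z _).1; lra.
  by apply: H; rewrite ltr_norml; lra.
- apply: mvt_lt => // z zts; exists (vel P z); first by apply: (D z _).1; lra.
  by apply: H; rewrite ltr_norml; lra.
- rewrite -ltrN2; apply: (@mvt_lt _ (fun z => - pos P z)) => //; first exact: cont_opp.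
  move=> z zts; exists (- vel P z); first by apply: isD_opp; apply: (D z _).1; lra.
  by rewrite oppr_gt0; apply: H; rewrite ltr_norml; lra.
- rewrite -ltrN2; apply: (@mvt_lt _ (fun z => - pos P z)) => //; first exact: cont_opp.
  move=> z zts; exists (- vel P z); first by apply: isD_opp; apply: (D z _).1; lra.
  by rewrite oppr_gt0; apply: H; rewrite ltr_norml; lra.
Qed.

(** A compact interval is covered by pieces on which the solution has a constant sign. *)
Lemma psol_dominates a b P : a <= b -> psol a b P ->
  (forall s, a <= s <= b -> transversal P s) ->
  dominates (fun s => nonlin n (pos P s)) (singular_part P) a b.
Proof.
move=> ab S tr; have c0 : continuous (pos P) by case: S.
apply: local_to_global => // [x y z ax xy yz zb|s sab]; first exact: dominates_cat.
have [p0|p0] := eqVneq (pos P s) 0; last first.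
  have [d d0 H] := sign_near c0 p0; exists d => // y z ay ys sz zb yd zd.
  apply: (psol_dominates_sign S) => //; first lra.
  by case: H => H; [left|right] => t tyz; apply: H; rewrite ltr_norml; lra.
have [d d0 H] := transversal_near S p0 (tr s sab p0).
exists d => // y z ay ys sz zb yd zd; apply: (dominates_cat ys sz).
  apply: (psol_dominates_sign S) => //; first lra.
  by case: H => -[H _]; [right|left] => t tys; apply: H; lra.
apply: (psol_dominates_sign S) => //; first lra.
by case: H => -[_ H]; [left|right] => t tys; apply: H; lra.
Qed.

Lemma psol_ac a b P : a <= b -> psol a b P ->
  (forall s, a <= s <= b -> transversal P s) -> AC a b (acc P).
Proof.
move=> ab S tr.
have [M M0 HM] := @cont_bounded _ (lin3 P) a b (lin3_cont S).
have -> : acc P = (fun s => - singular_part P s + - lin2 P s).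
  by apply/funext => s; rewrite /singular_part; ring.
apply: ac_add.
  have A : AC a b (singular_part P).
    apply: (dominates_ac ab) => x y ax xy yb; apply: (psol_dominates xy).
      exact: psol_sub S.
    by move=> s sxy; apply: tr; lra.
  move=> e e0; have [d d0 H] := A e e0; exists d => // k x y h1 h2 h3.
  by under eq_bigr do rewrite -opprD normrN; exact: H.
have M1 : 0 < M + 1 by lra.
apply: (ac_lip M1) => x y ax xy yb.
apply: (@mvt_bound _ (fun z => - lin2 P z)) => //; first by apply: cont_opp; exact: lin2_cont S.
move=> z zxy; exists (- lin3 P z); first by apply: isD_opp; apply: (isD_lin2 S); lra.
by rewrite normrN; have := HM z ltac:(lra); lra.
Qed.

Lemma finite_zeros a b P : a <= b -> psol a b P ->
  (forall s, a <= s <= b -> transversal P s) ->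
  finite_set [set s | a <= s <= b /\ pos P s = 0].
Proof.
move=> ab S tr; have c0 : continuous (pos P) by case: S.
apply: (@local_to_global _ (fun x y => finite_set [set s | x <= s <= y /\ pos P s = 0])) => //.
  move=> x y z ax xy yz zb h1 h2; have h3 : finite_set ([set s | x <= s <= y /\ pos P s = 0] `|` [set s | y <= s <= z /\ pos P s = 0]).
    by rewrite finite_setU.
  apply: sub_finite_set h3.
  by move=> s [sxz p0]; have [sy|sy] := leP s y; [left|right]; split => //; lra.
move=> s sab; have [p0|p0] := eqVneq (pos P s) 0.
  have [d d0 H] := transversal_near S p0 (tr s sab p0).
  exists d => // y z ay ys sz zb yd zd; apply: sub_finite_set (finite_set1 s).
  move=> t [tyz pt]; apply/eqP; rewrite eq_le !leNgt; apply/andP; split; apply/negP => h.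
    by case: H => -[_ H]; have := H t ltac:(lra) ltac:(lra) h ltac:(lra) sab; rewrite pt ltxx.
  by case: H => -[H _]; have := H t ltac:(lra) ltac:(lra) ltac:(lra) h sab; rewrite pt ltxx.
have [d d0 H] := sign_near c0 p0; exists d => // y z ay ys sz zb yd zd.
apply: sub_finite_set (@finite_set0 R) => t [tyz pt].
by case: H => H; have := H t ltac:(rewrite ltr_norml; lra); rewrite pt ltxx.
Qed.

(** The exceptional points are the zeros and the end point of the half-line; the former are
    finitely many on every bounded interval because they are transversal. *)
Lemma solution_of_psol (I : set R) P :
  (forall s, is_derive s 1 (pos P) (vel P s)) -> (forall s, is_derive s 1 (vel P) (acc P s)) ->
  continuous (acc P) -> (forall s, I s -> transversal P s) ->
  (forall a b, a <= b -> `[a, b] `<=` I -> psol a b P) ->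
  (forall k : nat, exists a b, [/\ a <= b, `[a, b] `<=` I &
     forall s, I s -> `|s| < k%:R -> a <= s <= b]) ->
  (forall s, I s -> s != 0 -> exists a b, a < s < b /\ `[a, b] `<=` I) ->
  solution n I (pos P).
Proof.
move=> D0 D1 c2 tr S cov int.
have E1 : derive1n 1 (pos P) = vel P.
  by apply/funext => s /=; rewrite derive1E; exact: derive_val.
have E2 : derive1n 2 (pos P) = acc P.
  by rewrite /= -[X in derive1 X]/(derive1n 1 (pos P)) E1; apply/funext => s; rewrite derive1E; exact: derive_val.
have trI a b : `[a, b] `<=` I -> forall s, a <= s <= b -> transversal P s.
  by move=> sub s sab; apply: tr; apply: sub; rewrite /= in_itv.
split.
- split; first by move=> s; have [] := D0 s.
  + by rewrite E1 => s; have [] := D1 s.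
  + by rewrite E2.
- move=> a b ab sub; rewrite E2; apply: (psol_ac ab (S a b ab sub)); exact: trI.
- move=> a b ab sub; exact: dominates_integrable (psol_dominates ab (S a b ab sub) (trI a b sub)).
pose Z := [set 0] `|` \bigcup_k [set s | [/\ I s, `|s| < k%:R & pos P s = 0]].
have Z0 : leb.-negligible Z.
  have fin (A : set R) : finite_set A -> leb.-negligible A.
    move=> fA; have cA := finite_set_countable fA.
    apply/negligibleP; last exact: countable_lebesgue_measure0.
    exact: countable_measurable.
  apply: negligibleU; first exact: fin.
  apply: negligible_bigcup => k; apply: fin.
  have [a [b [ab sub H]]] := cov k.
  apply: sub_finite_set (finite_zeros ab (S a b ab sub) (trI a b sub)).
  by move=> s [Is sk p0]; split => //; exact: H.
apply: negligibleS Z0 => s nh; apply: contrapT => nZ; apply: nh => Is.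
have s0 : s != 0 by apply/eqP => s0; apply: nZ; left.
have ps : pos P s != 0.
  apply/eqP => p0; apply: nZ; right; exists (Num.truncn `|s|).+1 => //=.
  by split => //; exact: truncnS_gt.
have [a [b [sab sub]]] := int s Is s0.
have [_ _ _ _ D2] := S a b ltac:(lra) sub.
have D := D2 s sab ps; split; first by rewrite E2; case: D.
rewrite /ode -/mu.
have -> : derive1n 3 (pos P) s = - (lin3 P s + nonlin n (pos P s)).
  by rewrite /= -[X in derive1 X]/(derive1n 2 (pos P)) E2 derive1E; exact: derive_val.
rewrite E1 E2 /lin3; move: (nonlin n _) => w; ring.
Qed.

End Solutions.

Section FromSolutions.
Context {R : realType} (n : R).
Implicit Types (P Q : jet R) (phi psi : R -> R) (a b c d e s t x y z T : R).
Local Notation mu := (exponent n).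
Local Notation leb := (@lebesgue_measure R).

Definition jet_of phi := Jet phi (derive1n 1 phi) (derive1n 2 phi).

(** Near a nonzero value the third derivative is almost everywhere equal to a continuous
    function, so the absolutely continuous second derivative is its primitive. *)
Lemma psol_of_solution a b psi : solution n `[a, b] psi -> psol n a b (jet_of psi).
Proof.
move=> [[d0 d1 c2] ac int ae].
have D0 s : is_derive s 1 psi (derive1n 1 psi s).
  by apply: DeriveDef; [exact: d0|rewrite /= derive1E].
have D1 s : is_derive s 1 (derive1n 1 psi) (derive1n 2 psi s).
  by apply: DeriveDef; [exact: d1|rewrite [RHS]/= derive1E].
have c0 : continuous psi by move=> s; apply: isD_cont (D0 s).
have c1 : continuous (derive1n 1 psi) by move=> s; apply: isD_cont (D1 s).
split => //= s sab ps.
have [d dgt0 H] := @sign_near _ (jet_of psi) s c0 ps.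
have ne t : `|t - s| < d -> psi t != 0.
  by case: H => H /H /= h; [rewrite gt_eqF|rewrite lt_eqF].
have [r [r0 rd ra rb]] : exists r, [/\ 0 < r, r < d, a < s - r & s + r < b].
  pose m := Num.min d (Num.min (s - a) (b - s)).
  have m0 : 0 < m by rewrite !lt_min dgt0; lra.
  have m1 : m <= d by rewrite ge_min lexx.
  have m2 : m <= s - a by rewrite !ge_min lexx !orbT.
  have m3 : m <= b - s by rewrite !ge_min lexx !orbT.
  by clearbody m; exists (m / 2); split; lra.
pose P := jet_of psi.
pose k t := - (lin3 n P (clamp (s - r) (s + r) t) + nonlin n (psi (clamp (s - r) (s + r) t))).
have cc := @clamp_cont R (s - r) (s + r).
have ck : continuous k.
  apply: cont_opp; apply: cont_add; last first.
    move=> t; apply: continuous_comp; last first.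
      apply: g_cont; apply: ne; have := @clamp_itv R (s - r) (s + r) t ltac:(lra).
      by rewrite ltr_norml; lra.
    by apply: (cont_comp c0 cc).
  apply: (@cont_comp _ (lin3 n P)) => //.
  rewrite /lin3 /P /=; apply: cont_add; last by apply: cont_mul => //; exact: cont_cst.
  by apply: cont_add; (apply: cont_mul => //; exact: cont_cst).
have kE t : s - r <= t <= s + r -> k t = - (lin3 n P t + nonlin n (psi t)).
  by move=> tsr; rewrite /k clamp_id.
have ab : a <= b by lra.
have A := ac a b ab (fun _ h => h).
have Hd : {ae leb, forall t, s - r <= t <= s + r -> is_derive t 1 (derive1n 2 psi) (k t)}.
  have [Z [mZ Z0 HZ]] := ae; exists Z; split => // t nt; apply: HZ => Ht; apply: nt => tsr.
  have [] := Ht ltac:(by rewrite /= in_itv /=; lra) => dt o.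
  apply: DeriveDef => //; rewrite kE //.
  have <- : derive1n 3 psi t = 'D_1 (derive1n 2 psi) t by rewrite [LHS]/= derive1E.
  move: o; rewrite /ode -/mu /lin3 /P /jet_of /pos /vel /acc.
  move: (derive1n 3 psi t) (derive1n 2 psi t) (derive1n 1 psi t) (psi t) (nonlin _ _); clear; move=> u3 u2 u1 u0 g o.
  by apply: subr0_eq; rewrite -[RHS]o; move: mu => m; ring.
have E t : s - r <= t <= s + r ->
    derive1n 2 psi t = prim k t + (derive1n 2 psi (s - r) - prim k (s - r)).
  move=> tsr; have [st _] := andP tsr.
  have A' := ac_sub (ltW ra) (_ : t <= b) A.
  have := @ac_primitive _ (s - r) t (derive1n 2 psi) k st (A' ltac:(lra)) ck.
  have Ha : {ae leb, forall z, s - r <= z <= t -> is_derive z 1 (derive1n 2 psi) (k z)}.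
    have [Z [mZ Z0 HZ]] := Hd; exists Z; split => // z nz; apply: HZ => Hz; apply: nz => zz.
    by apply: Hz; lra.
  move=> /(_ Ha).
  by move: (derive1n 2 psi t) (derive1n 2 psi (s - r)) (prim k t) (prim k _); clear; move=> *; lra.
rewrite -kE; last lra.
apply: (@isD_near _ (fun t => prim k t + (derive1n 2 psi (s - r) - prim k (s - r)))).
  by exists r => // t; rewrite ltr_norml => tt; symmetry; apply: E; lra.
by apply: (isD_eq (isD_add (prim_derive s ck) (isD_cst _ s))); rewrite addr0.
Qed.

End FromSolutions.

(** * Change of variables *)

Section StateConversions.
Context {R : realType} (n : R).
Implicit Types (F P : jet R) (w p v a x s y al be : R).
Local Notation mu := (exponent n).

(** With [f(y) = y^mu phi(ln y)], the maps [T] give the derivatives of [phi] at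
    [ln w] from those of [f] at [w], and the maps [S] are their inverses. *)
Definition T0 w x := w `^ (- mu) * x.
Definition T1 w x v := w `^ (1 - mu) * v - mu * T0 w x.
Definition T2 w x v a := w `^ (2 - mu) * a - (2 * mu - 1) * T1 w x v - mu * (mu - 1) * T0 w x.

Definition S0 w p := w `^ mu * p.
Definition S1 w p v := w `^ (mu - 1) * (v + mu * p).
Definition S2 w p v a := w `^ (mu - 2) * (a + (2 * mu - 1) * v + mu * (mu - 1) * p).

Lemma powR_opp w p q : 0 < w -> q = - p -> w `^ p * w `^ q = 1.
Proof. by move=> w0 ->; rewrite -powR_split // subrr powRr0. Qed.

Lemma S0K w p : 0 < w -> T0 w (S0 w p) = p.
Proof. by move=> w0; rewrite /T0 /S0 mulrA powR_opp ?mul1r //; ring. Qed.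

Lemma S1K w p v : 0 < w -> T1 w (S0 w p) (S1 w p v) = v.
Proof.
by move=> w0; rewrite /T1 S0K // /S1 mulrA powR_opp ?mul1r //; [ring|move: mu => m; ring].
Qed.

Lemma S2K w p v a : 0 < w -> T2 w (S0 w p) (S1 w p v) (S2 w p v a) = a.
Proof.
by move=> w0; rewrite /T2 S0K // S1K // /S2 mulrA powR_opp ?mul1r //; [ring|move: mu => m; ring].
Qed.

Lemma T0K w x : 0 < w -> S0 w (T0 w x) = x.
Proof. by move=> w0; rewrite /T0 /S0 mulrA powR_opp ?mul1r //; ring. Qed.

Lemma T1K w x v : 0 < w -> S1 w (T0 w x) (T1 w x v) = v.
Proof.
move=> w0; rewrite /S1 /T1 subrK mulrA powR_opp ?mul1r //; move: mu => m; ring.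
Qed.

Lemma T2K w x v a : 0 < w -> S2 w (T0 w x) (T1 w x v) (T2 w x v a) = a.
Proof.
move=> w0; rewrite /S2 /T2; move: (T1 w x v) (T0 w x) => r t.
have -> : w `^ (2 - mu) * a - (2 * mu - 1) * r - mu * (mu - 1) * t + (2 * mu - 1) * r +
  mu * (mu - 1) * t = w `^ (2 - mu) * a by ring.
rewrite mulrA powR_opp ?mul1r //; move: mu => m; ring.
Qed.

Definition pjet F := Jet (fun s => T0 (expR s) (pos F (expR s)))
  (fun s => T1 (expR s) (pos F (expR s)) (vel F (expR s)))
  (fun s => T2 (expR s) (pos F (expR s)) (vel F (expR s)) (acc F (expR s))).

Definition fjet P := Jet
  (fun y => S0 (Num.max y 1) (pos P (ln (Num.max y 1))))
  (fun y => S1 (Num.max y 1) (pos P (ln (Num.max y 1))) (vel P (ln (Num.max y 1))))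
  (fun y => S2 (Num.max y 1) (pos P (ln (Num.max y 1))) (vel P (ln (Num.max y 1)))
     (acc P (ln (Num.max y 1)))).

Lemma expR_powR p s : expR s `^ p = expR (p * s).
Proof. by rewrite /powR gt_eqF ?expR_gt0 // expRK. Qed.

Lemma nonlin_T0 w x (n_gt0 : 0 < n) : 0 < w ->
  nonlin n (T0 w x) = w `^ (3 - mu) * nonlin n x.
Proof.
move=> w0; have := @nonlin_scale _ n 1 w^-1 x n_gt0 (normr1 _) ltac:(by rewrite invr_gt0).
rewrite !mul1r /T0.
have inv p : w^-1 `^ p = w `^ (- p) by rewrite -powR_inv1 ?(ltW w0) // -powRrM mulN1r.
by rewrite !inv => ->; congr (_ `^ _ * _); ring.
Qed.

Lemma psol_pjet F x y al be (n_gt0 : 0 < n) : jsol n 1 x y F ->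
  (forall s, al < s < be -> x < expR s < y) -> psol n al be (pjet F).
Proof.
move=> [c0 c1 c2 D D2] H.
have ce : continuous (@expR R) by exact: continuous_expR.
have cp p : continuous (fun s : R => expR s `^ p).
  have -> : (fun s : R => expR s `^ p) = (fun s => expR (p * s)).
    by apply/funext => s; exact: expR_powR.
  by conts.
have g0 : continuous (fun s => pos F (expR s)) by exact: cont_comp.
have g1 : continuous (fun s => vel F (expR s)) by exact: cont_comp.
have g2 : continuous (fun s => acc F (expR s)) by exact: cont_comp.
have cq := cp (- mu); have cr := cp (1 - mu); have cs := cp (2 - mu).
have h0 : continuous (pos (pjet F)) by rewrite /pjet /= /T0; apply: cont_mul.
have h1 : continuous (vel (pjet F)).
  rewrite /pjet /= /T1; apply: cont_add; first exact: cont_mul.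
  by apply: cont_opp; apply: cont_mul; [exact: cont_cst|exact: h0].
have h2 : continuous (acc (pjet F)).
  rewrite /pjet /= /T2; apply: cont_add; first apply: cont_add; first exact: cont_mul.
    by apply: cont_opp; apply: cont_mul; [exact: cont_cst|exact: h1].
  by apply: cont_opp; apply: cont_mul; [exact: cont_cst|exact: h0].
have Dp p s : is_derive s 1 (fun s : R => expR s `^ p) (p * expR s `^ p).
  have -> : (fun s : R => expR s `^ p) = (fun s => expR (p * s)).
    by apply/funext => t; exact: expR_powR.
  by rewrite expR_powR; ders; ring.
have De (f : R -> R) (d s : R) : is_derive (expR s) 1 f d -> is_derive s 1 (fun s => f (expR s)) (d * expR s).
  by move=> fd; apply: (isD_comp fd); exact: is_derive_expR.
have pS p s : expR s `^ (p + 1) = expR s * expR s `^ p.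
  by rewrite powR_split ?expR_gt0 // powRr1 ?expR_ge0 // mulrC.
have D0 s : al < s < be -> is_derive s 1 (pos (pjet F)) (vel (pjet F) s).
  move=> ss; have [Da Db] := D _ (H s ss).
  apply: (isD_eq (isD_mul (Dp (- mu) s) (De _ _ _ Da))).
  by rewrite /pjet /= /T1 /T0 (_ : 1 - mu = - mu + 1) ?pS; ring.
have D1 s : al < s < be -> is_derive s 1 (vel (pjet F)) (acc (pjet F) s).
  move=> ss; have [Da Db] := D _ (H s ss).
  apply: (isD_eq (isD_sub (isD_mul (Dp (1 - mu) s) (De _ _ _ Db))
    (isD_mul (isD_cst mu s) (D0 s ss)))).
  rewrite /pjet /= /T2 /T1 /T0 (_ : 2 - mu = 1 - mu + 1); last by ring.
  by rewrite pS; ring.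
split => //.
  by move=> s ss; split; [exact: D0|exact: D1].
move=> s ss ps; have [Da Db] := D _ (H s ss).
have e0 : 0 < expR s :> R by exact: expR_gt0.
have ps' : pos F (expR s) != 0.
  by apply: contra_neq ps => p0; rewrite /pjet /= /T0 p0 mulr0.
have Dc := D2 _ (H s ss) ps'.
apply: (isD_eq (isD_sub (isD_sub (isD_mul (Dp (2 - mu) s) (De _ _ _ Dc))
    (isD_mul (isD_cst (2 * mu - 1) s) (D1 s ss)))
    (isD_mul (isD_cst (mu * (mu - 1)) s) (D0 s ss)))).
rewrite /pjet /lin3 /pos /vel /acc -/(pos F) -/(vel F) -/(acc F) nonlin_T0 //.
rewrite (_ : 3 - mu = 2 - mu + 1); last by ring.
rewrite pS /T2; move: (expR s) (expR s `^ _) (acc F _) (nonlin _ _) (T0 _ _) (T1 _ _ _).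
by move: mu => m *; ring.
Qed.

Lemma jsol_fjet P x y al be (n_gt0 : 0 < n) : psol n x y P -> 1 <= al ->
  (forall w, al < w < be -> x < ln w < y) -> jsol n 1 al be (fjet P).
Proof.
move=> [c0 c1 c2 D D2] al1 H.
have mx w : 0 < Num.max w 1 :> R by rewrite lt_max ltr01 orbT.
have cm : continuous (fun w : R => Num.max w 1) by exact: cont_max.
have cln : continuous (fun w : R => ln (Num.max w 1)).
  by move=> w; apply: continuous_comp; [exact: cm|apply: continuous_ln].
have cp p : continuous (fun w : R => Num.max w 1 `^ p).
  move=> w; apply: (@continuous_comp _ _ _ (fun w : R => Num.max w 1) (fun u => u `^ p)).
    exact: cm.
  by apply: isD_cont; apply: is_derive1_powR.
have g0 : continuous (fun s => pos P (ln (Num.max s 1))) by exact: cont_comp cln.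
have g1 : continuous (fun s => vel P (ln (Num.max s 1))) by exact: cont_comp cln.
have g2 : continuous (fun s => acc P (ln (Num.max s 1))) by exact: cont_comp cln.
have cq := cp mu; have cr := cp (mu - 1); have cs := cp (mu - 2).
have E w : al < w < be -> Num.max w 1 = w.
  by move=> ww; apply/max_idPl; lra.
have near_id (f g : R -> R) w d : al < w < be -> (forall w, al < w < be -> f w = g w) ->
    is_derive w 1 f d -> is_derive w 1 g d.
  move=> ww fg; apply: isD_near; exists (Num.min (w - al) (be - w)).
    by rewrite lt_min; lra.
  by move=> z; rewrite lt_min !ltr_norml => zw; apply: fg; lra.
have Dl (f : R -> R) (d w : R) : al < w < be -> is_derive (ln w) 1 f d -> is_derive w 1 (fun w => f (ln w)) (d / w).
  move=> ww fd; apply: (@isD_comp _ f (@ln R) w _ _ fd).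
  by apply: is_derive1_ln; lra.
have Dp p w : al < w < be -> is_derive w 1 (fun w => w `^ p) (p * w `^ (p - 1)).
  by move=> ww; apply: is_derive1_powR; lra.
have w0 w : al < w < be -> 0 < w by lra.
have p1 p w : al < w < be -> w `^ p / w = w `^ (p - 1) by move=> ww; rewrite powR_sub1 //; exact: (w0 w).
split; rewrite /fjet /=.
- by rewrite /S0; apply: cont_mul.
- rewrite /S1; apply: cont_mul => //; apply: cont_add => //.
  by apply: cont_mul => //; exact: cont_cst.
- rewrite /S2; apply: cont_mul => //; apply: cont_add.
    by apply: cont_add => //; apply: cont_mul => //; exact: cont_cst.
  by apply: cont_mul => //; exact: cont_cst.
- move=> w ww; have [Da Db] := D _ (H w ww); rewrite E //; split.
    apply: (near_id (fun w => w `^ mu * pos P (ln w))) => //.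
      by move=> z zz; rewrite E.
    apply: (isD_eq (isD_mul (Dp mu w ww) (Dl _ _ _ ww Da))).
    by rewrite mulrCA [vel P _ * _]mulrC mulrA p1 // /S1; ring.
  apply: (near_id (fun w => w `^ (mu - 1) * (vel P (ln w) + mu * pos P (ln w)))) => //.
    by move=> z zz; rewrite E.
  apply: (isD_eq (isD_mul (Dp (mu - 1) w ww) (isD_add (Dl _ _ _ ww Db)
    (isD_mul (isD_cst mu w) (Dl _ _ _ ww Da))))).
  rewrite /S2 (_ : mu - 2 = mu - 1 - 1); last by ring.
  by rewrite -(p1 (mu - 1)) //; ring.
move=> w ww; rewrite E // => fw; have [Da Db] := D _ (H w ww).
have pw : pos P (ln w) != 0 by apply: contra_neq fw => p0; rewrite /S0 p0 mulr0.
have Dc := D2 _ (H w ww) pw.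
apply: (near_id (fun w => w `^ (mu - 2) * (acc P (ln w) + (2 * mu - 1) * vel P (ln w)
  + mu * (mu - 1) * pos P (ln w)))) => //.
  by move=> z zz; rewrite E.
apply: (isD_eq (isD_mul (Dp (mu - 2) w ww) (isD_add (isD_add (Dl _ _ _ ww Dc)
  (isD_mul (isD_cst (2 * mu - 1) w) (Dl _ _ _ ww Db)))
  (isD_mul (isD_cst (mu * (mu - 1)) w) (Dl _ _ _ ww Da))))).
have := @nonlin_scale _ n 1 w (pos P (ln w)) n_gt0 (normr1 _) (w0 w ww).
rewrite !mul1r /S0 => ->; rewrite (_ : mu - 3 = mu - 2 - 1); last by ring.
rewrite -(p1 (mu - 2)) // /lin3.
move: (w^-1) (w `^ _) (pos P _) (vel P _) (acc P _) (nonlin _ _).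
by move: mu => m *; ring.
Qed.

End StateConversions.

(** * Uniqueness *)

Section Uniqueness.
Context {R : realType} (n : R).
Implicit Types (F G P Q : jet R) (a b d e s x y u v T : R).
Local Notation mu := (exponent n).

Definition same F G y := jinit F y (pos G y) (vel G y) (acc G y).

Lemma jaff_unit e s F y : [/\ pos (jaff n e 1 1 s F) y = e * pos F (y - s),
  vel (jaff n e 1 1 s F) y = e * vel F (y - s) & acc (jaff n e 1 1 s F) y = e * acc F (y - s)].
Proof. by rewrite /jaff /= !powR1 !mulr1 mul1r divr1. Qed.

Lemma rising_pos F b : 0 < b -> continuous (pos F) -> continuous (vel F) ->
  (forall y, 0 < y < b -> is_derive y 1 (pos F) (vel F y)) -> rising F 0 ->
  exists2 d, 0 < d <= b & forall y, 0 < y < d -> 0 < pos F y.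
Proof.
move=> b0 c0 c1 D [p0|[p0 v0]].
  have [d d0 H] := cont_pos_near c0 p0; exists (Num.min d b).
    by rewrite lt_min d0 b0 ge_min lexx orbT.
  by move=> y; rewrite lt_min => /and3P[y0 yd _]; apply: H; rewrite subr0 gtr0_norm.
have [d d0 H] := cont_pos_near c1 v0; exists (Num.min d b).
  by rewrite lt_min d0 b0 ge_min lexx orbT.
move=> y; rewrite lt_min => /and3P[y0 yd yb]; rewrite -p0; apply: mvt_lt => // z zy.
exists (vel F z); first by apply: D; lra.
by apply: H; rewrite subr0 gtr0_norm; lra.
Qed.

(** Agreement propagates along the interval: at each point, up to a change of sign, the
    transversal solution is rising, and [uniq_forward] applies just after it. *)
Lemma jsol_uniq F G a b (n_gt0 : 0 < n) (n_lt2 : n < 2) : a <= b ->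
  jsol n 1 a b F -> jsol n 1 a b G -> (forall y, a <= y <= b -> transversal F y) ->
  same G F a -> forall y, a <= y <= b -> same G F y.
Proof.
move=> ab sF sG tr Ea.
have [c0 c1 c2 D D2] := sF; have [g0 g1 g2 _ _] := sG.
apply: real_ind => // [x xab H|x xab H]; last first.
  have ax : a < x by lra.
  by split; apply: (cont_eq_left ax) => // y yax; have [] := H y yax.
have [E0 E1 E2] := H x ltac:(lra).
have [e [e1 st]] : exists e : R, `|e| = 1 /\ rising (jaff n e 1 1 (- x) F) 0.
  have [q0 q1 _] : [/\ pos F (0 - - x) = pos F x, vel F (0 - - x) = vel F x & True].
    by rewrite sub0r opprK.
  have [p|p|p] := ltgtP (pos F x) 0.
  - exists (-1); split; first by rewrite normrN normr1.
    by left; have [-> _ _] := jaff_unit (-1) (- x) F 0; rewrite q0 mulN1r oppr_gt0.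
  - exists 1; split; first exact: normr1.
    by left; have [-> _ _] := jaff_unit 1 (- x) F 0; rewrite q0 mul1r.
  - have : vel F x != 0 by apply: tr => //; lra.
    rewrite neq_lt => /orP[v|v].
      exists (-1); split; first by rewrite normrN normr1.
      right; have [-> -> _] := jaff_unit (-1) (- x) F 0.
      by rewrite q0 q1 p mulr0 mulN1r oppr_gt0.
    exists 1; split; first exact: normr1.
    by right; have [-> -> _] := jaff_unit 1 (- x) F 0; rewrite q0 q1 p mulr0 mul1r.
have bx : 0 < b - x by lra.
have aff K : jsol n 1 a b K -> jsol n 1 0 (b - x) (jaff n e 1 1 (- x) K).
  move=> sK; rewrite -[X in jsol n X](mulr1 1).
  apply: (@jsol_aff _ n 1 e 1 1 (- x) a b 0 (b - x)) => //; first by rewrite mulr1.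
  by move=> y yb; rewrite mul1r divr1 opprK; lra.
have sF' := aff F sF; have sG' := aff G sG.
have [k0 k1 _ K _] := sF'.
have [d dd Hp] := rising_pos bx k0 k1 (fun y yb => (K y yb).1) st.
have [d0 db] := andP dd.
have iG : jinit (jaff n e 1 1 (- x) G) 0 (pos (jaff n e 1 1 (- x) F) 0)
    (vel (jaff n e 1 1 (- x) F) 0) (acc (jaff n e 1 1 (- x) F) 0).
  have [-> -> ->] := jaff_unit e (- x) F 0; have [h1 h2 h3] := jaff_unit e (- x) G 0.
  by split; rewrite ?h1 ?h2 ?h3 sub0r opprK ?E0 ?E1 ?E2.
have sg1 : `|1| <= 1 :> R by rewrite normr1.
have U := @uniq_forward _ n 1 (jaff n e 1 1 (- x) F) (jaff n e 1 1 (- x) G) d n_gt0 n_lt2 sg1 d0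
  (jsol_sub (lexx 0) db sF') (jsol_sub (lexx 0) db sG') st Hp iG.
exists d => // y yx yb.
have e0 : e != 0 by rewrite -normr_eq0 e1 oner_neq0.
have [] := U (y - x) ltac:(lra).
have [-> -> ->] := jaff_unit e (- x) F (y - x); have [-> -> ->] := jaff_unit e (- x) G (y - x).
rewrite opprK subrK => /(mulfI e0) h0 /(mulfI e0) h1 /(mulfI e0) h2.
by split.
Qed.

Lemma psol_uniq P Q T (n_gt0 : 0 < n) (n_lt2 : n < 2) : 0 <= T ->
  psol n 0 T P -> psol n 0 T Q -> (forall s, 0 <= s <= T -> transversal P s) ->
  same Q P 0 -> forall s, 0 <= s <= T -> same Q P s.
Proof.
move=> T0 sP sQ tr [E0 E1 E2].
have eT : 1 <= expR T by rewrite -expR0 ler_expR.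
have lnw w : 1 < w < expR T -> 0 < ln w < T.
  move=> /andP[w1 wT]; rewrite -[X in X < _ < _]ln1 -[X in _ < _ < X]expRK.
  by rewrite !ltr_ln ?posrE ?expR_gt0 ?w1 ?wT //; apply: lt_trans w1.
have jP := jsol_fjet n_gt0 sP (lexx 1) lnw; have jQ := jsol_fjet n_gt0 sQ (lexx 1) lnw.
have m1 : Num.max 1 1 = 1 :> R by rewrite maxxx.
have trF y : 1 <= y <= expR T -> transversal (fjet n P) y.
  move=> yT p0 /=; have y1 : Num.max y 1 = y by apply/max_idPl; case/andP: yT.
  have y0 : 0 < y by lra.
  move: p0; rewrite /transversal /fjet /= y1 /S0 /S1 => /eqP.
  rewrite mulf_eq0 gt_eqF ?powR_gt0 //= => /eqP p0.
  rewrite p0 mulr0 addr0; apply: mulf_neq0; first by rewrite gt_eqF ?powR_gt0.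
  apply: tr => //.
  by rewrite -[X in _ <= _ <= X]expRK ler_ln ?posrE ?expR_gt0 // ln_ge0; lra.
have E : same (fjet n Q) (fjet n P) 1.
  by rewrite /same /fjet; split; rewrite /= m1 ln1 ?E0 ?E1 ?E2.
have h := jsol_uniq n_gt0 n_lt2 eT jP jQ trF E.
move=> s sT; have es : 1 <= expR s <= expR T.
  by rewrite -[X in X <= _ <= _]expR0 !ler_expR.
have [h0 h1 h2] := h _ es.
have y1 : Num.max (expR s) 1 = expR s by apply/max_idPl; case/andP: es.
rewrite /fjet /= y1 expRK in h0 h1 h2.
have e0 := expR_gt0 s.
have p0 : pos Q s = pos P s by rewrite -[LHS](S0K n _ e0) h0 S0K.
have p1 : vel Q s = vel P s by rewrite -[LHS](S1K n (pos Q s) _ e0) h1 h0 S1K.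
by split => //; rewrite -[LHS](S2K n (pos Q s) (vel Q s) _ e0) h2 h1 h0 S2K.
Qed.

End Uniqueness.

(** * Solutions starting near an arc *)

Section NearArc.
Context {R : realType} (n : R).
Implicit Types (F G : jet R) (a b d e s x y u v T Y : R).
Local Notation mu := (exponent n).

(** A zero start with arbitrary positive slope is rescaled to unit slope. *)
Lemma existence_rising x v a Y (n_gt0 : 0 < n) (n_lt2 : n < 2) :
  0 < x \/ (x = 0 /\ 0 < v) -> 0 <= v \/ a <= 0 -> 0 < Y ->
  exists F T, [/\ 0 < T <= Y, jsol n 1 0 T F, jinit F 0 x v a,
    forall y, 0 < y < T -> 0 < pos F y &
    pos F T = 0 \/ (T = Y /\ 0 < pos F T)].
Proof.
move=> [x0|[-> v0]] va Y0; first by apply: existence => //; left.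
have m1 := mu_gt1 n_gt0 n_lt2.
pose L := v `^ (mu - 1)^-1.
have L0 : 0 < L by exact: powR_gt0.
have Lv : L `^ (mu - 1) = v.
  by rewrite /L -powRrM mulVf ?powRr1 ?(ltW v0) // gt_eqF // subr_gt0.
clearbody L.
have [F [T [T0 sF [p0 v1 a0] Fp E]]] := @existence _ n 0 1 (a / L `^ (mu - 2)) (Y / L) n_gt0 n_lt2
  ltac:(by right) ltac:(by left; exact: ler01) ltac:(exact: divr_gt0).
exists (jaff n 1 1 L 0 F), (T * L).
have Ey y : 1 * (y - 0) / L = y / L by rewrite mul1r subr0.
have Lmu p : 0 < L `^ p by exact: powR_gt0.
split.
- by case/andP: T0 => T0 T1; rewrite mulr_gt0 //= -ler_pdivlMr.
- rewrite -[X in jsol n X](mulr1 1).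
  apply: (@jsol_aff _ n 1 1 1 L 0 0 T) => //; first by rewrite normr1.
    by rewrite mulr1.
  by move=> y /andP[y0 yT]; rewrite Ey divr_gt0 //= ltr_pdivrMr.
- split; rewrite /= Ey mul0r ?p0 ?v1 ?a0 ?mulr0 ?mul1r ?mulr1 //.
  by rewrite mulrC divfK // gt_eqF.
- move=> y /andP[y0 yT]; rewrite /= Ey mul1r mulr_gt0 //; apply: Fp.
  by rewrite divr_gt0 //= ltr_pdivrMr.
rewrite /= Ey mulfK ?gt_eqF //; case: E => [->|[-> h]]; first by left; rewrite mulr0.
by right; rewrite divfK ?gt_eqF //; split => //; rewrite mul1r mulr_gt0.
Qed.

(** The sign condition of [existence_rising] holds near an arc because the acceleration
    decreases along it: where the velocity is not positive, the acceleration is negative.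
    The solution cannot stay positive beyond the time allowed by [arc_dependence]. *)
Lemma landing_near a F T e (n_gt0 : 0 < n) (n_lt2 : n < 2) : is_arc n a F T -> 0 < e ->
  exists2 d, 0 < d & forall u x v b, 0 <= u <= T ->
    `|x - pos F u| < d -> `|v - vel F u| < d -> `|b - acc F u| < d ->
    0 < x \/ (x = 0 /\ 0 < v) ->
    exists G Y, [/\ 0 < Y, jsol n 1 0 Y G, jinit G 0 x v b,
       forall y, 0 < y < Y -> 0 < pos G y & [/\ pos G Y = 0, `|u + Y - T| < e,
       close e G Y F T & forall y, 0 <= y <= Y -> exists z,
         [/\ 0 <= z <= T, `|z - (u + y)| < e & close e G y F z]]].
Proof.
move=> A e0; have [d d0 H] := arc_dependence n_gt0 n_lt2 A e0.
have [T0 sF [p0 v0 a0] Fp pT] := A; have [c0 c1 c2 D _] := sF.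
have [m m0 Hm] : exists2 m, 0 < m & forall u, 0 <= u <= T -> m <= Num.max (vel F u) (- acc F u).
  apply: cont_min_pos; first by apply: cont_max2 => //; exact: cont_opp.
  move=> u uT; rewrite lt_max oppr_gt0; have [//|vu /=] := ltP 0 (vel F u).
  rewrite ltNge; apply/negP => au.
  have : vel F 0 <= vel F u.
    apply: mvt_le => //; first by case/andP: uT.
    move=> z zu; exists (acc F z); first by apply: (D z _).2; lra.
    by apply: le_trans au _; apply: (acc_nincr sF Fp); lra.
  by rewrite v0; lra.
exists (Num.min d m); first by rewrite lt_min d0.
move=> u x v b uT; rewrite !lt_min => /andP[x1 _] /andP[v1 v2] /andP[b1 b2] st.
have va : 0 <= v \/ b <= 0.
  have := Hm u uT; rewrite le_max => /orP[h|h]; [left|right].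
    by move: v2; rewrite ltr_norml; lra.
  by move: b2; rewrite ltr_norml; lra.
have Y0 : 0 < T + e + 1 by lra.
have [G [Y [YY sG iG Gp E]]] := existence_rising n_gt0 n_lt2 st va Y0.
have [Y00 Y1] := andP YY.
have sG' : jsol n 1 u (u + Y) (jshift (- u) G).
  by apply: jsol_shift; rewrite subrr [u + Y]addrC addrK.
have Gp' y : u < y < u + Y -> 0 < pos (jshift (- u) G) y.
  by move=> yu; apply: Gp; lra.
have [i0 i1 i2] := iG.
have Gu : 0 <= pos (jshift (- u) G) u.
  by rewrite /= subrr i0; case: st => [/ltW|[-> _]].
have cl : close d (jshift (- u) G) u F u by split; rewrite /= subrr ?i0 ?i1 ?i2.
have uY : u <= u + Y by rewrite lerDl ltW.
have [K1 K2 K3] := H u (jshift (- u) G) (u + Y) uT uY sG' Gp' Gu cl.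
have pY : pos G Y = 0.
  by case: E => [//|[YE _]]; move: K1 uT; rewrite YE; clear; lra.
have Yu : u + Y - u = Y by rewrite addrAC subrr add0r.
have [k1 k2] := K3 ltac:(by rewrite /= Yu) ltac:(by left; rewrite ltrDl).
exists G, Y; split => //; split => //.
  by move: k2; rewrite /close /= Yu.
move=> y yY; have [z [z1 z2 z3]] := K2 (u + y) ltac:(by rewrite lerDl lerD2l).
exists z; split => //; by move: z3; rewrite /close /= addrAC subrr add0r.
Qed.

Lemma lands_open a (n_gt0 : 0 < n) (n_lt2 : n < 2) : lands n a ->
  exists2 d, 0 < d & forall b, `|b - a| < d -> lands n b.
Proof.
move=> [F [T A]]; have [d d0 H] := landing_near n_gt0 n_lt2 A ltr01.
have [T0 sF [p0 v0 a0] Fp pT] := A.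
exists d => // b ba.
have [||||G [Y [Y0 sG iG Gp [pY _ _ _]]]] := H 0 0 1 b ltac:(by rewrite lexx ltW).
- by rewrite p0 subrr normr0.
- by rewrite v0 subrr normr0.
- by rewrite a0.
- by right.
by exists G, Y.
Qed.

End NearArc.

(** * Gluing solutions at zeros *)

Section Gluing.
Context {R : realType} (n : R).
Implicit Types (F G : jet R) (a b c d e x z : R).

(** The sum of the two truncated functions, corrected by the common value at the junction:
    this form is continuous without any matching condition. *)
Definition cglue c (f g : R -> R) x := f (Num.min x c) + (g (Num.max x c) - g c).

Definition glue c F G :=
  Jet (cglue c (pos F) (pos G)) (cglue c (vel F) (vel G)) (cglue c (acc F) (acc G)).

Lemma cglue_le c (f g : R -> R) x : x <= c -> cglue c f g x = f x.
Proof. by move=> xc; rewrite /cglue min_l // max_r // subrr addr0. Qed.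

Lemma cglue_ge c (f g : R -> R) x : g c = f c -> c <= x -> cglue c f g x = g x.
Proof. by move=> fg xc; rewrite /cglue min_r // max_l // fg addrCA subrr addr0. Qed.

Lemma cglue_cont c (f g : R -> R) : continuous f -> continuous g -> continuous (cglue c f g).
Proof.
move=> cf cg; apply: cont_add; first by apply: (cont_comp cf); exact: cont_min.
by apply: cont_sub; [apply: (cont_comp cg); exact: cont_max|exact: cont_cst].
Qed.

Lemma glue_le c F G x : x <= c -> same (glue c F G) F x.
Proof. by move=> xc; split; exact: cglue_le. Qed.

Lemma glue_ge c F G x : same G F c -> c <= x -> same (glue c F G) G x.
Proof. by move=> [E0 E1 E2] xc; split; exact: cglue_ge. Qed.

(** At the junction the derivatives come from the continuity of the jet; the third
    derivative is prescribed only away from zeros. *)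
Lemma jsol_glue a b c F G : a < c -> c < b -> jsol n 1 a c F -> jsol n 1 c b G ->
  same G F c -> pos F c = 0 -> jsol n 1 a b (glue c F G).
Proof.
move=> ac cb [f0 f1 f2 Df Df2] [g0 g1 g2 Dg Dg2] [E0 E1 E2] pc.
have h0 := @cglue_cont c _ _ f0 g0; have h1 := @cglue_cont c _ _ f1 g1.
have h2 := @cglue_cont c _ _ f2 g2.
have left (f g : R -> R) x d : a < x < c -> is_derive x 1 f d -> is_derive x 1 (cglue c f g) d.
  move=> xac; apply: isD_near; exists (c - x); first lra.
  by move=> y; rewrite ltr_norml => yx; rewrite cglue_le //; lra.
have right (f g : R -> R) x d : c < x < b -> g c = f c -> is_derive x 1 g d ->
    is_derive x 1 (cglue c f g) d.
  move=> xcb E; apply: isD_near; exists (x - c); first lra.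
  by move=> y; rewrite ltr_norml => yx; rewrite cglue_ge //; lra.
pose r := Num.min (c - a) (b - c).
have r0 : 0 < r by rewrite lt_min; lra.
have ra : r <= c - a by rewrite ge_min lexx.
have rb : r <= b - c by rewrite ge_min lexx orbT.
clearbody r.
have mid (p0 p1 k0 k1 : R -> R) : continuous p0 -> continuous p1 -> continuous k0 ->
    continuous k1 -> k0 c = p0 c -> k1 c = p1 c ->
    (forall y, a < y < c -> is_derive y 1 p0 (p1 y)) ->
    (forall y, c < y < b -> is_derive y 1 k0 (k1 y)) ->
    forall x, a < x < b -> is_derive x 1 (cglue c p0 k0) (cglue c p1 k1 x).
  move=> cf0 cf1 ck0 ck1 e0 e1 D K.
  have ne x : a < x < b -> x != c -> is_derive x 1 (cglue c p0 k0) (cglue c p1 k1 x).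
    rewrite neq_lt => xab /orP[xc|xc].
      by rewrite cglue_le ?(ltW xc) //; apply: left; [|apply: D]; lra.
    by rewrite cglue_ge ?(ltW xc) //; apply: right => //; [|apply: K]; lra.
  move=> x xab; have [->|xc] := eqVneq x c; last exact: ne.
  apply: (@derive_glue _ _ (cglue c p1 k1) c r) => //; [exact: cglue_cont|exact: cglue_cont|].
  by move=> y; rewrite ltr_norml => yc ync; apply: ne => //; lra.
split => //.
  move=> x xab; split; apply: mid => //.
  - by move=> y ya; have [] := Df y ya.
  - by move=> y ya; have [] := Dg y ya.
  - by move=> y ya; have [] := Df y ya.
  - by move=> y ya; have [] := Dg y ya.
move=> x xab; rewrite /glue /=; have [xc|cx|->] := ltgtP x c.
- rewrite !cglue_le ?(ltW xc) // => p0; apply: left; first lra.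
  by apply: Df2 => //; lra.
- rewrite !cglue_ge ?(ltW cx) // => p0; apply: right => //; first lra.
  by apply: Dg2 => //; lra.
- by rewrite cglue_le // pc eqxx.
Qed.

Lemma same_trans F G (H : jet R) x : same F G x -> same G H x -> same F H x.
Proof.
move=> [e0 e1 e2] [h0 h1 h2].
by split; [exact: etrans e0 h0|exact: etrans e1 h1|exact: etrans e2 h2].
Qed.

Lemma same_sym F G x : same F G x -> same G F x.
Proof. by move=> [E0 E1 E2]; split. Qed.

(** The successive gluings agree where they are both defined, so at each point the value is
    that of any sufficiently late one. *)
Lemma jsol_glue_seq (J : nat -> jet R) (y : nat -> R) :
  (forall k, y k < y k.+1) -> (forall M, exists k, M < y k) ->
  (forall k, jsol n 1 (y k) (y k.+1) (J k)) ->
  (forall k, same (J k.+1) (J k) (y k.+1)) -> (forall k, pos (J k) (y k.+1) = 0) ->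
  exists F, (forall Y, jsol n 1 (y 0) Y F) /\
    forall k x, y k <= x <= y k.+1 -> same F (J k) x.
Proof.
move=> yS yoo sJ mJ pJ.
have yle i j : (i <= j)%N -> y i <= y j.
  move=> /subnK <-; elim: (j - i)%N => [|m IH] //; rewrite addSn.
  exact: le_trans IH (ltW (yS _)).
pose fix FK k := if k is k'.+1 then glue (y k) (FK k') (J k) else J 0%N.
have FKJ k : same (FK k) (J k) (y k.+1).
  elim: k => [|k IH]; first by split.
  exact: glue_ge (same_trans (mJ k) (same_sym IH)) (ltW (yS _)).
have FKS k x : x <= y k.+1 -> same (FK k.+1) (FK k) x by exact: glue_le.
have FKle i j x : (i <= j)%N -> x <= y i.+1 -> same (FK j) (FK i) x.
  move=> /subnK <- xi; elim: (j - i)%N => [|m IH]; first by split.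
  rewrite addSn; apply: same_trans IH; apply: FKS; apply: le_trans xi _.
  by apply: yle; rewrite ltnS leq_addl.
have FKarc i j x : (i <= j)%N -> y i <= x <= y i.+1 -> same (FK j) (J i) x.
  move=> ij /andP[x1 x2]; apply: same_trans (FKle i j x ij x2) _.
  case: i x1 {ij x2} => [|i] x1; first by split.
  exact: glue_ge (same_trans (mJ i) (same_sym (FKJ i))) x1.
have FKsol k : jsol n 1 (y 0%N) (y k.+1) (FK k).
  elim: k => [|k IH]; first exact: sJ.
  have y0k : y 0%N < y k.+1 by apply: lt_le_trans (yS 0%N) _; exact: yle.
  have pk : pos (FK k) (y k.+1) = 0 by have [-> _ _] := FKJ k.
  exact: jsol_glue y0k (yS _) IH (sJ _) (same_trans (mJ k) (same_sym (FKJ k))) pk.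
have [N HN] := choice yoo.
pose F := Jet (fun x => pos (FK (N x)) x) (fun x => vel (FK (N x)) x) (fun x => acc (FK (N x)) x).
have FE k x : x <= y k.+1 -> same F (FK k) x.
  move=> xk; have xN : x <= y (N x).+1 by apply: ltW; exact: lt_trans (HN x) (yS _).
  change (same (FK (N x)) (FK k) x).
  have [h|h] := leqP k (N x); first exact: FKle.
  by apply: same_sym; apply: FKle xN; exact: ltnW.
exists F; split; last first.
  by move=> k x xk; apply: same_trans (FE k x (andP xk).2) (FKarc k k x (leqnn k) xk).
have cnt (f : R -> R) (g : nat -> R -> R) : (forall k, continuous (g k)) ->
    (forall k x, x <= y k.+1 -> f x = g k x) -> continuous f.
  move=> cg fg x; have [k xk] := yoo (x + 1).
  apply/contP => e e0; have [d d0 H] := (contP (g k) x).1 (cg k x) e e0.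
  have yk := yS k.
  exists (Num.min d 1); first by rewrite lt_min d0 ltr01.
  move=> z; rewrite lt_min => /andP[zx z1]; rewrite !(fg k); first exact: H.
    lra.
  by move: z1; rewrite ltr_norml; lra.
move=> Y; split.
- apply: (cnt _ (fun k => pos (FK k))) => [k|k x /FE[]//]; by case: (FKsol k).
- apply: (cnt _ (fun k => vel (FK k))) => [k|k x /FE[]//]; by case: (FKsol k).
- apply: (cnt _ (fun k => acc (FK k))) => [k|k x /FE[]//]; by case: (FKsol k).
- move=> x xY; have [k xk] := yoo (x + 1); have yk := yS k.
  have [_ _ _ D _] := FKsol k; have [D0 D1] := D x ltac:(lra).
  have nr (f g : R -> R) d : (forall z, z <= y k.+1 -> f z = g z) ->
      is_derive x 1 g d -> is_derive x 1 f d.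
    move=> fg; apply: isD_near; exists 1 => // z; rewrite ltr_norml => zx.
    by rewrite fg //; lra.
  have [E0 E1 E2] := FE k x ltac:(lra).
  rewrite E1 E2; split.
    by apply: (nr _ _ _ _ D0) => z /FE[].
  by apply: (nr _ _ _ _ D1) => z /FE[].
move=> x xY; have [k xk] := yoo (x + 1); have yk := yS k.
have [_ _ _ _ D] := FKsol k; have [E0 E1 E2] := FE k x ltac:(lra).
rewrite E0 => p0; have D2 := D x ltac:(lra) p0.
apply: isD_near D2; exists 1 => // z; rewrite ltr_norml => zx.
by have [_ _ ->] := FE k z ltac:(lra).
Qed.

End Gluing.

(** * Trajectories *)

Section Trajectory.
Context {R : realType} (n : R).
Context (y0 l0 a0 e0 : R).
Implicit Types (F G : jet R) (a b c d e x z w : R) (k : nat).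
Local Notation mu := (exponent n).

Definition ak k := iter k (ret n) a0.
Fixpoint ell k := if k is k'.+1 then ell k' * expand n (ak k') else l0.
Fixpoint yk k := if k is k'.+1 then yk k' + ell k' * tau n (ak k') else y0.
Definition sgk k := e0 * (-1) ^+ k.
Definition arck k := jaff n (sgk k) 1 (ell k) (yk k) (arcF n (ak k)).

(** The position of the initial zero in the length scale of the arc. *)
Definition zk k := yk k / ell k.

Section Properties.
Context (n_gt0 : 0 < n) (n_lt2 : n < 2) (l0_gt0 : 0 < l0) (e01 : `|e0| = 1).
Context (la : forall k, lands n (ak k)).

Lemma sgk1 k : `|sgk k| = 1.
Proof. by rewrite /sgk normrM e01 normrX normrN normr1 expr1n mulr1. Qed.

Lemma sgkS k : sgk k.+1 = - sgk k.
Proof. by rewrite /sgk exprS mulN1r mulrN. Qed.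

Lemma ell_gt0 k : 0 < ell k.
Proof.
elim: k => [|k IH] //=; apply: mulr_gt0 => //.
exact: lt_trans ltr01 (expand_gt1 n_gt0 n_lt2 (la k)).
Qed.

Lemma ell_ge k : l0 <= ell k.
Proof.
elim: k => [|k IH] //=; apply: le_trans IH _; rewrite ler_peMr ?(ltW (ell_gt0 k)) //.
exact: ltW (expand_gt1 n_gt0 n_lt2 (la k)).
Qed.

Lemma yk_lt k : yk k < yk k.+1.
Proof. by rewrite /= ltrDl mulr_gt0 ?ell_gt0 //; exact: tau_gt0. Qed.

Lemma zkS k : zk k.+1 = (zk k + tau n (ak k)) / expand n (ak k).
Proof.
have L := ell_gt0 k; have e1 := expand_gt1 n_gt0 n_lt2 (la k).
rewrite /zk /=; move: (expand n _) e1 (tau n _) (yk k) (ell k) L => e e1 t y l l1.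
by field; apply/andP; split; rewrite gt_eqF //; lra.
Qed.

Lemma arckE k w : let x := yk k + ell k * w in
  [/\ pos (arck k) x = sgk k * ell k `^ mu * pos (arcF n (ak k)) w,
      vel (arck k) x = sgk k * ell k `^ (mu - 1) * vel (arcF n (ak k)) w &
      acc (arck k) x = sgk k * ell k `^ (mu - 2) * acc (arcF n (ak k)) w].
Proof.
have E : 1 * (yk k + ell k * w - yk k) / ell k = w.
  have L := ell_gt0 k; move: (yk k) (ell k) L => y l L.
  by field; rewrite gt_eqF.
by move=> x; rewrite /arck /jaff /= E mulr1.
Qed.

Lemma arck_sol k : jsol n 1 (yk k) (yk k.+1) (arck k).
Proof.
have [T0 sF _ _ _] := arcP (la k); have L := ell_gt0 k.
rewrite -[X in jsol n X](mulr1 1) /arck.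
apply: jsol_aff sF => //; [exact: sgk1|by rewrite mulr1|].
move=> y; rewrite /=; move: (yk k) (ell k) L (tau _ _) => s l l1 t /andP[y1 y2].
rewrite mul1r divr_gt0 ?subr_gt0 //= ltr_pdivrMr // ltrBlDl mulrC.
exact: y2.
Qed.

Lemma arck_end k : pos (arck k) (yk k.+1) = 0.
Proof.
have [_ _ _ _ pT] := arcP (la k).
by have [-> _ _] := arckE k (tau n (ak k)); rewrite pT mulr0.
Qed.

Lemma arck_match k : same (arck k.+1) (arck k) (yk k.+1).
Proof.
have [h0 h1 h2] := arckE k (tau n (ak k)).
have := arckE k.+1 0; rewrite mulr0 addr0 => -[g0 g1 g2].
have [_ _ [p0 v0 a1] _ _] := arcP (la k.+1); have [_ _ _ _ pT] := arcP (la k).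
have e1 := expand_gt1 n_gt0 n_lt2 (la k).
have e_0 : 0 <= expand n (ak k) by lra.
have l_0 : 0 <= ell k by exact: ltW (ell_gt0 k).
have vT : vel (arcF n (ak k)) (tau n (ak k)) = - expand n (ak k) `^ (mu - 1).
  by rewrite expand_slope // /slope opprK.
have aT := ret_acc n_gt0 n_lt2 (la k).
split.
- by rewrite g0 h0 p0 pT !mulr0.
- rewrite g1 h1 v0 vT sgkS [ell k.+1]/= powRM //.
  by ring.
- rewrite g2 h2 a1 aT sgkS [ell k.+1]/= powRM // [ak k.+1]/=.
  by ring.
Qed.

Lemma yk_unbounded m : 0 < m -> (forall k, m <= tau n (ak k)) -> forall M, exists k, M < yk k.
Proof.
move=> m0 H M.
have yge k : y0 + k%:R * (l0 * m) <= yk k.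
  elim: k => [|k IH]; first by rewrite mul0r addr0.
  rewrite /= -natr1 mulrDl mul1r addrA; apply: lerD => //.
  by apply: ler_pM (ell_ge k) (H k); exact: ltW.
have lm : 0 < l0 * m by exact: mulr_gt0.
exists (Num.truncn (`|M - y0| / (l0 * m))).+1; apply: lt_le_trans (yge _).
rewrite -ltrBlDl; apply: le_lt_trans (ler_norm _) _.
by rewrite -ltr_pdivrMr // truncnS_gt.
Qed.

End Properties.
End Trajectory.

(** * Stability near a two-cycle *)

Section StateDistance.
Context {R : realType} (n : R).
Implicit Types (F G : jet R) (a b c d e m p v w x y z B M T : R) (X Y : R * R * R).
Local Notation mu := (exponent n).

Lemma norm3_lt X Y e : `|X - Y| < e <->
  [/\ `|X.1.1 - Y.1.1| < e, `|X.1.2 - Y.1.2| < e & `|X.2 - Y.2| < e].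
Proof.
rewrite prod_normE /= gt_max prod_normE /= gt_max.
by split=> [/andP[/andP[]]|[-> -> ->]].
Qed.

(** All states near the orbit have positions in a compact subset of the positive half-line,
    where powers are bounded and uniformly continuous. *)
Lemma lin_unif p m M B e : 0 < m -> 0 <= B -> 0 < e -> exists2 d, 0 < d &
  forall w w' x x', m <= w <= M -> m <= w' <= M -> `|x'| <= B ->
    `|w - w'| < d -> `|x - x'| < d -> `|w `^ p * x - w' `^ p * x'| < e.
Proof.
move=> m0 B0 e0.
have ch : continuous (fun w => Num.max w m `^ p).
  move=> w; apply: (@continuous_comp _ _ _ (fun w => Num.max w m) (fun u => u `^ p)).
    exact: cont_max.
  by apply: isD_cont; apply: is_derive1_powR; rewrite lt_max m0 orbT.
have [C C0 HC] := @cont_bounded _ _ m M ch.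
have [d1 d10 H1] := @unif_cont _ _ m M (e / (2 * (B + 1))) ch ltac:(by rewrite divr_gt0 // mulr_gt0 //; lra).
have hE w : m <= w <= M -> Num.max w m = w by move=> wm; apply/max_idPl; case/andP: wm.
have q0 : 0 < e / (2 * (C + 1)) by rewrite divr_gt0 // mulr_gt0 //; lra.
exists (Num.min d1 (e / (2 * (C + 1)))); first by rewrite lt_min d10.
move=> w w' x x' wm wm' xB; rewrite !lt_min => /andP[w1 _] /andP[_ x1].
have := H1 w w' wm wm' w1; have := HC w wm; rewrite /= !hE //.
move: (w `^ p) (w' `^ p) => u u' uC uu.
have -> : u * x - u' * x' = u * (x - x') + (u - u') * x' by ring.
apply: le_lt_trans (ler_normD _ _) _; rewrite !normrM.
have h1 : `|u| * `|x - x'| <= C * (e / (2 * (C + 1))) by apply: ler_pM => //; exact: ltW.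
have h2 : `|u - u'| * `|x'| <= e / (2 * (B + 1)) * B by apply: ler_pM => //; exact: ltW.
have h3 : C * (e / (2 * (C + 1))) < e / 2.
  have -> : C * (e / (2 * (C + 1))) = e / 2 * (C / (C + 1)) by field; lra.
  by rewrite gtr_pMr ?divr_gt0 // ltr_pdivrMr; lra.
have h4 : e / (2 * (B + 1)) * B < e / 2.
  have -> : e / (2 * (B + 1)) * B = e / 2 * (B / (B + 1)) by field; lra.
  by rewrite gtr_pMr ?divr_gt0 // ltr_pdivrMr; lra.
by move: h1 h2 h3 h4; clear; lra.
Qed.

Lemma lin_unif3 p0 p1 p2 m M B e : 0 < m -> 0 <= B -> 0 < e -> exists2 d, 0 < d &
  forall w w' x x', m <= w <= M -> m <= w' <= M -> `|x'| <= B ->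
    `|w - w'| < d -> `|x - x'| < d -> [/\ `|w `^ p0 * x - w' `^ p0 * x'| < e,
      `|w `^ p1 * x - w' `^ p1 * x'| < e & `|w `^ p2 * x - w' `^ p2 * x'| < e].
Proof.
move=> m0 B0 e0.
have [d0 d00 H0] := @lin_unif p0 m M B e m0 B0 e0.
have [d1 d10 H1] := @lin_unif p1 m M B e m0 B0 e0.
have [d2 d20 H2] := @lin_unif p2 m M B e m0 B0 e0.
exists (Num.min d0 (Num.min d1 d2)); first by rewrite !lt_min d00 d10.
move=> w w' x x' wm wm' xB; rewrite !lt_min => /and3P[w0 w1 w2] /and3P[x0 x1 x2].
by split; [exact: H0|exact: H1|exact: H2].
Qed.

(** The state at [ln w] of the solution that corresponds to a jet with state
    [F v] at position [w]. *)
Definition stateT w F v : R * R * R := (T0 n w (pos F v),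
  T1 n w (pos F v) (vel F v), T2 n w (pos F v) (vel F v) (acc F v)).

Lemma stateT_unif m M B e (n_gt0 : 0 < n) (n_lt2 : n < 2) : 0 < m -> 0 <= B -> 0 < e ->
  exists2 d, 0 < d &
  forall w w' F v G y, m <= w <= M -> m <= w' <= M ->
    `|pos G y| <= B -> `|vel G y| <= B -> `|acc G y| <= B ->
    `|w - w'| < d -> close d F v G y -> `|stateT w F v - stateT w' G y| < e.
Proof.
move=> m0 B0 e0; have m1 := mu_gt1 n_gt0 n_lt2.
pose K := 1 + mu + (2 * mu - 1) * (1 + mu) + mu * (mu - 1).
have K1 : 1 + mu <= K by rewrite /K -addrA lerDl addr_ge0 // mulr_ge0 //; lra.
have K0 : 0 < K by lra.
have eK : 0 < e / K by exact: divr_gt0.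
have [d d0 H] := @lin_unif3 (- mu) (1 - mu) (2 - mu) m M B (e / K) m0 B0 eK.
exists d => // w w' F v G y wm wm' B0' B1 B2 ww [c0 c1 c2].
have [h0 _ _] := H w w' _ _ wm wm' B0' ww c0.
have [_ h1 _] := H w w' _ _ wm wm' B1 ww c1.
have [_ _ h2] := H w w' _ _ wm wm' B2 ww c2.
have E : e = K * (e / K) by rewrite mulrC divfK // gt_eqF.
move: h0 h1 h2; rewrite -/(T0 n w (pos F v)) -/(T0 n w' (pos G y)).
move: (e / K) E eK => q -> q0 h0 h1 h2.
have k1 : `|T1 n w (pos F v) (vel F v) - T1 n w' (pos G y) (vel G y)| < (1 + mu) * q.
  rewrite /T1; move: h0 h1; move: (T0 n w _) (T0 n w' _) (w `^ _ * _) (w' `^ _ * _) => t t' r r' h0 h1.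
  have -> : r - mu * t - (r' - mu * t') = (r - r') - mu * (t - t') by ring.
  apply: le_lt_trans (ler_normB _ _) _; rewrite normrM (ger0_norm (_ : 0 <= mu)); last lra.
  rewrite mulrDl mul1r; apply: ltr_leD => //; rewrite ler_pM2l; [exact: ltW|lra].
have k2 : `|T2 n w (pos F v) (vel F v) (acc F v) - T2 n w' (pos G y) (vel G y) (acc G y)|
    < K * q.
  rewrite /T2; move: h0 h2 k1.
  move: (w `^ _ * _) (w' `^ _ * _) (T0 n w _) (T0 n w' _) (T1 n w _ _) (T1 n w' _ _).
  move=> r r' t t' s s' h0 h2 k1.
  have -> : r - (2 * mu - 1) * s - mu * (mu - 1) * t - (r' - (2 * mu - 1) * s' - mu * (mu - 1) * t') =
    (r - r') - (2 * mu - 1) * (s - s') - mu * (mu - 1) * (t - t') by ring.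
  apply: le_lt_trans (ler_normB _ _) _; rewrite normrM.
  have -> : K * q = q + (2 * mu - 1) * ((1 + mu) * q) + mu * (mu - 1) * q + mu * q by rewrite /K; ring.
  have m2 : 0 < mu * (mu - 1) by rewrite mulr_gt0 //; lra.
  have m3 : 0 < 2 * mu - 1 by lra.
  rewrite (ger0_norm (ltW m2)); apply: ltr_wpDr; first by rewrite mulr_ge0 ?ltW //; lra.
  apply: ltr_leD; last by rewrite ler_pM2l //; exact: ltW.
  apply: le_lt_trans (ler_normB _ _) _; rewrite normrM (ger0_norm (ltW m3)).
  by apply: ltrD => //; rewrite ltr_pM2l.
have qK : q <= K * q by rewrite ler_peMl ?(ltW q0) //; lra.
apply/norm3_lt; split => /=; [exact: lt_le_trans qK| |exact: k2].
by apply: lt_le_trans k1 _; rewrite ler_pM2r.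
Qed.

Lemma T0_scale e l w x : 0 < l -> 0 < w ->
  T0 n (l * w) (e * l `^ mu * x) = e * T0 n w x.
Proof.
move=> l0 w0; rewrite /T0 powRM ?ltW //.
have := @powR_opp _ l mu (- mu) l0 erefl.
move: (l `^ mu) (l `^ (- mu)) (w `^ _) => u u' t uu.
have -> : u' * t * (e * u * x) = u * u' * (e * (t * x)) by ring.
by rewrite uu mul1r.
Qed.

Lemma stateT_scale e l w (F G : jet R) x v : 0 < l -> 0 < w ->
  pos F x = e * l `^ mu * pos G v -> vel F x = e * l `^ (mu - 1) * vel G v ->
  acc F x = e * l `^ (mu - 2) * acc G v ->
  stateT (l * w) F x = e *: stateT w G v.
Proof.
move=> l0 w0 E0 E1 E2; rewrite /stateT E0 E1 E2.
have k0 := T0_scale e (pos G v) l0 w0.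
have k1 : T1 n (l * w) (e * l `^ mu * pos G v) (e * l `^ (mu - 1) * vel G v) =
    e * T1 n w (pos G v) (vel G v).
  rewrite /T1 k0 powRM ?ltW //.
  have := @powR_opp _ l (mu - 1) (1 - mu) l0 ltac:(by rewrite opprB).
  move: (l `^ (mu - 1)) (l `^ (1 - mu)) (w `^ _) (T0 _ _ _) (vel G v) => u u' t s r uu.
  have -> : u' * t * (e * u * r) - mu * (e * s) = u * u' * (e * (t * r)) - mu * (e * s) by ring.
  by rewrite uu; ring.
rewrite k0 k1 /T2 k0 k1 powRM ?ltW //.
have := @powR_opp _ l (mu - 2) (2 - mu) l0 ltac:(by rewrite opprB).
move=> uu; transitivity (e * T0 n w (pos G v), e * T1 n w (pos G v) (vel G v),
  e * T2 n w (pos G v) (vel G v) (acc G v)); last by [].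
congr (_, _, _); rewrite /T2; move: uu.
move: (l `^ (mu - 2)) (l `^ (2 - mu)) (w `^ _) (T0 _ _ _) (T1 _ _ _ _) (acc G v) => u u' t s r q uu.
have -> : u' * t * (e * u * q) - (2 * mu - 1) * (e * r) - mu * (mu - 1) * (e * s) =
   u * u' * (e * (t * q)) - (2 * mu - 1) * (e * r) - mu * (mu - 1) * (e * s) by ring.
by rewrite uu; ring.
Qed.

End StateDistance.

Section Cycle.
Context {R : realType} (n a : R) (n_gt0 : 0 < n) (n_lt2 : n < 2).
Context (la0 : lands n a) (la1 : lands n (ret n a)) (cyc : ret n (ret n a) = a).
Implicit Types (F G : jet R) (b c d e m p u v w x y z B M : R) (q : bool).
Local Notation mu := (exponent n).

Lemma gt1_mul x y : 1 < x -> 1 < y -> 1 < x * y.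
Proof.
move=> x1 y1; have : 0 < (x - 1) * (y - 1) by rewrite mulr_gt0 // subr_gt0.
by lra.
Qed.

Definition arc_param q := if q then ret n a else a.
Local Notation aq := arc_param.
(** The solution of [z' = (z + tau) / expand] along the cycle: the position of the zero for
    which the trajectory is self-similar. *)
Definition zero_ratio q : R :=
  let z := (tau n a + expand n a * tau n (ret n a)) / (expand n a * expand n (ret n a) - 1) in
  if q then (z + tau n a) / expand n a else z.
Local Notation zq := zero_ratio.

Lemma laq q : lands n (aq q). Proof. by case: q. Qed.

Lemma ret_aq q : ret n (aq q) = aq (~~ q). Proof. by case: q. Qed.

Lemma zq_gt0 q : 0 < zq q.
Proof.
have e0 := expand_gt1 n_gt0 n_lt2 la0; have e1 := expand_gt1 n_gt0 n_lt2 la1.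
have t0 := tau_gt0 la0; have t1 := tau_gt0 la1; rewrite /zero_ratio.
move: (expand n a) (expand n (ret n a)) (tau n a) (tau n (ret n a)) e0 e1 t0 t1 => r r' t t' e0 e1 t0 t1.
have z0 : 0 < (t + r * t') / (r * r' - 1).
  have h : 0 < r * r' - 1 by rewrite subr_gt0; exact: gt1_mul.
  apply: divr_gt0 => //.
  by apply: addr_gt0 => //; apply: mulr_gt0 => //; lra.
case: q => //; apply: divr_gt0; [exact: addr_gt0|lra].
Qed.

Lemma zqS q : zq (~~ q) = (zq q + tau n (aq q)) / expand n (aq q).
Proof.
have e0 := expand_gt1 n_gt0 n_lt2 la0; have e1 := expand_gt1 n_gt0 n_lt2 la1.
case: q => //; rewrite /zero_ratio /arc_param /=.
move: (expand n a) (expand n (ret n a)) (tau n a) (tau n (ret n a)) e0 e1 => r r' t t' e0 e1.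
have h : 1 < r * r' by exact: gt1_mul.
by field; rewrite !gt_eqF //; lra.
Qed.

Definition arc_sign q : R := (-1) ^+ q.
Local Notation sq := arc_sign.
(** The periodic orbit consists of two curves, on which the solution is positive and
    negative respectively. *)
Definition orb q u : R * R * R := sq q *: stateT n (zq q + u) (arcF n (aq q)) u.

Lemma sq1 q : `|sq q| = 1. Proof. by rewrite /arc_sign normrX normrN normr1 expr1n. Qed.

Lemma sqN q : sq (~~ q) = - sq q.
Proof. by case: q; rewrite /arc_sign /= ?expr0 ?expr1 ?opprK. Qed.

Lemma orb_unif q e : 0 < e -> exists2 d, 0 < d & forall w F v z,
  0 <= z <= tau n (aq q) -> `|w - (zq q + z)| < d -> close d F v (arcF n (aq q)) z ->
  `|sq q *: stateT n w F v - orb q z| < e.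
Proof.
move=> e0; have z0 := zq_gt0 q; have [T0 [c0 c1 c2 _ _] _ _ _] := arcP (laq q).
have [B0 B00 H0] := @cont_bounded _ _ 0 (tau n (aq q)) c0.
have [B1 B10 H1] := @cont_bounded _ _ 0 (tau n (aq q)) c1.
have [B2 B20 H2] := @cont_bounded _ _ 0 (tau n (aq q)) c2.
have BB : 0 <= B0 + B1 + B2 by rewrite !addr_ge0.
have [d d0 H] := @stateT_unif _ n (zq q / 2) (zq q + tau n (aq q) + 1) (B0 + B1 + B2) e
  n_gt0 n_lt2 ltac:(lra) BB e0.
exists (Num.min d (Num.min (zq q / 2) 1)); first by rewrite !lt_min d0 ltr01 andbT; lra.
move=> w F v z zT wz cl; rewrite /orb -scalerBr normrZ sq1 mul1r.
move: wz; rewrite !lt_min => /and3P[w1 w2 w3].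
apply: H => //.
- by move: w2 w3; rewrite !ltr_norml; lra.
- by lra.
- by have := H0 z zT; lra.
- by have := H1 z zT; lra.
- by have := H2 z zT; lra.
- by apply: close_le cl; rewrite ge_min lexx.
Qed.

Lemma arc_near_orb q e : 0 < e -> exists2 d, 0 < d & forall b z, lands n b ->
  `|b - aq q| < d -> `|z - zq q| < d -> forall v, 0 <= v <= tau n b ->
  exists2 v', 0 <= v' <= tau n (aq q) &
    `|sq q *: stateT n (z + v) (arcF n b) v - orb q v'| < e.
Proof.
move=> e0; have [d1 d10 H1] := orb_unif q e0.
have d12 : 0 < d1 / 2 by lra.
have [d2 d20 H2] := arc_dependence n_gt0 n_lt2 (arcP (laq q)) d12.
have [T0 sF [p0 v0 a0] Fp pT] := arcP (laq q).
exists (Num.min (d1 / 2) d2); first by rewrite lt_min d12.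
move=> b z lb; rewrite !lt_min => /andP[_ b2] /andP[z1 _] v vT.
have [T0' sG [p1 v1 a1] Gp pT'] := arcP lb.
have h0 : (0 : R) <= 0 <= tau n (aq q) by rewrite lexx ltW.
have cl : close d2 (arcF n b) 0 (arcF n (aq q)) 0.
  by split; rewrite ?p1 ?v1 ?a1 ?p0 ?v0 ?a0 ?subrr ?normr0.
have Gp0 : 0 <= pos (arcF n b) 0 by rewrite p1.
have [_ K _] := H2 0 (arcF n b) (tau n b) h0 (ltW T0') sG Gp Gp0 cl.
have [v' [v'T vv cv]] := K v vT; exists v' => //.
apply: H1 => //; last by apply: close_le cv; lra.
by move: z1 vv; rewrite !ltr_norml; lra.
Qed.

Context (stab : forall eta, 0 < eta -> exists l r, [/\ l < a < r, a - eta < l, r < a + eta,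
      forall y, l <= y <= r -> lands n y /\ lands n (ret n y) &
      forall y, l <= y <= r -> l <= ret n (ret n y) <= r]).

(** The invariant interval around [a] and the set of parameters that it sends there make a
    system of neighbourhoods of the cycle that is invariant under the return map. *)
Lemma stable_sets eta : 0 < eta -> exists A : bool -> set R,
  (forall q b, A q b -> [/\ lands n b, `|b - aq q| < eta & A (~~ q) (ret n b)]) /\
  exists2 d, 0 < d & forall q b, `|b - aq q| < d -> A q b.
Proof.
move=> eta0.
have [d1 d10 H1] := ret_cont n_gt0 n_lt2 la0 eta0.
have m0 : 0 < Num.min d1 eta by rewrite lt_min d10.
have [l [r [la ra le re]]] := stab m0.
have m1 : Num.min d1 eta <= d1 by rewrite ge_min lexx.
have m2 : Num.min d1 eta <= eta by rewrite ge_min lexx orbT.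
move: (Num.min _ _) m1 m2 ra le re => m m1 m2 ra rb HL HR.
exists (fun q => if q then [set b | [/\ lands n b, `|b - ret n a| < eta & l <= ret n b <= r]]
  else [set b | l <= b <= r]); split.
  case=> b /=; first by move=> [lb be rl]; split.
  move=> bl; have [lb lrb] := HL b bl.
  have bm : `|b - a| < m by rewrite ltr_norml; lra.
  split => //; first exact: lt_le_trans m2.
  split => //; last exact: HR.
  by have [] := H1 b lb (lt_le_trans bm m1).
have e1 : 0 < Num.min (a - l) (r - a) by rewrite lt_min; lra.
have [d2 d20 H2] := ret_cont n_gt0 n_lt2 la1 e1.
have [d3 d30 H3] := lands_open n_gt0 n_lt2 la1.
exists (Num.min (Num.min (a - l) (r - a)) (Num.min d2 (Num.min d3 eta))).
  by rewrite !lt_min d20 d30 eta0 !andbT; lra.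
case=> b; rewrite !lt_min => /andP[/andP[b1 b2] /and3P[b3 b4 b5]] /=.
  have lb := H3 b b4; split => //.
  have [_ _ + _] := H2 b lb b3; rewrite cyc lt_min => /andP[].
  by move: (ret n b) => x; rewrite !ltr_norml; lra.
by move: b1 b2; rewrite /= !ltr_norml; lra.
Qed.

(** The relative position of the zeros contracts, since lengths expand. *)
Lemma zq_contract q e : 0 < e -> exists2 d, 0 < d & forall b z, lands n b ->
  `|b - aq q| < d -> `|z - zq q| < e ->
  `|(z + tau n b) / expand n b - zq (~~ q)| < e.
Proof.
move=> e0; rewrite zqS; have r1 := expand_gt1 n_gt0 n_lt2 (laq q).
have T0 := tau_gt0 (laq q); have z0 := zq_gt0 q.
pose s := (1 + expand n (aq q)) / 2.
have [s1 sr] : 1 < s /\ s < expand n (aq q) by rewrite /s; lra.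
clearbody s.
have k0 : 0 < e * (1 - s^-1).
  by rewrite mulr_gt0 // subr_gt0 invf_lt1 //; lra.
have c : {for (expand n (aq q)), continuous (fun u : R => u^-1)}.
  by apply: inv_continuous; rewrite gt_eqF //; lra.
have [d1 d10 H1] := @mul_near R (zq q + tau n (aq q)) (expand n (aq q))^-1 _ k0.
have [d2 d20 H2] := (contP _ _).1 c d1 d10.
have m0 : 0 < Num.min d1 (Num.min d2 (expand n (aq q) - s)) by rewrite !lt_min d10 d20 subr_gt0.
have [d d0 H] := ret_cont n_gt0 n_lt2 (laq q) m0.
exists d => // b z lb ba ze; have [] := H b lb ba; rewrite !lt_min.
move=> /and3P[t1 _ _] /and3P[_ x2 x3] _ _.
have sb : s < expand n b by move: x3; rewrite ltr_norml; lra.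
have := H1 (zq q + tau n b) (expand n b)^-1 ltac:(by rewrite opprD addrACA subrr add0r)
  (H2 _ x2).
have -> : (z + tau n b) / expand n b - (zq q + tau n (aq q)) / expand n (aq q) =
  (z - zq q) * (expand n b)^-1 + ((zq q + tau n b) / expand n b -
    (zq q + tau n (aq q)) / expand n (aq q)) by ring.
move: (_ - _ / expand n (aq q)) => g h.
apply: le_lt_trans (ler_normD _ _) _; rewrite normrM.
have si : 0 < s^-1 by rewrite invr_gt0; lra.
have b0 : 0 < (expand n b)^-1 by rewrite invr_gt0; lra.
have bs : (expand n b)^-1 <= s^-1 by rewrite lef_pV2 ?posrE; lra.
rewrite (gtr0_norm b0).
have : `|z - zq q| * (expand n b)^-1 <= e * s^-1 by apply: ler_pM => //; exact: ltW.
by move: h; rewrite mulrBr mulr1; clear; lra.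
Qed.

End Cycle.

Section TrajectoryStates.
Context {R : realType} (n : R) (n_gt0 : 0 < n) (n_lt2 : n < 2).
Implicit Types (F G : jet R) (a b c d e m p u v w x y z l B M : R) (q : bool) (X : R * R * R).
Local Notation mu := (exponent n).

Lemma traj_state y0 l0 a0 e0 (l0_gt0 : 0 < l0) (la : forall k, lands n (ak n a0 k)) k v F :
  let x := yk n y0 l0 a0 k + ell n l0 a0 k * v in
  0 < zk n y0 l0 a0 k + v -> same F (arck n y0 l0 a0 e0 k) x ->
  stateT n x F x = sgk e0 k *: stateT n (zk n y0 l0 a0 k + v) (arcF n (ak n a0 k)) v.
Proof.
move=> x zv [E0 E1 E2]; have L := ell_gt0 n_gt0 n_lt2 l0_gt0 la k.
have [h0 h1 h2] := arckE y0 e0 n_gt0 n_lt2 l0_gt0 la k v.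
have xE : x = ell n l0 a0 k * (zk n y0 l0 a0 k + v).
  rewrite /x /zk; move: (yk _ _ _ _ _) (ell _ _ _ _) L => s l l1.
  by field; rewrite gt_eqF.
rewrite [in LHS]/stateT E0 E1 E2 h0 h1 h2 xE.
exact: (@stateT_scale _ n (sgk e0 k) (ell n l0 a0 k) (zk n y0 l0 a0 k + v)
  (Jet (fun=> sgk e0 k * ell n l0 a0 k `^ mu * pos (arcF n (ak n a0 k)) v)
       (fun=> sgk e0 k * ell n l0 a0 k `^ (mu - 1) * vel (arcF n (ak n a0 k)) v)
       (fun=> sgk e0 k * ell n l0 a0 k `^ (mu - 2) * acc (arcF n (ak n a0 k)) v)) _ 0 v L zv).
Qed.

Lemma arc_transversal a u : lands n a -> 0 <= u <= tau n a -> pos (arcF n a) u = 0 ->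
  vel (arcF n a) u != 0.
Proof.
move=> la uT p0; have A := arcP la; have [T0 sF [h0 h1 h2] Fp pT] := A.
have [-> |u0] := eqVneq u 0; first by rewrite h1 oner_neq0.
have [-> |uT'] := eqVneq u (tau n a); first by have [h _ _] := arc_end A; rewrite lt_eqF.
have := Fp u; rewrite p0 ltxx; case/andP: uT => uT1 uT2.
by rewrite lt_neqAle eq_sym u0 uT1 lt_neqAle uT' uT2 => /(_ isT).
Qed.

Lemma stateT_transversal w F x : 0 < w -> transversal F x ->
  T0 n w (pos F x) = 0 -> T1 n w (pos F x) (vel F x) != 0.
Proof.
move=> w0 tr /eqP; rewrite /T1 /T0 mulf_eq0 gt_eqF ?powR_gt0 //= => /eqP p0.
rewrite p0 !mulr0 subr0; apply: mulf_neq0; last exact: tr.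
by rewrite gt_eqF ?powR_gt0.
Qed.

Lemma next_arc_near a z e : lands n a -> 0 < e -> exists2 d, 0 < d & forall v b y,
  `|v - vel (arcF n a) (tau n a)| < d -> `|b - acc (arcF n a) (tau n a)| < d ->
  `|y - (z + tau n a)| < d ->
  let l := (- v) `^ (mu - 1)^-1 in
  [/\ 1 < - v, `|- b * l `^ (2 - mu) - ret n a| < e &
      `|y / l - (z + tau n a) / expand n a| < e].
Proof.
move=> la e0; have s1 := slope_gt1 la; have r1 := expand_gt1 n_gt0 n_lt2 la.
have [d1 d10 H1] := @mul_near R (- acc (arcF n a) (tau n a)) (expand n a `^ (2 - mu)) e e0.
have [d2 d20 H2] := @mul_near R (z + tau n a) (expand n a)^-1 e e0.
have [d3 d30 H3] := @powR_near R (2 - mu) (expand n a) d1 ltac:(lra) d10.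
have [d4 d40 H4] := @powR_near R (-1) (expand n a) d2 ltac:(lra) d20.
have m0 : 0 < Num.min d3 d4 by rewrite lt_min d30.
have [d5 d50 H5] := @powR_near R (mu - 1)^-1 (slope n a) (Num.min d3 d4) ltac:(lra) m0.
exists (Num.min (slope n a - 1) (Num.min d1 (Num.min d2 d5))).
  by rewrite !lt_min subr_gt0 s1 d10 d20.
move=> v b y; rewrite !lt_min => /and4P[v1 v2 v3 v4] /and4P[b1 b2 b3 b4] /and4P[y1 y2 y3 y4] l.
have ve : `|- v - slope n a| < d5 by rewrite /slope -opprD normrN.
have vs : 1 < - v by move: v1; rewrite /slope ltr_norml; lra.
have := H5 _ ve; rewrite -/(expand n a) -/l lt_min => /andP[l1 l2].
have l0 : 0 < l by apply: powR_gt0; lra.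
split => //.
  apply: H1; first by rewrite -opprD normrN.
  exact: H3.
apply: H2 => //; have := H4 l l2.
by rewrite !powR_inv1 ?ltW //; lra.
Qed.

End TrajectoryStates.

Section NearCycle.
Context {R : realType} (n a : R) (n_gt0 : 0 < n) (n_lt2 : n < 2).
Context (la0 : lands n a) (la1 : lands n (ret n a)) (cyc : ret n (ret n a) = a).
Implicit Types (F G P : jet R) (b c d e m p u v w x y z l B M : R) (q : bool) (X : R * R * R).
Local Notation mu := (exponent n).
Local Notation aq := (arc_param n a).
Local Notation sq := (@arc_sign R).
Local Notation zq := (zero_ratio n a).
Local Notation orb := (orb n a).
Local Notation laq := (laq la0 la1).
Local Notation zq_gt0 := (zq_gt0 n_gt0 n_lt2 la0 la1).

Lemma cycle_ak q k : ak n (aq q) k = aq (q (+) odd k).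
Proof.
elim: k => [|k IH]; first by rewrite addbF.
by rewrite /ak iterS -/(ak n (aq q) k) IH (ret_aq cyc) /= addbN.
Qed.

Lemma cycle_la q k : lands n (ak n (aq q) k).
Proof. by rewrite cycle_ak; exact: laq. Qed.

Lemma cycle_zk q k : zk n (zq q) 1 (aq q) k = zq (q (+) odd k).
Proof.
elim: k => [|k IH]; first by rewrite addbF /zk /= divr1.
rewrite (zkS _ n_gt0 n_lt2 ltr01 (cycle_la q)) IH cycle_ak.
by rewrite [odd _]/= addbN (zqS n_gt0 n_lt2 la0 la1).
Qed.

Lemma cycle_sgk q k : sgk (sq q) k = sq (q (+) odd k).
Proof. by rewrite /sgk /arc_sign signr_addb signr_odd. Qed.

Lemma cycle_state q k v F : 0 <= v ->
  let x := yk n (zq q) 1 (aq q) k + ell n 1 (aq q) k * v in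
  same F (arck n (zq q) 1 (aq q) (sq q) k) x ->
  stateT n x F x = orb (q (+) odd k) v.
Proof.
move=> v0 x E; rewrite /orb -cycle_sgk -cycle_ak -cycle_zk.
apply: (traj_state n_gt0 n_lt2 ltr01 (cycle_la q)) => //.
by rewrite cycle_zk ltr_pwDl // zq_gt0.
Qed.

Lemma tq_gt0 q : 0 < tau n (aq q). Proof. exact: tau_gt0 (laq q). Qed.

Lemma orb_knot q : orb q (tau n (aq q)) = orb (~~ q) 0.
Proof.
have m := arck_match (zq q) (sq q) n_gt0 n_lt2 ltr01 (cycle_la q) 0.
have h0 := @cycle_state q 0 (tau n (aq q)) (arck n (zq q) 1 (aq q) (sq q) 0) (ltW (tq_gt0 q)).
have h1 := @cycle_state q 1 0 (arck n (zq q) 1 (aq q) (sq q) 0) (lexx 0).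
rewrite mulr0 addr0 addbT in h1; rewrite -(h1 (same_sym m)).
by rewrite addbF in h0; rewrite -h0.
Qed.

Lemma orb_cont q e : 0 < e -> exists2 d, 0 < d & forall u v,
  0 <= u <= tau n (aq q) -> 0 <= v <= tau n (aq q) -> `|u - v| < d -> `|orb q u - orb q v| < e.
Proof.
move=> e0; have [d d0 H] := orb_unif n_gt0 n_lt2 la0 la1 q e0.
have [_ [c0 c1 c2 _ _] _ _ _] := arcP (laq q).
have [d' d'0 H'] := @close_unif _ (arcF n (aq q)) 0 (tau n (aq q)) d c0 c1 c2 d0.
exists (Num.min d d'); first by rewrite lt_min d0.
move=> u v uT vT; rewrite lt_min => /andP[uv uv'].
apply: H => //; last exact: H'.
by rewrite opprD addrACA subrr add0r.
Qed.

Lemma orb_pos q u : (orb q u).1.1 = sq q * ((zq q + u) `^ (- mu) * pos (arcF n (aq q)) u).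
Proof. by []. Qed.

Lemma orb_vel q u : pos (arcF n (aq q)) u = 0 ->
  (orb q u).1.2 = sq q * ((zq q + u) `^ (1 - mu) * vel (arcF n (aq q)) u).
Proof.
move=> p0; rewrite (_ : (orb q u).1.2 = sq q * T1 n (zq q + u) (pos (arcF n (aq q)) u)
  (vel (arcF n (aq q)) u)) //.
by rewrite /T1 /T0 p0 !mulr0 subr0.
Qed.

Lemma sqK q : sq q * sq q = 1.
Proof. by rewrite /arc_sign -expr2 sqrr_sign. Qed.

Lemma orb_small q d : 0 < d -> exists2 m, 0 < m & forall u, 0 <= u <= tau n (aq q) ->
  sq q * (orb q u).1.1 < m -> u < d \/ tau n (aq q) - u < d.
Proof.
move=> d0; have [T0 [c0 _ _ _ _] _ Fp _] := arcP (laq q).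
have z0 := zq_gt0 q; have mu1 := mu_gt1 n_gt0 n_lt2.
have [m m0 Hm] := @cont_min_pos R (pos (arcF n (aq q))) d (tau n (aq q) - d) c0
  (fun u ud => Fp u ltac:(lra)).
exists ((zq q + tau n (aq q)) `^ (- mu) * m); first by rewrite mulr_gt0 // powR_gt0; lra.
move=> u uT; rewrite orb_pos mulrA sqK mul1r => h.
have [|ud] := ltP u d; first by left.
have [|uT'] := ltP (tau n (aq q) - u) d; first by right.
have h1 := Hm u ltac:(lra).
have h2 : (zq q + tau n (aq q)) `^ (- mu) <= (zq q + u) `^ (- mu).
  by apply: powR_le_neg; lra.
have h3 : (zq q + tau n (aq q)) `^ (- mu) * m <= (zq q + u) `^ (- mu) * pos (arcF n (aq q)) u.
  by apply: ler_pM => //; [exact: powR_ge0|exact: ltW].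
by have := lt_le_trans h h3; rewrite ltxx.
Qed.

Definition rising_state q X := 0 < sq q * X.1.1 \/ (X.1.1 = 0 /\ 0 < sq q * X.1.2).

(** Near a zero a perturbed state may lie on the other side, and it is then seen as
    close to the neighbouring arc. *)
Lemma near_start q e : 0 < e -> exists2 d, 0 < d & forall u X, 0 <= u <= tau n (aq q) ->
  `|X - orb q u| < d -> exists q' u', [/\ 0 <= u' <= tau n (aq q'),
     `|X - orb q' u'| < e & rising_state q' X].
Proof.
move=> e0; have T0 := tq_gt0 q; have z0 := zq_gt0 q; have T1 := tq_gt0 (~~ q).
have [_ _ [p0 v0 _] _ pT] := arcP (laq q).
have vT : vel (arcF n (aq q)) (tau n (aq q)) < 0 by have [] := arc_end (arcP (laq q)).
pose k0 := zq q `^ (1 - mu).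
have k00 : 0 < k0 by exact: powR_gt0.
pose k1 := (zq q + tau n (aq q)) `^ (1 - mu) * - vel (arcF n (aq q)) (tau n (aq q)).
have k10 : 0 < k1 by rewrite mulr_gt0 ?oppr_gt0 // powR_gt0 // addr_gt0.
have V0 : (orb q 0).1.2 = sq q * k0 by rewrite orb_vel // v0 mulr1 addr0.
have V1 : (orb q (tau n (aq q))).1.2 = - (sq q * k1) by rewrite orb_vel // /k1 !mulrN opprK.
clearbody k0 k1.
pose e' := Num.min e (Num.min k0 k1).
have e'0 : 0 < e' by rewrite !lt_min e0 k00.
have [ee e_0 e_1] : [/\ e' <= e, e' <= k0 & e' <= k1] by rewrite /e' !ge_min !lexx !orbT.
clearbody e'.
have e'2 : 0 < e' / 2 by lra.
have [d d0 Hd] := orb_cont q e'2.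
have [m m0 Hm] := orb_small q d0.
exists (Num.min m (e' / 2)); first by rewrite lt_min m0.
move=> u X uT; rewrite lt_min => /andP[Xm Xe].
have [sX|sX] := ltP 0 (sq q * X.1.1).
  by exists q, u; split => //; [lra|left].
have sm : sq q * (orb q u).1.1 < m.
  have /norm3_lt[h _ _] := Xm.
  have : `|sq q * X.1.1 - sq q * (orb q u).1.1| < m by rewrite -mulrBr normrM sq1 mul1r.
  by rewrite ltr_norml; lra.
have sX' : X.1.1 != 0 -> 0 < sq (~~ q) * X.1.1.
  move=> X0; rewrite sqN mulNr oppr_gt0 lt_neqAle sX andbT mulf_neq0 //.
  by rewrite -normr_eq0 sq1 oner_neq0.
have [ud|ud] := Hm u uT sm.
  have Xk : `|X - orb q 0| < e'.
    rewrite -(subrKA (orb q u)); apply: le_lt_trans (ler_normD _ _) _.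
    have := Hd u 0 uT ltac:(by rewrite lexx ltW) ltac:(by rewrite subr0 ger0_norm //; case/andP: uT).
    lra.
  have [X0|X0] := eqVneq X.1.1 0; last first.
    exists (~~ q), (tau n (aq (~~ q))); split; [by rewrite lexx ltW| |by left; exact: sX'].
    by rewrite orb_knot negbK; exact: lt_le_trans ee.
  exists q, u; split => //; first lra.
  right; split => //; have /norm3_lt[_ + _] := Xk; rewrite V0 => h.
  have : `|sq q * X.1.2 - k0| < e'.
    by rewrite -[k0]mul1r -(sqK q) -mulrA -mulrBr normrM sq1 mul1r.
  by rewrite ltr_norml; lra.
have Xk : `|X - orb q (tau n (aq q))| < e'.
  rewrite -(subrKA (orb q u)); apply: le_lt_trans (ler_normD _ _) _.
  have := Hd u (tau n (aq q)) uT ltac:(by rewrite lexx ltW)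
    ltac:(by rewrite distrC ger0_norm // subr_ge0; case/andP: uT).
  lra.
exists (~~ q), 0; split; [by rewrite lexx ltW|by rewrite -orb_knot; exact: lt_le_trans ee|].
have [X0|X0] := eqVneq X.1.1 0; last by left; exact: sX'.
right; split => //; have /norm3_lt[_ + _] := Xk; rewrite V1 sqN => h.
have : `|- sq q * X.1.2 - k1| < e'.
  have -> : - sq q * X.1.2 - k1 = - (sq q * (X.1.2 - - (sq q * k1))).
    by rewrite mulrBr mulrN mulrA sqK mul1r; ring.
  by rewrite normrN normrM sq1 mul1r.
by rewrite ltr_norml; lra.
Qed.

Lemma near_jet q e : 0 < e -> exists2 d, 0 < d & forall u X, 0 <= u <= tau n (aq q) ->
  `|X - orb q u| < d -> let w := zq q + u in
  [/\ `|sq q * S0 n w X.1.1 - pos (arcF n (aq q)) u| < e,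
      `|sq q * S1 n w X.1.1 X.1.2 - vel (arcF n (aq q)) u| < e &
      `|sq q * S2 n w X.1.1 X.1.2 X.2 - acc (arcF n (aq q)) u| < e].
Proof.
move=> e0; have z0 := zq_gt0 q; have tq0 := tq_gt0 q; have mu1 := mu_gt1 n_gt0 n_lt2.
have [d d0 H] := @lin_unif3 R mu (mu - 1) (mu - 2) (zq q) (zq q + tau n (aq q)) 0 e z0 (lexx 0) e0.
pose K := 1 + mu + (2 * mu - 1) + mu * (mu - 1).
have m2 : 0 < mu * (mu - 1) by rewrite mulr_gt0 //; lra.
have K1 : 1 + mu <= K by rewrite /K; lra.
have K2 : 1 + (2 * mu - 1) + mu * (mu - 1) <= K by rewrite /K; lra.
clearbody K.
have K0 : 0 < K by lra.
exists (d / K); first exact: divr_gt0.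
move=> u X uT Xu w.
have wT : zq q <= w <= zq q + tau n (aq q) by rewrite /w; lra.
have w0 : 0 < w by rewrite /w; lra.
have E : d = K * (d / K) by rewrite mulrC divfK // gt_eqF.
have Kd0 : 0 < d / K by exact: divr_gt0.
have lin p x : `|x| < d -> p \in [:: mu; mu - 1; mu - 2] -> `|w `^ p * x| < e.
  move=> xd; have [h0 h1 h2] := H w w x 0 wT wT ltac:(by rewrite normr0)
    ltac:(by rewrite subrr normr0) ltac:(by rewrite subr0).
  move: h0 h1 h2; rewrite !mulr0 !subr0 => h0 h1 h2.
  by rewrite !inE => /or3P[] /eqP->.
have : `|sq q *: X - stateT n w (arcF n (aq q)) u| < d / K.
  rewrite -[X in _ - X](scale1r) -(sqK q) -scalerA -scalerBr normrZ sq1 mul1r; exact: Xu.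
move=> /norm3_lt[/= h0 h1 h2].
rewrite -[pos _ u](T0K n _ w0) -[vel _ u](T1K n (pos (arcF n (aq q)) u) _ w0).
rewrite -[acc _ u](T2K n (pos (arcF n (aq q)) u) (vel (arcF n (aq q)) u) _ w0).
move: h0 h1 h2; rewrite -![sq q *: _]/(sq q * _).
move: (T0 n w _) (T1 n w _ _) (T2 n w _ _ _) (sq q) => t0 t1 t2 s h0 h1 h2.
rewrite /S0 /S1 /S2.
have r0 : s * X.1.1 - t0 = s * X.1.1 - t0 by [].
split.
- have -> : s * (w `^ mu * X.1.1) - w `^ mu * t0 = w `^ mu * (s * X.1.1 - t0) by ring.
  by apply: lin; rewrite ?inE ?eqxx //; apply: lt_le_trans h0 _; rewrite ler_pdivrMr // ler_peMr ?ltW //; lra.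
- have -> : s * (w `^ (mu - 1) * (X.1.2 + mu * X.1.1)) - w `^ (mu - 1) * (t1 + mu * t0) =
    w `^ (mu - 1) * ((s * X.1.2 - t1) + mu * (s * X.1.1 - t0)) by ring.
  apply: lin; rewrite ?inE ?eqxx ?orbT //.
  apply: le_lt_trans (ler_normD _ _) _; rewrite normrM (ger0_norm (_ : 0 <= mu)); last lra.
  have : mu * `|s * X.1.1 - t0| < mu * (d / K) by rewrite ltr_pM2l //; lra.
  have : (1 + mu) * (d / K) <= K * (d / K) by rewrite ler_pM2r.
  by move: h1; rewrite -E; clear; lra.
have -> : s * (w `^ (mu - 2) * (X.2 + (2 * mu - 1) * X.1.2 + mu * (mu - 1) * X.1.1)) -
    w `^ (mu - 2) * (t2 + (2 * mu - 1) * t1 + mu * (mu - 1) * t0) =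
  w `^ (mu - 2) * ((s * X.2 - t2) + (2 * mu - 1) * (s * X.1.2 - t1) +
    mu * (mu - 1) * (s * X.1.1 - t0)) by ring.
apply: lin; rewrite ?inE ?eqxx ?orbT //.
apply: le_lt_trans (ler_normD _ _) _; apply: le_lt_trans (lerD (ler_normD _ _) (lexx _)) _.
rewrite (normrM (2 * mu - 1)) (normrM (mu * (mu - 1))) (gtr0_norm m2) (ger0_norm (_ : 0 <= 2 * mu - 1)); last lra.
have : mu * (mu - 1) * `|s * X.1.1 - t0| < mu * (mu - 1) * (d / K) by rewrite ltr_pM2l.
have : (2 * mu - 1) * `|s * X.1.2 - t1| < (2 * mu - 1) * (d / K) by rewrite ltr_pM2l //; lra.
have : (1 + (2 * mu - 1) + mu * (mu - 1)) * (d / K) <= K * (d / K) by rewrite ler_pM2r.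
have -> : (1 + (2 * mu - 1) + mu * (mu - 1)) * (d / K) =
  d / K + (2 * mu - 1) * (d / K) + mu * (mu - 1) * (d / K) by ring.
rewrite -E; move: h2.
move: (mu * (mu - 1) * _) (mu * (mu - 1) * _) ((2 * mu - 1) * _) ((2 * mu - 1) * _) => *; lra.
Qed.

End NearCycle.

Section NearTrajectory.
Context {R : realType} (n a : R) (n_gt0 : 0 < n) (n_lt2 : n < 2).
Context (la0 : lands n a) (la1 : lands n (ret n a)) (cyc : ret n (ret n a) = a).
Implicit Types (F G P : jet R) (b c d e m p s u v w x y z l B M : R) (q : bool) (X : R * R * R).
Local Notation mu := (exponent n).
Local Notation aq := (arc_param n a).
Local Notation zq := (zero_ratio n a).
Local Notation orb := (orb n a).
Local Notation sq := (@arc_sign R).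
Local Notation laq := (laq la0 la1).

Lemma bool_choice (Q : bool -> R -> Prop) : (forall q, exists2 d, 0 < d & Q q d) ->
  exists D : bool -> R, exists2 m, 0 < m & forall q, m <= D q /\ Q q (D q).
Proof.
move=> H; have H' q : exists d, 0 < d /\ Q q d by have [d d0 h] := H q; exists d.
have [D HD] := choice H'.
exists D, (Num.min (D true) (D false)); first by rewrite lt_min !(HD _).1.
by move=> q; split; [case: q; rewrite ge_min lexx ?orbT|exact: (HD q).2].
Qed.

Lemma locate (y : nat -> R) x : (forall M, exists k, M < y k) -> y 0%N <= x ->
  exists k, y k <= x <= y k.+1.
Proof.
move=> yoo x0; have [K] := yoo x; elim: K => [|K IH] h; first by rewrite ltNge x0 in h.
by have [xK|xK] := ltP x (y K); [exact: IH|exists K; rewrite xK ltW].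
Qed.

Lemma psol_shift x y s P : psol n (x + s) (y + s) P -> psol n x y (jshift s P).
Proof.
move=> [c0 c1 c2 D D2]; have cs : continuous (fun y => y + s) by conts.
split => /=; try by apply: cont_comp cs.
- by move=> t ty; have [D0 D1] := D (t + s) ltac:(lra); split; apply: isD_shift.
- by move=> t ty p0; apply: isD_shift; apply: D2; [lra|exact: p0].
Qed.

Definition stP P s : R * R * R := (pos P s, vel P s, acc P s).

Lemma psol_of_jsol w F : 0 < w -> (forall Y, jsol n 1 w Y F) ->
  forall b, psol n 0 b (jshift (ln w) (pjet n F)).
Proof.
move=> w0 sF b; apply: psol_shift.
apply: (@psol_pjet _ n F w (expR (b + ln w))) => // s /andP[s1 s2].
by rewrite ltr_expR s2 andbT -[X in X < _](lnK w0) ltr_expR -[X in X < _]add0r.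
Qed.

(** The partial arc that starts at [X] ends close to the end of an arc of the cycle; the
    parameters of the following arcs stay in [stable_sets], and the relative positions of
    their zeros stay close by [zq_contract], so each of them follows the orbit. *)
Lemma near_trajectory e (stab : forall eta, 0 < eta -> exists l r,
      [/\ l < a < r, a - eta < l, r < a + eta,
      forall y, l <= y <= r -> lands n y /\ lands n (ret n y) &
      forall y, l <= y <= r -> l <= ret n (ret n y) <= r]) : 0 < e ->
  exists2 d, 0 < d & forall q u X, 0 <= u <= tau n (aq q) -> `|X - orb q u| < d ->
  exists P, [/\ forall b, psol n 0 b P, stP P 0 = X, forall s, 0 <= s -> transversal P s &
    forall s, 0 <= s -> exists q' u', 0 <= u' <= tau n (aq q') /\ `|stP P s - orb q' u'| < e].
Proof.
move=> e0.
have [D1 [m1 m10 H1]] := bool_choice (fun q => arc_near_orb n_gt0 n_lt2 la0 la1 q e0).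
have [D2 [m2 m20 H2]] := bool_choice (fun q => zq_contract n_gt0 n_lt2 la0 la1 q m10).
have th q : 0 < tau n (aq q) / 2 by rewrite divr_gt0 // (tau_gt0 (laq q)).
have [D3 [m3 m30 H3]] := bool_choice (fun q => ret_cont n_gt0 n_lt2 (laq q) (th q)).
have eta0 : 0 < Num.min m1 (Num.min m2 m3) by rewrite !lt_min m10 m20.
have [A [HA [d4 d40 H4]]] := stable_sets n_gt0 n_lt2 la0 la1 cyc stab eta0.
have e50 : 0 < Num.min d4 m1 by rewrite lt_min d40.
have [D5 [m5 m50 H5]] := bool_choice (fun q => next_arc_near n_gt0 n_lt2 (zq q) (laq q) e50).
have [D6 [m6 m60 H6]] := bool_choice (fun q => orb_unif n_gt0 n_lt2 la0 la1 q e0).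
have e70 : 0 < Num.min m5 m6 by rewrite lt_min m50.
have [D7 [m7 m70 H7]] := bool_choice (fun q => landing_near n_gt0 n_lt2 (arcP (laq q)) e70).
have [D8 [m8 m80 H8]] := bool_choice (fun q => near_jet n_gt0 n_lt2 la0 la1 q m70).
have [D9 [m9 m90 H9]] := bool_choice (fun q => near_start n_gt0 n_lt2 la0 la1 cyc q m80).
exists m9 => // q0 u0 X uT0 Xu0.
have [q [u [uT Xu st]]] := (H9 q0).2 u0 X uT0 (lt_le_trans Xu0 (H9 q0).1).
have z0 := zq_gt0 n_gt0 n_lt2 la0 la1 q.
have [x1 v1 b1] := (H8 q).2 u X uT (lt_le_trans Xu (H8 q).1).
set w := zq q + u in x1 v1 b1.
have w0 : 0 < w by case/andP: uT => u0' _; rewrite /w ltr_pwDl.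
have wu : w - u = zq q by rewrite /w addrK.
have wE : w = zq q + u by [].
clearbody w.
have sqK' := sqK q.
have st' : 0 < sq q * S0 n w X.1.1 \/ (sq q * S0 n w X.1.1 = 0 /\ 0 < sq q * S1 n w X.1.1 X.1.2).
  rewrite /S0 /S1; case: st => [h|[h1 h2]].
    by left; rewrite mulrCA mulr_gt0 // powR_gt0.
  by right; rewrite h1 !mulr0 addr0 mulrCA mulr_gt0 // powR_gt0.
have [G [Y [Y0 sG [iG0 iG1 iG2] Gp [pY uY cY KY]]]] := (H7 q).2 u _ _ _ uT
  (lt_le_trans x1 (H7 q).1) (lt_le_trans v1 (H7 q).1) (lt_le_trans b1 (H7 q).1) st'.
have m75 : Num.min m5 m6 <= D5 q by rewrite ge_min (H5 q).1.
have m76 : Num.min m5 m6 <= D6 q by rewrite ge_min (H6 q).1 orbT.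
pose y1 := w + Y.
have y1E : `|y1 - (zq q + tau n (aq q))| < D5 q.
  rewrite (_ : y1 - _ = u + Y - tau n (aq q)); first exact: lt_le_trans m75.
  by rewrite /y1 wE; ring.
have [_ c1 c2] := cY.
have [vY a1 z1] := (H5 q).2 _ _ y1 (lt_le_trans c1 m75) (lt_le_trans c2 m75) y1E.
set l1 := (- vel G Y) `^ (mu - 1)^-1 in a1 z1.
have l10 : 0 < l1 by apply: powR_gt0; exact: lt_trans ltr01 vY.
have mu1 := mu_gt1 n_gt0 n_lt2.
have l1v : l1 `^ (mu - 1) = - vel G Y.
  rewrite /l1 -powRrM mulVf ?powRr1 ?(ltW (lt_trans ltr01 vY)) //.
  by rewrite gt_eqF // subr_gt0.
have l1a : l1 `^ (mu - 2) * l1 `^ (2 - mu) = 1 by apply: powR_opp => //; ring.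
set b2 := - acc G Y * l1 `^ (2 - mu) in a1.
have b2E : b2 = - acc G Y * l1 `^ (2 - mu) by [].
clearbody l1 b2.
move: a1 z1; rewrite (ret_aq cyc) -(zqS n_gt0 n_lt2 la0 la1) !lt_min => /andP[a1 _] /andP[_ z1].
have Ak k : A (~~ q (+) odd k) (ak n b2 k).
  elim: k => [|k IH]; first by rewrite addbF; exact: H4.
  by rewrite [odd _]/= addbN; have [_ _] := HA _ _ IH.
have la k : lands n (ak n b2 k) by have [] := HA _ _ (Ak k).
have near_a k : [/\ `|ak n b2 k - aq (~~ q (+) odd k)| < m1,
    `|ak n b2 k - aq (~~ q (+) odd k)| < m2 & `|ak n b2 k - aq (~~ q (+) odd k)| < m3].
  by have [_ + _] := HA _ _ (Ak k); rewrite !lt_min => /and3P[].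
have zk1 k : `|zk n y1 l1 b2 k - zq (~~ q (+) odd k)| < m1.
  elim: k => [|k IH]; first by rewrite addbF.
  rewrite (zkS _ n_gt0 n_lt2 l10 la) [odd _]/= addbN.
  have [_ h _] := near_a k.
  by apply: (H2 _).2 => //; exact: lt_le_trans h (H2 _).1.
have tk k : Num.min (tau n (aq true) / 2) (tau n (aq false) / 2) <= tau n (ak n b2 k).
  have [_ _ h] := near_a k; set q' := ~~ q (+) odd k in h.
  have [h1 _ _ _] := (H3 q').2 _ (la k) (lt_le_trans h (H3 q').1).
  have h2 : Num.min (tau n (aq true) / 2) (tau n (aq false) / 2) <= tau n (aq q') / 2.
    by case: (q'); rewrite ge_min lexx ?orbT.
  by move: h1 h2; rewrite ltr_norml; clear; lra.
have tm0 : 0 < Num.min (tau n (aq true) / 2) (tau n (aq false) / 2) by rewrite lt_min !th.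
pose J k := if k is k'.+1 then arck n y1 l1 b2 (sq (~~ q)) k' else jaff n (sq q) 1 1 w G.
pose yy k := if k is k'.+1 then yk n y1 l1 b2 k' else w.
have J0 y : [/\ pos (J 0%N) y = sq q * pos G (y - w), vel (J 0%N) y = sq q * vel G (y - w) &
    acc (J 0%N) y = sq q * acc G (y - w)] by exact: jaff_unit.
have y1w : y1 - w = Y by rewrite /y1 addrAC subrr add0r.
have yyS k : yy k < yy k.+1.
  by case: k => [|k]; [rewrite /yy /= /y1 ltrDl|exact: (yk_lt y1 n_gt0 n_lt2 l10 la k)].
have yyoo M : exists k, M < yy k.
  by have [k h] := yk_unbounded y1 n_gt0 n_lt2 l10 la tm0 tk M; exists k.+1.
have sJ k : jsol n 1 (yy k) (yy k.+1) (J k).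
  case: k => [|k]; last exact: (arck_sol y1 n_gt0 n_lt2 l10 (sq1 _) la k).
  rewrite -[X in jsol n X](mulr1 1); apply: jsol_aff sG => //; [exact: sq1|by rewrite mulr1|].
  by move=> y; rewrite /yy /= mul1r divr1 -y1w => /andP[h1 h2]; rewrite subr_gt0 h1 ltrD2r.
have mJ k : same (J k.+1) (J k) (yy k.+1).
  case: k => [|k]; last exact: (arck_match y1 _ n_gt0 n_lt2 l10 la k).
  have [j0 j1 j2] := J0 y1; have := arckE y1 (sq (~~ q)) n_gt0 n_lt2 l10 la 0 0.
  have [_ _ [p0 v0 a0] _ _] := arcP (la 0%N).
  rewrite mulr0 addr0 p0 v0 a0 [sgk _ _]mulr1 sqN [ell _ _ _ _]/= [yk _ _ _ _ _]/= [ak _ _ _]/=.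
  move=> [i0 i1 i2]; rewrite /same /yy [J 1%N]/= sqN.
  split; rewrite ?i0 ?i1 ?i2 ?j0 ?j1 ?j2 y1w.
  - by rewrite pY !mulr0.
  - by rewrite l1v mulr1 mulrNN.
  - rewrite b2E; move: (l1 `^ (mu - 2)) (l1 `^ (2 - mu)) l1a (acc G Y) (sq q) => t t' tt g s.
    have -> : - s * t * (- g * t') = t * t' * (s * g) by ring.
    by rewrite tt mul1r.
have pJ k : pos (J k) (yy k.+1) = 0.
  case: k => [|k]; last exact: (arck_end y1 _ n_gt0 n_lt2 l10 la k).
  by have [-> _ _] := J0 y1; rewrite y1w pY mulr0.
have [F [sF EF]] := jsol_glue_seq yyS yyoo sJ mJ pJ.
(* Every position lies on one of the pieces. *)
have main x : w <= x -> transversal F x /\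
    exists q' u', 0 <= u' <= tau n (aq q') /\ `|stateT n x F x - orb q' u'| < e.
  move=> wx; have [k xk] := locate yyoo wx; have Ek := EF k x xk.
  case: k xk Ek => [|k] xk Ek.
    have [E0 E1 E2] := Ek; have [j0 j1 j2] := J0 x; rewrite j0 in E0; rewrite j1 in E1; rewrite j2 in E2.
    have xY : 0 <= x - w <= Y by case/andP: xk => h1 h2; rewrite subr_ge0 h1 /= lerBlDl.
    split.
      move=> p0; rewrite E0 in p0; rewrite E1.
      have sq0 : sq q != 0 by rewrite -normr_eq0 sq1 oner_neq0.
      have {}p0 : pos G (x - w) = 0 by apply: (mulfI sq0); rewrite p0 mulr0.
      apply: mulf_neq0 => //.
      have [xw|xw] := eqVneq (x - w) 0.
        rewrite xw iG0 in p0; rewrite xw iG1.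
        by case: st' => [|[_ h]]; [rewrite p0 ltxx|rewrite gt_eqF].
      have [xw'|xw'] := eqVneq (x - w) Y.
        by rewrite xw' -oppr_eq0 gt_eqF // (lt_trans ltr01).
      have := Gp (x - w); rewrite p0 ltxx; case/andP: xY => h1 h2.
      by rewrite lt_neqAle eq_sym xw h1 lt_neqAle xw' h2 => /(_ isT).
    have [z [zT zu cz]] := KY (x - w) xY.
    exists q, z; split => //.
    have -> : stateT n x F x = sq q *: stateT n x G (x - w).
      have := @stateT_scale _ n (sq q) 1 x F G x (x - w) ltr01 (lt_le_trans w0 wx).
      by rewrite !powR1 !mulr1 mul1r; apply.
    apply: (H6 q).2 => //; last by apply: close_le cz.
    apply: lt_le_trans m76; rewrite distrC.
    rewrite (_ : zq q + z - x = z - (u + (x - w))) //.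
    by rewrite wE; ring.
  pose v := (x - yk n y1 l1 b2 k) / ell n l1 b2 k.
  have L := ell_gt0 n_gt0 n_lt2 l10 la k.
  have xE : x = yk n y1 l1 b2 k + ell n l1 b2 k * v.
    by rewrite /v [_ * (_ / _)]mulrC divfK ?gt_eqF // addrC subrK.
  have vT : 0 <= v <= tau n (ak n b2 k).
    move: xk; rewrite /yy /= /v => /andP[h1 h2].
    apply/andP; split; first by apply: divr_ge0; [rewrite subr_ge0|exact: ltW].
    by rewrite ler_pdivrMr // lerBlDl mulrC.
  clearbody v.
  have [q' q'E] : exists q', q' = ~~ q (+) odd k by exists (~~ q (+) odd k).
  have [na _ _] := near_a k; have nz := zk1 k; rewrite -q'E in na nz.
  have [v' v'T vv] := (H1 q').2 _ _ (la k) (lt_le_trans na (H1 q').1) (lt_le_trans nz (H1 q').1) v vT.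
  have zk0 : 0 < zk n y1 l1 b2 k.
    rewrite /zk divr_gt0 //; apply: (@lt_le_trans _ _ w) => //.
    have yge : forall j, w <= yk n y1 l1 b2 j.
      elim=> [|j IH]; first by rewrite /= /y1 lerDl ltW.
      by apply: le_trans IH _; exact: ltW (yk_lt y1 n_gt0 n_lt2 l10 la j).
    exact: yge.
  split.
    move=> p0; rewrite xE in Ek p0 *; have [E0 E1 _] := Ek.
    have [j0 j1 _] := arckE y1 (sq (~~ q)) n_gt0 n_lt2 l10 la k v.
    have c0 p : sgk (sq (~~ q)) k * ell n l1 b2 k `^ p != 0.
      apply: mulf_neq0; last by rewrite gt_eqF // powR_gt0.
      by rewrite -normr_eq0 (sgk1 (sq1 _)) oner_neq0.
    rewrite E1 [J _]/= j1; apply: mulf_neq0 => //; apply: arc_transversal => //.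
    by apply: (mulfI (c0 mu)); rewrite mulr0 -j0 -p0 E0.
  exists q', v'; split => //.
  have zkv : 0 < zk n y1 l1 b2 k + v by case/andP: vT => v0 _; rewrite ltr_pwDl.
  have Ek' : same F (arck n y1 l1 b2 (sq (~~ q)) k) (yk n y1 l1 b2 k + ell n l1 b2 k * v).
    by rewrite -xE; exact: Ek.
  have := traj_state n_gt0 n_lt2 l10 la zkv Ek'; rewrite -xE => ->.
  by rewrite cycle_sgk -q'E.
exists (jshift (ln w) (pjet n F)); split.
- exact: psol_of_jsol w0 sF.
- rewrite /stP /jshift /= add0r lnK //.
  have [E0 E1 E2] := EF 0%N w ltac:(by rewrite lexx ltW // (yyS 0%N)).
  have [j0 j1 j2] := J0 w; rewrite subrr iG0 iG1 iG2 in j0 j1 j2.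
  have ss t : sq q * (sq q * t) = t by rewrite mulrA sqK' mul1r.
  rewrite E0 E1 E2 j0 j1 j2 !ss (S0K _ _ w0) (S1K _ _ _ w0) (S2K _ _ _ _ w0).
  by case: (X) => -[].
- move=> s s0; have [tr _] := main (expR (s + ln w)) ltac:(by rewrite -[X in X <= _](lnK w0) ler_expR lerDr).
  exact: stateT_transversal (expR_gt0 _) tr.
- move=> s s0; have [_ h] := main (expR (s + ln w)) ltac:(by rewrite -[X in X <= _](lnK w0) ler_expR lerDr).
  exact: h.
Qed.

End NearTrajectory.

(** * The periodic solution *)

Section PeriodicOrbit.
Context {R : realType} (n a : R) (n_gt0 : 0 < n) (n_lt2 : n < 2).
Context (la0 : lands n a) (la1 : lands n (ret n a)) (cyc : ret n (ret n a) = a).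
Implicit Types (F G P : jet R) (b c d e m p s u v w x y z l B M T : R) (q : bool) (X : R * R * R).
Local Notation mu := (exponent n).
Local Notation aq := (arc_param n a).
Local Notation zq := (zero_ratio n a).
Local Notation orb := (orb n a).
Local Notation sq := (@arc_sign R).
Local Notation laq := (laq la0 la1).
Local Notation y k := (yk n (zq false) 1 (aq false) k).
Local Notation el k := (ell n 1 (aq false) k).
Local Notation la := (cycle_la la0 la1 cyc false).
Local Notation rho := (expand n a * expand n (ret n a)).

Lemma cycle_el k : el k.+2 = rho * el k.
Proof.
have -> : el k.+2 = el k * expand n (ak n (aq false) k) * expand n (ak n (aq false) k.+1) by [].
rewrite !(cycle_ak cyc) !addFb [odd k.+1]/=; case: (odd k); rewrite /arc_param [~~ _]/=.
  by move: (expand n a) (expand n (ret n a)) (el k) => *; ring.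
by move: (expand n a) (expand n (ret n a)) (el k) => *; ring.
Qed.

Lemma cycle_y k : y k.+2 = rho * y k.
Proof.
have E j : y j = zq (odd j) * el j.
  have := cycle_zk n_gt0 n_lt2 la0 la1 cyc false j; rewrite /zk addFb => <-.
  by rewrite divfK // gt_eqF // (ell_gt0 n_gt0 n_lt2 ltr01 la).
by rewrite !E cycle_el /= negbK mulrCA.
Qed.

(** After two arcs the trajectory has grown by the factor [expand a * expand (ret a)], and
    in logarithmic time this is a translation. *)
Lemma cycle_orbit : exists P T, [/\ 0 < T, forall b, psol n 0 b P,
  forall s, 0 <= s -> transversal P s /\
    exists q u, 0 <= u <= tau n (aq q) /\ stP P s = orb q u,
  forall s, 0 <= s -> stP P (s + T) = stP P s &
  forall q u, 0 <= u <= tau n (aq q) -> exists2 s, 0 <= s & stP P s = orb q u].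
Proof.
have e0 := expand_gt1 n_gt0 n_lt2 la0; have e1 := expand_gt1 n_gt0 n_lt2 la1.
have r1 : 1 < rho := gt1_mul e0 e1.
have r0 : 0 < rho := lt_trans ltr01 r1.
have tm q : 0 < tau n (aq q) := tau_gt0 (laq q).
have yoo M : exists k, M < y k.
  apply: (@yk_unbounded _ n (zq false) 1 (aq false) n_gt0 n_lt2 ltr01 la
    (Num.min (tau n (aq true)) (tau n (aq false)))).
    by rewrite lt_min !tm.
  by move=> k; rewrite (cycle_ak cyc) addFb; case: (odd k); rewrite ge_min lexx ?orbT.
have [F [sF EF]] := jsol_glue_seq (yk_lt (zq false) n_gt0 n_lt2 ltr01 la) yoo
  (arck_sol (zq false) n_gt0 n_lt2 ltr01 (sq1 false) la)
  (arck_match (zq false) (sq false) n_gt0 n_lt2 ltr01 la)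
  (arck_end (zq false) (sq false) n_gt0 n_lt2 ltr01 la).
have w0 : 0 < zq false := zq_gt0 n_gt0 n_lt2 la0 la1 false.
have elg k : 0 < el k := ell_gt0 n_gt0 n_lt2 ltr01 la k.
have yS k : y k.+1 = y k + el k * tau n (aq (odd k)).
  have -> : y k.+1 = y k + el k * tau n (ak n (aq false) k) by [].
  by rewrite (cycle_ak cyc) addFb.
(* The state at the relative time [v] of the arc number [k]. *)
have st k v : 0 <= v <= tau n (aq (odd k)) ->
    stateT n (y k + el k * v) F (y k + el k * v) = orb (odd k) v /\
    transversal F (y k + el k * v).
  move=> vT; have [v0 v1] := andP vT.
  have Ek : same F (arck n (zq false) 1 (aq false) (sq false) k) (y k + el k * v).
    apply: EF; rewrite yS lerDl lerD2l ler_pM2l // v1 andbT.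
    by rewrite mulr_ge0 // ltW.
  split; first by have := cycle_state n_gt0 n_lt2 la0 la1 cyc v0 Ek; rewrite addFb.
  move=> p0; have [E0 E1 _] := Ek.
  have [j0 j1 _] := arckE (zq false) (sq false) n_gt0 n_lt2 ltr01 la k v.
  have c0 p : sgk (sq false) k * el k `^ p != 0.
    apply: mulf_neq0; last by rewrite gt_eqF // powR_gt0.
    by rewrite -normr_eq0 (sgk1 (sq1 _)) oner_neq0.
  rewrite E1 j1; apply: mulf_neq0 => //; apply: (arc_transversal (la k)).
    by rewrite (cycle_ak cyc) addFb.
  by apply: (mulfI (c0 mu)); rewrite mulr0 -j0 -p0 E0.
have pos_k x : zq false <= x -> exists k v, 0 <= v <= tau n (aq (odd k)) /\ x = y k + el k * v.
  move=> x0; have [k xk] := locate yoo x0; exists k, ((x - y k) / el k).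
  have [x1 x2] := andP xk; split; last first.
    by rewrite [_ * (_ / _)]mulrC divfK ?gt_eqF // addrC subrK.
  apply/andP; split; first by apply: divr_ge0; [rewrite subr_ge0|exact: ltW].
  by rewrite ler_pdivrMr // lerBlDl mulrC -yS.
have ex s : 0 <= s -> zq false <= expR (s + ln (zq false)).
  by move=> s0; rewrite -[X in X <= _](lnK w0) ler_expR lerDr.
exists (jshift (ln (zq false)) (pjet n F)), (ln rho); split.
- exact: ln_gt0.
- exact: psol_of_jsol w0 sF.
- move=> s s0; have [k [v [vT E]]] := pos_k _ (ex s s0); have [E1 tr] := st k v vT.
  split; first by apply: stateT_transversal (expR_gt0 _) _; rewrite E.
  exists (odd k), v; split => //; rewrite -E1 -E; exact: erefl.
- move=> s s0; have [k [v [vT E]]] := pos_k _ (ex s s0); have [E1 _] := st k v vT.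
  have vT2 : 0 <= v <= tau n (aq (odd k.+2)) by rewrite /= negbK.
  have [E2 _] := st k.+2 v vT2.
  transitivity (stateT n (expR (s + ln (zq false))) F (expR (s + ln (zq false)))); last by [].
  rewrite E E1; have -> : odd k = odd k.+2 by rewrite /= negbK.
  have Ey : y k.+2 + el k.+2 * v = rho * (y k + el k * v).
    rewrite cycle_el cycle_y; move: (expand n a) (expand n (ret n a)) (y k) (el k).
    by move=> r r' s' l; ring.
  rewrite -E2 Ey -E.
  transitivity (stateT n (expR (s + ln rho + ln (zq false))) F (expR (s + ln rho + ln (zq false)))); first by [].
  have -> : s + ln rho + ln (zq false) = ln rho + (s + ln (zq false)) by ring.
  by rewrite expRD lnK.
move=> q u uT; have qo : odd q = q by case: q {uT}.
have [E1 _] := st q u ltac:(by rewrite qo); rewrite qo in E1.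
have x0 : zq false <= y q + el q * u.
  have [u0 _] := andP uT.
  apply: (@le_trans _ _ (y q)); last by rewrite lerDl mulr_ge0 // ltW.
  by case: (q) => //; exact: ltW (yk_lt (zq false) n_gt0 n_lt2 ltr01 la 0).
have xp : 0 < y q + el q * u by exact: lt_le_trans x0.
exists (ln (y q + el q * u) - ln (zq false)).
  by rewrite subr_ge0 ler_ln.
rewrite -E1; transitivity (stateT n (expR (ln (y q + el q * u) - ln (zq false) + ln (zq false))) F
  (expR (ln (y q + el q * u) - ln (zq false) + ln (zq false)))); first by [].
by rewrite subrK lnK.
Qed.

End PeriodicOrbit.

Section Extensions.
Context {R : realType} (n : R).
Implicit Types (P Q : jet R) (b c d e s t x y T : R) (X : R * R * R).

Definition C2jet Q := [/\ forall s, is_derive s 1 (pos Q) (vel Q s),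
  forall s, is_derive s 1 (vel Q) (acc Q s) & continuous (acc Q)].

Lemma C2jet_state Q s : C2jet Q -> state (pos Q) s = stP Q s.
Proof.
move=> [D0 D1 _].
have E1 : derive1n 1 (pos Q) = vel Q.
  by apply/funext => t /=; rewrite derive1E; exact: derive_val.
have E2 : derive1n 2 (pos Q) = acc Q.
  rewrite /= -[X in derive1 X]/(derive1n 1 (pos Q)) E1.
  by apply/funext => t; rewrite derive1E; exact: derive_val.
by rewrite /state E1 E2.
Qed.

Lemma stPE P Q s t : stP P s = stP Q t -> [/\ pos P s = pos Q t, vel P s = vel Q t & acc P s = acc Q t].
Proof. by case. Qed.

(** The value at [s] is that of [P] at any sufficiently late translate of [s]. *)
Lemma periodic_extension P T : 0 < T -> (forall b, psol n 0 b P) ->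
  (forall s, 0 <= s -> transversal P s) -> (forall s, 0 <= s -> stP P (s + T) = stP P s) ->
  exists Q, [/\ C2jet Q, forall s, transversal Q s, forall x y, psol n x y Q,
    forall s, stP Q (s + T) = stP Q s &
    (forall s, 0 <= s -> stP Q s = stP P s) /\ forall s, exists2 t, 0 <= t & stP Q s = stP P t].
Proof.
move=> T0 sP tr per.
have perk (k : nat) s : 0 <= s -> stP P (s + k%:R * T) = stP P s.
  move=> s0; elim: k => [|k IH]; first by rewrite mul0r addr0.
  rewrite -natr1 mulrDl mul1r addrA per // addr_ge0 // mulr_ge0 //; exact: ltW.
have same2 (k k' : nat) s : 0 <= s + k%:R * T -> 0 <= s + k'%:R * T ->
    stP P (s + k%:R * T) = stP P (s + k'%:R * T).
  wlog : k k' / (k <= k')%N.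
    move=> H h h'; have [kk|/ltnW kk] := leqP k k'; first exact: (H k k').
    by symmetry; exact: (H k' k).
  move=> kk h h'.
  have -> : s + k'%:R * T = s + k%:R * T + (k' - k)%:R * T by rewrite natrB //; ring.
  by rewrite (perk (k' - k)%N _ h).
have far s : exists k : nat, 1 < s + k%:R * T.
  exists (Num.truncn ((1 + `|s|) / T)).+1.
  have := truncnS_gt ((1 + `|s|) / T); rewrite ltr_pdivrMr // => h.
  by have := ler_norm (- s); rewrite normrN; lra.
have [m Hm] := choice far.
pose Q := Jet (fun s => pos P (s + (m s)%:R * T)) (fun s => vel P (s + (m s)%:R * T))
  (fun s => acc P (s + (m s)%:R * T)).
have QE (k : nat) s : 0 <= s + k%:R * T -> stP Q s = stP P (s + k%:R * T).
  move=> h; transitivity (stP P (s + (m s)%:R * T)); first by [].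
  by apply: same2 => //; apply: ltW; exact: lt_trans ltr01 (Hm s).
have QE1 (k : nat) s : 0 <= s + k%:R * T -> [/\ pos Q s = pos P (s + k%:R * T),
  vel Q s = vel P (s + k%:R * T) & acc Q s = acc P (s + k%:R * T)] by move=> /QE/stPE.
(* Near each point [Q] is a fixed translate of [P]. *)
have loc s : [/\ is_derive s 1 (pos Q) (vel Q s), is_derive s 1 (vel Q) (acc Q s),
    {for s, continuous (acc Q)}, transversal Q s &
    pos Q s != 0 -> is_derive s 1 (acc Q) (- (lin3 n Q s + nonlin n (pos Q s)))].
  have h := Hm s; set k := m s in h; have [E0 E1 E2] := QE1 k s ltac:(lra).
  have [c0 c1 c2 D D2] := sP (s + k%:R * T + 1).
  have sk : 0 < s + k%:R * T < s + k%:R * T + 1 by lra.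
  have [d0 d1] := D _ sk.
  have nr t : `|t - s| < 1 -> 0 <= t + k%:R * T by rewrite ltr_norml; lra.
  have cp (f g : R -> R) d : (forall t, `|t - s| < 1 -> f t = g (t + k%:R * T)) ->
      is_derive (s + k%:R * T) 1 g d -> is_derive s 1 f d.
    move=> fg gd; apply: (@isD_near _ (fun t => g (t + k%:R * T))).
      by exists 1 => // t ts; rewrite fg.
    exact: isD_shift.
  split.
  - by rewrite E1; apply: cp d0 => t /nr/QE1[].
  - by rewrite E2; apply: cp d1 => t /nr/QE1[].
  - apply/contP => e e0; have [d dgt0 Hd] := (contP (acc P) _).1 (c2 (s + k%:R * T)) e e0.
    exists (Num.min d 1); first by rewrite lt_min dgt0 ltr01.
    move=> t; rewrite lt_min => /andP[td t1]; have [_ _ ->] := QE1 k t (nr t t1).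
    by rewrite E2; apply: Hd; rewrite opprD addrACA subrr addr0.
  - by rewrite /transversal E0 E1; apply: tr; lra.
  rewrite E0 => p0; have := D2 _ sk p0; rewrite /lin3 E0 E1 E2.
  by apply: cp => t /nr/QE1[].
have c0 : continuous (pos Q) by move=> s; have [D _ _ _ _] := loc s; apply: isD_cont D.
have c1 : continuous (vel Q) by move=> s; have [_ D _ _ _] := loc s; apply: isD_cont D.
have c2 : continuous (acc Q) by move=> s; have [_ _ D _ _] := loc s.
exists Q; split.
- by split=> // s; have [] := loc s.
- by move=> s; have [] := loc s.
- move=> x y; split => // s sxy; first by have [] := loc s.
  by have [] := loc s.
- move=> s; have h := Hm s; rewrite (QE (m s) s) ?(QE (m s) (s + T)); [|lra|lra].
  by rewrite addrAC per //; lra.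
split.
  by move=> s s0; rewrite (QE 0%N) mul0r addr0.
by move=> s; exists (s + (m s)%:R * T); [have := Hm s; lra|apply: QE; have := Hm s; lra].
Qed.

(** The second derivative is continued by a constant and integrated twice. *)
Lemma halfline_extension P : (forall b, psol n 0 b P) ->
  exists Q, C2jet Q /\ forall s, 0 <= s -> stP Q s = stP P s.
Proof.
move=> sP; have [c0 c1 c2 _ _] := sP 0.
have ca : continuous (fun s => acc P (Num.max s 0)) by apply: (cont_comp c2); exact: cont_max.
pose v s := vel P 0 + prim (fun s => acc P (Num.max s 0)) s.
have Dv s : is_derive s 1 v (acc P (Num.max s 0)).
  by apply: (isD_eq (isD_add (isD_cst _ s) (prim_derive s ca))); rewrite add0r.
have cv : continuous v by move=> s; exact: isD_cont (Dv s).
pose p s := pos P 0 + prim v s.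
have Dp s : is_derive s 1 p (v s).
  by apply: (isD_eq (isD_add (isD_cst _ s) (prim_derive s cv))); rewrite add0r.
have cp : continuous p by move=> s; exact: isD_cont (Dp s).
have vE s : 0 <= s -> v s = vel P s.
  move=> s0; apply/eqP; rewrite -subr_eq0.
  have -> : 0 = v 0 - vel P 0 by rewrite /v prim0 addr0 subrr.
  apply/eqP; apply: (@mvt_cst _ (fun t => v t - vel P t)) => //; first exact: cont_sub.
  move=> t ts; have [_ _ _ D _] := sP s; have [_ d1] := D t ts.
  apply: (isD_eq (isD_sub (Dv t) d1)); rewrite max_l ?subrr //; lra.
have pE s : 0 <= s -> p s = pos P s.
  move=> s0; apply/eqP; rewrite -subr_eq0.
  have -> : 0 = p 0 - pos P 0 by rewrite /p prim0 addr0 subrr.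
  apply/eqP; apply: (@mvt_cst _ (fun t => p t - pos P t)) => //; first exact: cont_sub.
  move=> t ts; have [_ _ _ D _] := sP s; have [d0 _] := D t ts.
  apply: (isD_eq (isD_sub (Dp t) d0)); rewrite vE ?subrr //; lra.
exists (Jet p v (fun s => acc P (Num.max s 0))); split; first by split.
by move=> s s0; rewrite /stP /= vE // pE // max_l.
Qed.

Lemma solution_of_halfline P : (forall b, psol n 0 b P) ->
  (forall s, 0 <= s -> transversal P s) ->
  exists psi, solution n `[0, +oo[ psi /\ state psi 0 = stP P 0.
Proof.
move=> sP tr; have [Q [C E]] := halfline_extension sP; have [D0 D1 c2] := C.
exists (pos Q); split; last by rewrite C2jet_state // E.
apply: solution_of_psol => //.
- move=> s; rewrite /= in_itv /= andbT => s0.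
  by have [E0 E1 _] := stPE (E s s0); rewrite /transversal E0 E1; exact: tr.
- move=> x y xy sub; have x0 : 0 <= x.
    by have := sub x; rewrite /= !in_itv /= lexx xy !andbT => /(_ isT).
  have q0 : continuous (pos Q) by move=> s; exact: isD_cont (D0 s).
  have q1 : continuous (vel Q) by move=> s; exact: isD_cont (D1 s).
  split => // s sxy p0.
  have [E0 E1 E2] := stPE (E s ltac:(lra)).
  have [_ _ _ _ D2] := sP (s + 1).
  rewrite E0 in p0; have D := D2 s ltac:(lra) p0.
  move: D; rewrite /lin3 E0 E1 E2; apply: isD_near; exists s; first lra.
  by move=> t; rewrite ltr_norml => ts; have [_ _ ->] := stPE (E t ltac:(lra)).
- move=> k; exists 0, k%:R; split; first exact: ler0n.
    by move=> s; rewrite /= !in_itv /= andbT => /andP[].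
  move=> s; rewrite /= in_itv /= andbT => s0; rewrite s0 ger0_norm //; exact: ltW.
- move=> s; rewrite /= in_itv /= andbT => s0 sne; have sp : 0 < s by rewrite lt_neqAle eq_sym sne.
  exists (s / 2), (s + 1); split; first lra.
  by move=> t; rewrite /= !in_itv /= andbT; lra.
Qed.

End Extensions.

Section Main.
Context {R : realType}.
Implicit Types (n a b e s t T u : R).

Lemma stable_periodic_solution n (n_gt0 : 0 < n) (n_lt2 : n < 2) : lands n 0 ->
  (forall a, a <= ret n 0 -> lands n a) ->
  exists phi : R -> R,
    solution n [set: R] phi /\ (exists s, phi s <> 0) /\
    (exists2 T : R, 0 < T & periodic phi T) /\
    ((exists s, 0 < phi s) /\ (exists s, phi s < 0)) /\ orbitally_stable n phi.
Proof.
move=> l0 lA; have [a [la0 la1 cyc stab]] := stable_two_cycle n_gt0 n_lt2 l0 lA.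
have [P [T [T0 sP HP per onto]]] := cycle_orbit n_gt0 n_lt2 la0 la1 cyc.
have trP s : 0 <= s -> transversal P s by move=> s0; have [] := HP s s0.
have [Q [C trQ sQ perQ [QP Qt]]] := periodic_extension T0 sP trP per.
have st s : state (pos Q) s = stP Q s by exact: C2jet_state.
have orbQ t : exists q u, 0 <= u <= tau n (arc_param n a q) /\ stP Q t = orb n a q u.
  by have [s s0 ->] := Qt t; have [_ H] := HP s s0.
have Qorb q u : 0 <= u <= tau n (arc_param n a q) -> exists t, stP Q t = orb n a q u.
  by move=> uT; have [s s0 E] := onto q u uT; exists s; rewrite QP.
have sgn q : exists s, 0 < @arc_sign R q * pos Q s.
  have t0 := tau_gt0 (laq la0 la1 q).
  have [s E] := Qorb q (tau n (arc_param n a q) / 2) ltac:(lra).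
  exists s; have -> : pos Q s = (stP Q s).1.1 by [].
  rewrite E orb_pos mulrA sqK mul1r mulr_gt0 //.
    by rewrite powR_gt0 // addr_gt0 ?(zq_gt0 n_gt0 n_lt2 la0 la1) //; lra.
  by have [_ _ _ Fp _] := arcP (laq la0 la1 q); apply: Fp; lra.
have [s1 p1] := sgn false; have [s2 p2] := sgn true.
rewrite /arc_sign expr0 mul1r in p1; rewrite /arc_sign expr1 mulN1r oppr_gt0 in p2.
exists (pos Q); split; [|split; [|split; [|split]]].
- have [D0 D1 c2] := C; apply: solution_of_psol => //.
  + move=> k; exists (- k%:R), k%:R; split => //.
      by have := ler0n R k; lra.
    by move=> s _; rewrite ltr_norml => /andP[/ltW -> /ltW ->].
  + by move=> s _ _; exists (s - 1), (s + 1); split => //; lra.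
- by exists s1; apply/eqP; rewrite gt_eqF.
- exists T => // s; have := perQ s; exact: (fun E => congr1 (fun X => X.1.1) E).
- by split; [exists s1|exists s2].
move=> e e0; have [d d0 H] := near_trajectory n_gt0 n_lt2 la0 la1 cyc stab e0.
exists d => // X [t]; rewrite st; have [q [u [uT ->]]] := orbQ t => Xu.
have [P' [sP' X0 tr' near']] := H q u X uT Xu; split.
  by have [psi [spsi E]] := solution_of_halfline sP' tr'; exists psi; rewrite E.
move=> S psi S0 spsi X0' s sS.
have E := @psol_uniq _ n P' (jet_of psi) S n_gt0 n_lt2 S0 (sP' S) (psol_of_solution spsi)
  (fun s sS => tr' s (andP sS).1).
have [E0 E1 E2] : same (jet_of psi) P' s.
  apply: E sS; have : state psi 0 = stP P' 0 by rewrite X0' X0.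
  by rewrite /state /stP => -[]; split.
have [q' [u' [u'T near]]] := near' s (andP sS).1.
have [t' E'] := Qorb q' u' u'T; exists t'; rewrite st E'.
have -> : state psi s = stP P' s by rewrite /state /stP -E0 -E1 -E2.
exact: near.
Qed.

Lemma sqrt3_lt2 : Num.sqrt 3 < 2 :> R.
Proof.
have -> : 2 = Num.sqrt (2 ^+ 2) :> R by rewrite sqrtr_sqr ger0_norm.
by rewrite ltr_sqrt; lra.
Qed.

End Main.

Theorem theorem5p4 (R : realType) :
  exists n_h : R, (3 / 2 < n_h /\ n_h < n_plus R) /\
    forall n : R, 0 < n -> n < n_h ->
      exists phi : R -> R,
        solution n [set: R] phi /\
        (exists s, phi s <> 0) /\
        (exists2 T : R, 0 < T & periodic phi T) /\
        ((exists s, 0 < phi s) /\ (exists s, phi s < 0)) /\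
        orbitally_stable n phi.
Proof.
have [A A1 HA] : exists2 A : R, 1 <= A & forall n, 3 / 2 <= n -> n <= 8 / 5 ->
    lands n 0 -> ret n 0 <= A.
  exists (2200 * 13200); last exact: ret_flat.
  rewrite -natrM ler1n muln_gt0 //.
pose e : R := (4 * (A + 1) ^+ 2)^-1.
have A2 : 0 < 4 * (A + 1) ^+ 2 by rewrite mulr_gt0 // exprn_gt0 //; lra.
have e0 : 0 < e by rewrite invr_gt0.
have eA : e * (2 * (A + 1) ^+ 2) = 1 / 2 by rewrite /e; field; lra.
have e16 : e <= 1 / 16.
  have h : 16 <= 4 * (A + 1) ^+ 2 by nra.
  by have := ler_wpM2l (ltW e0) h; rewrite {2}/e mulVf ?gt_eqF //; lra.
clearbody e.
have s3 := @sqrt3_lt2 R; have s30 : 0 <= Num.sqrt 3 :> R by exact: sqrtr_ge0.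
exists (3 / 2 + e / 2); split.
  split; first lra.
  by rewrite /n_plus ltr_pdivlMr; nra.
move=> n n_gt0 nh; have n_lt2 : n < 2 by lra.
have [n32|n32] := leP n (3 / 2).
  apply: stable_periodic_solution => //; first exact: lands_le32.
  by move=> a _; exact: lands_le32.
have la a : a <= A -> lands n a.
  move=> aA; have [a0|a0] := leP 0 a; last exact: lands_neg.
  apply: (@lands_gt1 _ _ a A e) => //; try lra.
have l0 : lands n 0 by apply: la; lra.
apply: stable_periodic_solution => // a ar; apply: la; apply: le_trans ar _.
by apply: HA => //; lra.
Qed.
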